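(* Let $K$ be an algebraically closed field of characteristic $2$ and let $A=\Lambda_9$. Then: (i) $\dim_K HH^0(A)=5$. (ii) $\dim_K HH^1(A)=1$. (iii) $\dim_K HH^2(A)=2$.
   Context: For a finite-dimensional $K$-algebra $A$, $HH^n(A)=\mathrm{Ext}^n_{A^e}(A,A)$ with $A^e=A^{\mathrm{op}}\otimes_K A$ is the $n$-th Hochschild cohomology space. Paths are composed from left to right ($\alpha\beta$ means first $\alpha$, then $\beta$). $\Lambda_9$ is the bound quiver algebra of the quiver with vertices $1,2,3,4$ and arrows $\alpha:1\to4$, $\beta:4\to1$, $\xi:2\to4$, $\varepsilon:4\to2$, $\gamma:3\to4$, $\delta:4\to3$, with relations $\beta\alpha+\varepsilon\xi+\delta\gamma=0$, $\xi\varepsilon=0$, $\gamma\delta=0$, $\alpha\beta=\alpha\delta\gamma\beta$. *)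

(* Defs.v *)
From HB Require Import structures.
From mathcomp Require Import all_boot all_algebra.
From mathcomp Require Import finmap monalg boolp functions.

Set Implicit Arguments.
Unset Strict Implicit.
Unset Printing Implicit Defensive.

Import GRing.Theory.
Local Open Scope ring_scope.
Local Open Scope quotient_scope.

Section LinExt.
Variables (R : nzRingType) (G : choiceType) (V : lmodType R).
Implicit Types (F : G -> V) (t : {malg R[G]}).

Definition lin_ext F t : V := \sum_(p <- msupp t) t@_p *: F p.

Lemma lin_extw (d : {fset G}) F t : fsubset (msupp t) d ->
  lin_ext F t = \sum_(p <- d) t@_p *: F p.
Proof.
move=> le; rewrite /lin_ext (big_fset_incl _ le) // => p _ /mcoeff_outdom ->.
by rewrite scale0r.
Qed.

Lemma lin_ext_is_linear F : linear (lin_ext F).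
Proof.
move=> a s t.
pose d := fsetU (msupp s) (msupp t).
have hs : fsubset (msupp s) d by apply: fsubsetUl.
have ht : fsubset (msupp t) d by apply: fsubsetUr.
have hst : fsubset (msupp (a *: s + t)) d.
  by apply: fsubset_trans (msuppD_le _ _) (fsetSU _ (msuppZ_le _ _)).
rewrite (lin_extw F hs) (lin_extw F ht) (lin_extw F hst).
rewrite scaler_sumr -big_split; apply: eq_bigr => p _ /=.
by rewrite mcoeffD mcoeffZ scalerDl scalerA.
Qed.

HB.instance Definition _ F :=
  GRing.isLinear.Build R {malg R[G]} V *:%R (lin_ext F) (lin_ext_is_linear F).

Lemma lin_extU F p : lin_ext F << p >> = F p.
Proof. by rewrite /lin_ext msuppU oner_eq0 big_seq_fset1 mcoeffUU scale1r. Qed.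

Lemma eq_lin_ext F F' t : F =1 F' -> lin_ext F t = lin_ext F' t.
Proof. by move=> e; apply: eq_bigr => p _; rewrite e. Qed.

Lemma lin_extD F F' t : lin_ext (fun p => F p + F' p) t = lin_ext F t + lin_ext F' t.
Proof. by rewrite -big_split; apply: eq_bigr => p _; rewrite scalerDr. Qed.

Lemma lin_ext0 t : lin_ext (fun _ => 0) t = 0 :> V.
Proof. by rewrite /lin_ext big1 // => p _; rewrite scaler0. Qed.
End LinExt.

Lemma linear_lin_ext (R : nzRingType) (G : choiceType) (V W : lmodType R)
  (f : {linear V -> W}) (F : G -> V) t :
  f (lin_ext F t) = lin_ext (f \o F) t.
Proof. by rewrite linear_sum; apply: eq_bigr => p _; rewrite linearZ. Qed.

Lemma lin_extUid (R : nzRingType) (G : choiceType) (t : {malg R[G]}) :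
  lin_ext (fun p => << p >> : {malg R[G]}) t = t.
Proof.
rewrite [RHS]monalgE; apply: eq_bigr => p _.
by apply/malgP => q; rewrite mcoeffZ !mcoeffU mulr_natr.
Qed.

Record submodule (R : pzRingType) (V : lmodType R) := Submodule {
  submodule_pred :> V -> Prop;
  submodule0 : submodule_pred 0;
  submoduleDZ : forall a x y,
    submodule_pred x -> submodule_pred y -> submodule_pred (a *: x + y)
}.

Section SubmoduleType.
Variables (R : pzRingType) (V : lmodType R) (S : submodule V).

Definition mem_sub : {pred V} := fun x => `[< S x >].

Lemma mem_subP x : reflect (S x) (x \in mem_sub).
Proof. exact: asboolP. Qed.

Fact mem_sub_closed : submod_closed mem_sub.
Proof.
split=> [|a x y /mem_subP Sx /mem_subP Sy]; apply/mem_subP.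
  exact: submodule0.
exact: submoduleDZ.
Qed.
HB.instance Definition _ := GRing.isSubmodClosed.Build R V mem_sub mem_sub_closed.

Definition sub_type := {x : V | x \in mem_sub}.
HB.instance Definition _ := [isSub of sub_type for @sval _ _].
HB.instance Definition _ := [Choice of sub_type by <:].
HB.instance Definition _ := [SubChoice_isSubLmodule of sub_type by <:].

Definition lquot := Quotient.quot mem_sub.
HB.instance Definition _ := GRing.Zmodule.on lquot.
HB.instance Definition _ := EqQuotient.on lquot.

Lemma lquotP (x y : V) : \pi_lquot x = \pi_lquot y <-> S (x - y).
Proof.
have e := Quotient.idealrBE mem_sub x y.
split=> h; last by apply/eqP; rewrite -e; apply/mem_subP.
by apply/mem_subP; rewrite e; apply/eqP.
Qed.

Lemma pi_lquot_surj (v : lquot) : exists x, v = \pi_lquot x.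
Proof. by exists (repr v); rewrite reprK. Qed.

Lemma pi_lquotD x y : \pi_lquot (x + y) = \pi_lquot x + \pi_lquot y.
Proof. exact: Quotient.pi_add. Qed.

Definition lquot_scale (a : R) (x : lquot) : lquot := \pi_lquot (a *: repr x).

Lemma pi_lquotZ_def a x : \pi_lquot (a *: x) = lquot_scale a (\pi_lquot x).
Proof.
apply/lquotP; rewrite -scalerBr -[_ *: _]addr0.
apply: submoduleDZ (submodule0 S).
by apply/lquotP; rewrite reprK.
Qed.

Fact lquot_scaleA a b v : lquot_scale a (lquot_scale b v) = lquot_scale (a * b) v.
Proof.
have [v' ->] := pi_lquot_surj v.
by rewrite -!pi_lquotZ_def scalerA. Qed.
Fact lquot_scale1 : left_id 1 lquot_scale.
Proof.
move=> v.
have [v' ->] := pi_lquot_surj v.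
by rewrite -!pi_lquotZ_def scale1r. Qed.
Fact lquot_scaleDr : right_distributive lquot_scale +%R.
Proof.
move=> a u v; have [u' ->] := pi_lquot_surj u.
have [v' ->] := pi_lquot_surj v.
by rewrite -!(pi_lquotZ_def, pi_lquotD) scalerDr.
Qed.
Fact lquot_scaleDl v : {morph lquot_scale^~ v : a b / a + b}.
Proof.
move=> a b; have [v' ->] := pi_lquot_surj v.
by rewrite -!(pi_lquotZ_def, pi_lquotD) scalerDl.
Qed.
HB.instance Definition _ := GRing.Zmodule_isLmodule.Build R lquot
  lquot_scaleA lquot_scale1 lquot_scaleDr lquot_scaleDl.

Lemma pi_lquotZ a x : \pi_lquot (a *: x) = a *: \pi_lquot x.
Proof. exact: pi_lquotZ_def. Qed.
End SubmoduleType.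

Record ideal (A : nzRingType) := Ideal {
  ideal_pred :> A -> Prop;
  ideal0 : ideal_pred 0;
  idealD : forall x y, ideal_pred x -> ideal_pred y -> ideal_pred (x + y);
  idealMl : forall a x, ideal_pred x -> ideal_pred (a * x);
  idealMr : forall x a, ideal_pred x -> ideal_pred (x * a);
  ideal_proper : ~ ideal_pred 1
}.

Section QuotientAlgebra.
Variables (K : comNzRingType) (A : algType K) (I : ideal A).

Fact ideal_submoduleDZ a x y : I x -> I y -> I (a *: x + y).
Proof. by move=> Ix; apply: idealD; rewrite -mulr_algl; apply: idealMl. Qed.
Definition ideal_submodule := Submodule (ideal0 I) ideal_submoduleDZ.

Definition aquot := lquot ideal_submodule.
HB.instance Definition _ := GRing.Lmodule.on aquot.
HB.instance Definition _ := EqQuotient.on aquot.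

Lemma aquotP (x y : A) : \pi_aquot x = \pi_aquot y <-> I (x - y).
Proof. exact: lquotP. Qed.
Lemma pi_aquot_surj (v : aquot) : exists x, v = \pi_aquot x.
Proof. exact: pi_lquot_surj. Qed.
Lemma pi_aquotD x y : \pi_aquot (x + y) = \pi_aquot x + \pi_aquot y.
Proof. exact: pi_lquotD. Qed.
Lemma pi_aquotZ a x : \pi_aquot (a *: x) = a *: \pi_aquot x.
Proof. exact: pi_lquotZ. Qed.

Definition aquot_mul (x y : aquot) : aquot := \pi_aquot (repr x * repr y).

Lemma pi_aquotM_def x y :
  \pi_aquot (x * y) = aquot_mul (\pi_aquot x) (\pi_aquot y).
Proof.
apply/aquotP; set x' := repr _; set y' := repr _.
have -> : x * y - x' * y' = (x - x') * y + x' * (y - y').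
  by rewrite mulrBl mulrBr addrA subrK.
by apply: idealD; [apply: idealMr | apply: idealMl]; apply/aquotP; rewrite reprK.
Qed.

Fact aquot_mulA : associative aquot_mul.
Proof.
move=> x y z; have [x' ->] := pi_aquot_surj x.
have [y' ->] := pi_aquot_surj y.
have [z' ->] := pi_aquot_surj z.
by rewrite -!pi_aquotM_def mulrA.
Qed.
Fact aquot_mul1x : left_id (\pi_aquot 1) aquot_mul.
Proof.
move=> x.
have [x' ->] := pi_aquot_surj x.
by rewrite -!pi_aquotM_def mul1r. Qed.
Fact aquot_mulx1 : right_id (\pi_aquot 1) aquot_mul.
Proof.
move=> x.
have [x' ->] := pi_aquot_surj x.
by rewrite -!pi_aquotM_def mulr1. Qed.
Fact aquot_mulDl : left_distributive aquot_mul +%R.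
Proof.
move=> x y z; have [x' ->] := pi_aquot_surj x.
have [y' ->] := pi_aquot_surj y.
have [z' ->] := pi_aquot_surj z.
by rewrite -!(pi_aquotM_def, pi_aquotD) mulrDl.
Qed.
Fact aquot_mulDr : right_distributive aquot_mul +%R.
Proof.
move=> x y z; have [x' ->] := pi_aquot_surj x.
have [y' ->] := pi_aquot_surj y.
have [z' ->] := pi_aquot_surj z.
by rewrite -!(pi_aquotM_def, pi_aquotD) mulrDr.
Qed.
Fact aquot_1neq0 : \pi_aquot 1 != 0.
Proof.
apply/eqP => e; apply: (@ideal_proper _ I); rewrite -[1]subr0; apply/aquotP.
rewrite e -[0 in RHS](scale0r (1 : A)) pi_aquotZ.
by rewrite scale0r.
Qed.
HB.instance Definition _ := GRing.Zmodule_isNzRing.Build aquot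
  aquot_mulA aquot_mul1x aquot_mulx1 aquot_mulDl aquot_mulDr aquot_1neq0.

Lemma pi_aquotM x y : \pi_aquot (x * y) = \pi_aquot x * \pi_aquot y.
Proof. exact: pi_aquotM_def. Qed.
Lemma pi_aquot1 : \pi_aquot 1 = 1.
Proof. by []. Qed.

Fact aquot_scaleAl (a : K) (u v : aquot) : a *: (u * v) = (a *: u) * v.
Proof.
have [u' ->] := pi_aquot_surj u.
have [v' ->] := pi_aquot_surj v.
by rewrite -pi_aquotM -!pi_aquotZ -pi_aquotM scalerAl.
Qed.
HB.instance Definition _ := GRing.Lmodule_isLalgebra.Build K aquot aquot_scaleAl.
Fact aquot_scaleAr (a : K) (u v : aquot) : a *: (u * v) = u * (a *: v).
Proof.
have [u' ->] := pi_aquot_surj u.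
have [v' ->] := pi_aquot_surj v.
by rewrite -pi_aquotM -!pi_aquotZ -pi_aquotM scalerAr.
Qed.
HB.instance Definition _ := GRing.Lalgebra_isAlgebra.Build K aquot aquot_scaleAr.
End QuotientAlgebra.

Inductive ideal_gen (A : nzRingType) (rel : A -> Prop) : A -> Prop :=
| ideal_gen0 : ideal_gen rel 0
| ideal_genS a r b x :
    rel r -> ideal_gen rel x -> ideal_gen rel (a * r * b + x).

Lemma ideal_genD (A : nzRingType) (rel : A -> Prop) x y :
  ideal_gen rel x -> ideal_gen rel y -> ideal_gen rel (x + y).
Proof.
by elim=> [|a r b z rr _ IH] Iy; rewrite ?add0r // -addrA; apply: ideal_genS; auto.
Qed.

Lemma ideal_genMl (A : nzRingType) (rel : A -> Prop) c x :
  ideal_gen rel x -> ideal_gen rel (c * x).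
Proof.
elim=> [|a r b z rr _ IH]; rewrite ?mulr0 ?mulrDr; first exact: ideal_gen0.
by rewrite !mulrA; apply: ideal_genS.
Qed.

Lemma ideal_genMr (A : nzRingType) (rel : A -> Prop) x c :
  ideal_gen rel x -> ideal_gen rel (x * c).
Proof.
elim=> [|a r b z rr _ IH]; rewrite ?mul0r ?mulrDl; first exact: ideal_gen0.
by rewrite -mulrA; apply: ideal_genS.
Qed.

Definition gen_ideal (A : nzRingType) (rel : A -> Prop)
    (h : ~ ideal_gen rel 1) : ideal A :=
  Ideal (ideal_gen0 rel) (@ideal_genD A rel) (@ideal_genMl A rel)
    (@ideal_genMr A rel) h.

(* A small category with finitely many objects, given by its morphisms:
   [cat_comp p q] is the composite "first p, then q" when it is defined, and
   [cat_ids] lists the identity morphisms. *)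
Record fincat := FinCat {
  mor :> choiceType;
  cat_comp : mor -> mor -> option mor;
  cat_ids : seq mor;
  cat_ids_uniq : uniq cat_ids;
  cat_ids_neq0 : cat_ids != [::];
  cat_compA : forall p q r,
    obind (cat_comp^~ r) (cat_comp p q) = obind (cat_comp p) (cat_comp q r);
  cat_idl : forall p, exists2 e, e \in cat_ids &
    forall e', e' \in cat_ids -> cat_comp e' p = if e' == e then Some p else None;
  cat_idr : forall p, exists2 e, e \in cat_ids &
    forall e', e' \in cat_ids -> cat_comp p e' = if e' == e then Some p else None
}.

(* The category algebra: the K-space with basis the morphisms, the product of
   two morphisms being their composite if it is defined and 0 otherwise.  For
   a category with one object this is the monoid algebra. *)
Definition catalg (K : comNzRingType) (C : fincat) := {malg K[mor C]}.

Section CategoryAlgebra.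
Variables (K : comNzRingType) (C : fincat).
Local Notation KC := (catalg K C).
Implicit Types (p q r e : C) (f g h : KC).

HB.instance Definition _ := GRing.Lmodule.on KC.

Definition cbase p : KC := << p >>.
Definition obase (o : option C) : KC := if o is Some p then cbase p else 0.

Definition catmull p g : KC := lin_ext (fun q => obase (cat_comp p q)) g.
Definition catmul f g : KC := lin_ext (catmull^~ g) f.
Definition catone : KC := \sum_(e <- cat_ids C) cbase e.

Lemma catalgE f : f = lin_ext (cbase : C -> {malg K[mor C]}) f.
Proof. by rewrite lin_extUid. Qed.

Lemma catmullE p g : catmul (cbase p) g = catmull p g.
Proof. exact: lin_extU. Qed.

Lemma catmulUU p q : catmul (cbase p) (cbase q) = obase (cat_comp p q).
Proof. by rewrite catmullE; exact: lin_extU. Qed.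

Definition catmulr g f := catmul f g.

Fact catmul_linearl g : linear (catmulr g).
Proof. by move=> a x y; rewrite /catmulr /catmul linearP. Qed.

Fact catmul_linearr f : linear (catmul f).
Proof.
move=> a x y; rewrite /catmul /lin_ext scaler_sumr -big_split.
apply: eq_bigr => p _ /=.
by rewrite /catmull linearP scalerDr !scalerA mulrC.
Qed.

HB.instance Definition _ g :=
  GRing.isLinear.Build K KC KC *:%R (catmulr g) (catmul_linearl g).
HB.instance Definition _ f :=
  GRing.isLinear.Build K KC KC *:%R (catmul f) (catmul_linearr f).

Lemma catmul_obase p (o : option C) :
  catmul (cbase p) (obase o) = obase (obind (cat_comp p) o).
Proof. by case: o => [q|] /=; rewrite ?catmulUU ?linear0. Qed.

Fact catmulA : associative catmul.
Proof.
move=> f g h.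
rewrite -[RHS]/(catmulr h (lin_ext (catmull^~ g) f)) [RHS]linear_lin_ext.
apply: eq_lin_ext => p /=.
rewrite -catmullE -[RHS]/(catmulr h (lin_ext _ g)) [RHS]linear_lin_ext.
rewrite [LHS](linear_lin_ext (catmul (cbase p))).
apply: eq_lin_ext => q /=.
rewrite (linear_lin_ext (catmul (cbase p))) /=.
transitivity (lin_ext (fun r : C => obase (obind (@cat_comp C ^~ r) (cat_comp p q))) h).
  by apply: eq_lin_ext => r /=; rewrite catmul_obase cat_compA.
rewrite /catmulr; case: (cat_comp p q) => [s|] /=; first by rewrite catmullE.
by rewrite lin_ext0 -[RHS]/(catmulr h 0) linear0.
Qed.

Lemma sum_obase (o : C -> option C) e p : e \in cat_ids C ->
  (forall e', e' \in cat_ids C -> o e' = if e' == e then Some p else None) ->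
  \sum_(e' <- cat_ids C) obase (o e') = cbase p.
Proof.
move=> ein oE; rewrite (bigD1_seq e) ?cat_ids_uniq //= oE // eqxx.
rewrite big_seq_cond big1 ?addr0 // => e' /andP[e'in ne].
by rewrite oE // (negPf ne).
Qed.

Fact catmul1x : left_id catone catmul.
Proof.
move=> f; rewrite [X in catmul _ X]catalgE linear_lin_ext [RHS]catalgE.
apply: eq_lin_ext => p /=; rewrite -[LHS]/(catmulr (cbase p) catone) linear_sum.
have [e ein eP] := cat_idl p; rewrite -[RHS](sum_obase ein eP).
by apply: eq_bigr => e' _; rewrite /= /catmulr catmulUU.
Qed.

Fact catmulx1 : right_id catone catmul.
Proof.
move=> f; rewrite [X in catmul X _]catalgE -[LHS]/(catmulr catone _).
rewrite linear_lin_ext [RHS]catalgE.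
apply: eq_lin_ext => p /=; rewrite /catmulr linear_sum.
have [e ein eP] := cat_idr p; rewrite -[RHS](sum_obase ein eP).
by apply: eq_bigr => e' _; rewrite /= catmulUU.
Qed.

Fact catmulDl : left_distributive catmul +%R.
Proof. by move=> f g h; rewrite -[LHS]/(catmulr h _) linearD. Qed.

Fact catmulDr : right_distributive catmul +%R.
Proof. by move=> f g h; rewrite linearD. Qed.

Lemma mcoeff_catone e : e \in cat_ids C -> (catone : {malg K[mor C]})@_e = 1.
Proof.
move=> ein; rewrite /catone (bigD1_seq e) ?cat_ids_uniq //= mcoeffD mcoeffU eqxx.
rewrite raddf_sum /= big1 ?addr0 // => e' ne.
by rewrite /cbase mcoeffU (negPf ne).
Qed.

Fact catone_neq0 : catone != 0.
Proof.
have [e ein] : exists e, e \in cat_ids C.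
  by case: (cat_ids C) (cat_ids_neq0 C) => // e s _; exists e; rewrite mem_head.
apply: contra_eq_neq (mcoeff_catone ein) => ->.
by rewrite mcoeff0 eq_sym oner_neq0.
Qed.

HB.instance Definition _ := GRing.Zmodule_isNzRing.Build KC
  catmulA catmul1x catmulx1 catmulDl catmulDr catone_neq0.

Fact cat_scaleAl (a : K) f g : a *: (f * g) = (a *: f) * g.
Proof. by rewrite -[RHS]/(catmulr g (a *: f)) linearZ. Qed.
HB.instance Definition _ := GRing.Lmodule_isLalgebra.Build K KC cat_scaleAl.
Fact cat_scaleAr (a : K) f g : a *: (f * g) = f * (a *: g).
Proof. by rewrite -[RHS]/(catmul f (a *: g)) linearZ. Qed.
HB.instance Definition _ := GRing.Lalgebra_isAlgebra.Build K KC cat_scaleAr.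

Lemma cbaseM p q : cbase p * cbase q = obase (cat_comp p q).
Proof. exact: catmulUU. Qed.
End CategoryAlgebra.

Record quiver := Quiver {
  vertex : finType;
  arrow : finType;
  source : arrow -> vertex;
  target : arrow -> vertex;
  vertex0 : vertex
}.

Section PathCategory.
Variable Q : quiver.

Fixpoint is_path (v : vertex Q) (s : seq (arrow Q)) : bool :=
  if s is a :: s' then (source a == v) && is_path (target a) s' else true.

(* A path is a starting vertex with a sequence of composable arrows, listed in
   the order in which they are followed; the empty sequence gives the trivial
   path at the vertex. *)
Definition qpath := {p : vertex Q * seq (arrow Q) | is_path p.1 p.2}.
HB.instance Definition _ := SubChoice.on qpath.

Definition path_start (p : qpath) : vertex Q := (val p).1.
Definition path_end (p : qpath) : vertex Q :=
  last (val p).1 [seq target a | a <- (val p).2].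

Definition trivial_path (v : vertex Q) : qpath :=
  exist (fun p => is_path p.1 p.2) (v, [::]) isT.

Fact arrow_path_proof (a : arrow Q) : is_path (source a) [:: a].
Proof. by rewrite /= eqxx. Qed.
Definition arrow_path (a : arrow Q) : qpath :=
  exist (fun p => is_path p.1 p.2) (source a, [:: a]) (arrow_path_proof a).

Lemma is_path_cat v s t :
  is_path v (s ++ t) = is_path v s && is_path (last v [seq target a | a <- s]) t.
Proof. by elim: s v => //= a s IH v; rewrite IH andbA. Qed.

Definition path_comp (p q : qpath) : option qpath :=
  if path_end p == path_start q then
    (insub (path_start p, (val p).2 ++ (val q).2) : option qpath)
  else None.

Variant path_comp_spec (p q : qpath) : bool -> option qpath -> Prop :=
| PathComp (r : qpath) of path_end p = path_start q
    & val r = (path_start p, (val p).2 ++ (val q).2) :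
    path_comp_spec p q true (Some r)
| PathNoComp of path_end p <> path_start q : path_comp_spec p q false None.

Lemma path_compP p q :
  path_comp_spec p q (path_end p == path_start q) (path_comp p q).
Proof.
rewrite /path_comp; case: eqP => [e|]; last by constructor.
case: insubP => [r _ rE|]; first by constructor.
by rewrite is_path_cat (valP p) -/(path_end p) e (valP q).
Qed.

Fact path_compA p q r :
  obind (path_comp^~ r) (path_comp p q) = obind (path_comp p) (path_comp q r).
Proof.
case: (path_compP p q) => [x epq xE|npq]; case: (path_compP q r) => [y eqr yE|nqr] //=.
- have ex : path_end x = path_end q.
    by rewrite /path_end xE /= map_cat last_cat -/(path_end p) epq.
  have sy : path_start y = path_start q by rewrite /path_start yE.
  case: path_compP => [u _ uE|]; last by rewrite ex eqr.
  case: path_compP => [w _ wE|]; last by rewrite sy epq.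
  by congr Some; apply: val_inj; rewrite uE wE /path_start xE yE /= catA.
- have ex : path_end x = path_end q.
    by rewrite /path_end xE /= map_cat last_cat -/(path_end p) epq.
  by case: path_compP => [u|//]; rewrite ex.
- have sy : path_start y = path_start q by rewrite /path_start yE.
  by case: path_compP => [u|//]; rewrite sy.
Qed.

Definition trivial_paths := [seq trivial_path v | v <- enum (vertex Q)].

Fact trivial_path_inj : injective trivial_path.
Proof. by move=> u v [->]. Qed.

Fact trivial_paths_uniq : uniq trivial_paths.
Proof. by rewrite map_inj_uniq ?enum_uniq //; exact: trivial_path_inj. Qed.

Fact mem_trivial_paths v : trivial_path v \in trivial_paths.
Proof. by apply: map_f; rewrite mem_enum. Qed.

Fact trivial_paths_neq0 : trivial_paths != [::].
Proof. by apply: contraTneq (mem_trivial_paths (vertex0 Q)) => ->. Qed.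

Fact path_idl p : exists2 e, e \in trivial_paths &
  forall e', e' \in trivial_paths -> path_comp e' p = if e' == e then Some p else None.
Proof.
exists (trivial_path (path_start p)); first exact: mem_trivial_paths.
move=> _ /mapP[v _ ->]; rewrite (inj_eq trivial_path_inj).
case: path_compP => [r /= e rE|ne].
  2: by case: (v =P path_start p) => // e; case: ne.
congr Some; apply: val_inj; rewrite [LHS]rE.
by rewrite -[path_start _]/(path_end (trivial_path v)) e [RHS]surjective_pairing.
Qed.

Fact path_idr p : exists2 e, e \in trivial_paths &
  forall e', e' \in trivial_paths -> path_comp p e' = if e' == e then Some p else None.
Proof.
exists (trivial_path (path_end p)); first exact: mem_trivial_paths.
move=> _ /mapP[v _ ->]; rewrite (inj_eq trivial_path_inj).
case: path_compP => [r /= -> rE|ne].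
  2: by case: (v =P path_end p) => // e; case: ne; rewrite e.
rewrite eqxx; congr Some; apply: val_inj; rewrite [LHS]rE cats0.
by rewrite [RHS]surjective_pairing.
Qed.

Definition path_cat := FinCat trivial_paths_uniq trivial_paths_neq0
  path_compA path_idl path_idr.
End PathCategory.

(* The path algebra KQ; its product [p * q] is "first p, then q". *)
Definition path_algebra (K : comNzRingType) (Q : quiver) := catalg K (path_cat Q).
HB.instance Definition _ (K : comNzRingType) (Q : quiver) :=
  GRing.Algebra.on (path_algebra K Q).

Section PathAlgebra.
Variables (K : comNzRingType) (Q : quiver).
Local Notation KQ := (path_algebra K Q).

Definition path_elt (p : qpath Q) : KQ := cbase K (p : path_cat Q).
Definition arrow_elt (a : arrow Q) : KQ := path_elt (arrow_path a).

Definition trivial_coeff (v : vertex Q) (f : KQ) : K :=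
  (f : {malg K[mor (path_cat Q)]})@_(trivial_path v).

Lemma trivial_coeff0 v : trivial_coeff v 0 = 0.
Proof. exact: mcoeff0. Qed.
Lemma trivial_coeffD v f g :
  trivial_coeff v (f + g) = trivial_coeff v f + trivial_coeff v g.
Proof. exact: mcoeffD. Qed.
Lemma trivial_coeffB v f g :
  trivial_coeff v (f - g) = trivial_coeff v f - trivial_coeff v g.
Proof. exact: mcoeffB. Qed.
Lemma trivial_coeff1 v : trivial_coeff v 1 = 1.
Proof. exact: (@mcoeff_catone K (path_cat Q) _ (mem_trivial_paths v)). Qed.

Lemma trivial_coeff_path v p : trivial_coeff v (path_elt p) = (p == trivial_path v)%:R.
Proof. by rewrite /trivial_coeff /path_elt /cbase mcoeffU. Qed.

Lemma trivial_coeff_arrow v a : trivial_coeff v (arrow_elt a) = 0.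
Proof. by rewrite trivial_coeff_path; case: eqP => // /(congr1 val). Qed.

Lemma trivial_coeff_lin_ext v (F : qpath Q -> KQ) (t : {malg K[qpath Q]}) :
  trivial_coeff v (lin_ext F t) = \sum_(p <- msupp t) t@_p * trivial_coeff v (F p).
Proof.
rewrite /trivial_coeff raddf_sum; apply: eq_bigr => p _.
exact: mcoeffZ.
Qed.

Lemma trivial_coeffE v (f : {malg K[qpath Q]}) :
  \sum_(p <- msupp f) f@_p * (p == trivial_path v)%:R = trivial_coeff v f.
Proof.
rewrite [in RHS](catalgE (C := path_cat Q) f) trivial_coeff_lin_ext.
by apply: eq_bigr => p _; rewrite trivial_coeff_path.
Qed.

Lemma trivial_coeff_comp v (p q : qpath Q) :
  trivial_coeff v (obase K (path_comp p q : option (path_cat Q))) =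
    (p == trivial_path v)%:R * (q == trivial_path v)%:R.
Proof.
rewrite -natrM mulnb; case: path_compP => [r e rE|ne] /=.
  rewrite [LHS]trivial_coeff_path; congr (_%:R); congr nat_of_bool.
  apply/eqP/andP => [rv|[/eqP pv /eqP qv]].
    move: rE; rewrite rv /path_start => -[vE /esym/nilP].
    rewrite /nilp size_cat addn_eq0 => /andP[/nilP pnil /nilP qnil].
    have pE : p = trivial_path v.
      by apply: val_inj; rewrite [LHS]surjective_pairing pnil /= vE.
    split; first exact/eqP.
    apply/eqP/val_inj; rewrite [LHS]surjective_pairing qnil /=.
    by rewrite -[(sval q).1]/(path_start q) -e pE.
  by apply: val_inj; rewrite [LHS]rE pv qv.
rewrite [LHS]trivial_coeff0; case: andP => // -[/eqP pv /eqP qv].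
by case: ne; rewrite pv qv.
Qed.

Lemma trivial_coeffM v f g :
  trivial_coeff v (f * g) = trivial_coeff v f * trivial_coeff v g.
Proof.
rewrite -[f * g]/(lin_ext (@catmull K (path_cat Q) ^~ g) f).
rewrite trivial_coeff_lin_ext -[in RHS]trivial_coeffE mulr_suml.
apply: eq_bigr => p _; rewrite -mulrA; congr (_ * _).
rewrite trivial_coeff_lin_ext -trivial_coeffE mulr_sumr.
apply: eq_bigr => q _; rewrite mulrCA; congr (_ * _).
exact: trivial_coeff_comp.
Qed.

Lemma trivial_coeff_arrowM v a f : trivial_coeff v (f * arrow_elt a) = 0.
Proof. by rewrite trivial_coeffM trivial_coeff_arrow mulr0. Qed.

Lemma trivial_coeff_ideal v (rel : KQ -> Prop) :
  (forall r, rel r -> trivial_coeff v r = 0) ->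
  forall x, ideal_gen rel x -> trivial_coeff v x = 0.
Proof.
move=> h x; elim=> [|a r b y rr _ IH]; first exact: trivial_coeff0.
by rewrite trivial_coeffD IH addr0 !trivial_coeffM (h r rr) mulr0 mul0r.
Qed.
End PathAlgebra.

(* A quiver with relations; the relations have to lie in the ideal spanned by
   the paths of positive length. *)
Record bound_quiver (K : comNzRingType) := BoundQuiver {
  bq_quiver : quiver;
  bq_rel : path_algebra K bq_quiver -> Prop;
  bq_relP : forall r, bq_rel r -> forall v, trivial_coeff v r = 0
}.

Fact bound_quiver_proper (K : comNzRingType) (Q : bound_quiver K) :
  ~ ideal_gen (@bq_rel K Q) 1.
Proof.
move/(trivial_coeff_ideal (fun r rr => bq_relP rr (vertex0 _)))/eqP.
by rewrite trivial_coeff1 oner_eq0.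
Qed.

Definition bound_quiver_algebra (K : comNzRingType) (Q : bound_quiver K) :=
  aquot (A := path_algebra K (bq_quiver Q)) (gen_ideal (@bound_quiver_proper K Q)).
HB.instance Definition _ (K : comNzRingType) (Q : bound_quiver K) :=
  GRing.Algebra.on (bound_quiver_algebra Q).

Section EnvelopingAlgebra.
Variables (K : comNzRingType) (A : algType K).

(* The monoid A^op x A as a category with one object. *)
Definition opp_pair := (A^c * A)%type.
HB.instance Definition _ := Choice.on opp_pair.

Definition opp_pair_mul (p q : opp_pair) : option opp_pair :=
  Some (p.1 * q.1, p.2 * q.2).

Fact opp_pair_mulA p q r :
  obind (opp_pair_mul^~ r) (opp_pair_mul p q) =
  obind (opp_pair_mul p) (opp_pair_mul q r).
Proof. by rewrite /opp_pair_mul /= !mulrA. Qed.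

Definition opp_pair1 : opp_pair := (1, 1).

Fact opp_pair_idl p : exists2 e, e \in [:: opp_pair1] &
  forall e', e' \in [:: opp_pair1] ->
    opp_pair_mul e' p = if e' == e then Some p else None.
Proof.
exists opp_pair1; rewrite ?mem_head // => e'; rewrite inE => /eqP ->.
by rewrite eqxx /opp_pair_mul !mul1r; case: p.
Qed.

Fact opp_pair_idr p : exists2 e, e \in [:: opp_pair1] &
  forall e', e' \in [:: opp_pair1] ->
    opp_pair_mul p e' = if e' == e then Some p else None.
Proof.
exists opp_pair1; rewrite ?mem_head // => e'; rewrite inE => /eqP ->.
by rewrite eqxx /opp_pair_mul !mulr1; case: p.
Qed.

Definition env_cat := FinCat (isT : uniq [:: opp_pair1]) isT
  opp_pair_mulA opp_pair_idl opp_pair_idr.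
Local Notation KAA := (catalg K env_cat).

Definition pair_elt (a b : A) : KAA := cbase K ((a, b) : env_cat).

Inductive tensor_rel : KAA -> Prop :=
| tensor_Dl a a' b :
    tensor_rel (pair_elt (a + a') b - pair_elt a b - pair_elt a' b)
| tensor_Dr a b b' :
    tensor_rel (pair_elt a (b + b') - pair_elt a b - pair_elt a b')
| tensor_Zl k a b : tensor_rel (pair_elt (k *: a) b - k *: pair_elt a b)
| tensor_Zr k a b : tensor_rel (pair_elt a (k *: b) - k *: pair_elt a b).

Definition act_pair (x : A) (p : opp_pair) : A := p.2 * x * (p.1 : A).
Definition act (x : A) (t : KAA) : A := lin_ext (act_pair x) t.

Fact act_linear x : linear (act x).
Proof. by move=> k s t; rewrite /act linearP. Qed.
HB.instance Definition _ x :=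
  GRing.isLinear.Build K KAA A *:%R (act x) (act_linear x).

Lemma act_elt x a b : act x (pair_elt a b) = b * x * a.
Proof. exact: lin_extU. Qed.

Lemma actD x y t : act (x + y) t = act x t + act y t.
Proof.
rewrite /act -lin_extD; apply: eq_lin_ext => p.
by rewrite /act_pair mulrDr mulrDl.
Qed.

Lemma actZ k x t : act (k *: x) t = k *: act x t.
Proof.
rewrite /act /lin_ext scaler_sumr; apply: eq_bigr => p _.
by rewrite /act_pair -scalerAr -scalerAl !scalerA mulrC.
Qed.

Fact actr_linear t : linear (act^~ t).
Proof. by move=> k x y; rewrite actD actZ. Qed.

Definition actr t x := act x t.
HB.instance Definition _ t := GRing.isLinear.Build K A A *:%R (actr t) (actr_linear t).

Lemma act1 x : act x 1 = x.
Proof.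
have -> : 1 = pair_elt 1 1 by rewrite -[LHS]/(catone K env_cat) /catone big_seq1.
by rewrite act_elt mul1r mulr1.
Qed.

Lemma actM x s t : act x (s * t) = act (act x t) s.
Proof.
rewrite -[s * t]/(lin_ext (@catmull K env_cat ^~ t) s).
rewrite (linear_lin_ext (act x)); apply: eq_lin_ext => p /=.
rewrite /catmull (linear_lin_ext (act x)) /act_pair [act x t]/lin_ext.
rewrite mulr_sumr mulr_suml; apply: eq_bigr => q _ /=.
rewrite -scalerAr -scalerAl; congr (_ *: _).
by rewrite [LHS]act_elt /act_pair !mulrA.
Qed.

Lemma act_tensor_rel x r : tensor_rel r -> act x r = 0.
Proof.
case=> [a a' b|a b b'|k a b|k a b]; rewrite !(linearB, linearZ) /= !act_elt.
- by rewrite mulrDr addrAC addrK subrr.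
- by rewrite !mulrDl addrAC addrK subrr.
- by rewrite -scalerAr scalerN subrr.
- by rewrite -!scalerAl scalerN subrr.
Qed.

Lemma act_ideal x t : ideal_gen tensor_rel t -> act x t = 0.
Proof.
move=> It; elim: It x => [|a r b y rr _ IH] x; first exact: linear0.
by rewrite linearD /= IH addr0 !actM (act_tensor_rel _ rr) -[LHS]/(actr a 0) linear0.
Qed.

Fact env_proper : ~ ideal_gen tensor_rel 1.
Proof. by move/(act_ideal 1)/eqP; rewrite act1 oner_eq0. Qed.

(* The enveloping algebra A^op (x) A, that is, the algebra of the monoid
   A^op x A modulo bilinearity. *)
Definition env := aquot (A := KAA) (gen_ideal env_proper).
HB.instance Definition _ := GRing.Algebra.on env.
HB.instance Definition _ := EqQuotient.on env.

Definition tensor (a b : A) : env := \pi_env (pair_elt a b).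

(* [A] as a left module over A^op (x) A, the action being
   (a (x) b) . x = b x a. *)
Definition bimod := (A : Type).
HB.instance Definition _ := GRing.Zmodule.on bimod.

Definition bimod_scale (t : env) (x : bimod) : bimod := act x (repr t).

Lemma bimod_scale_pi t x : bimod_scale (\pi_env t) x = act x t.
Proof.
apply/eqP; rewrite -subr_eq0 -linearB; apply/eqP/act_ideal.
by apply/(aquotP (gen_ideal env_proper)); rewrite reprK.
Qed.

Fact bimod_scaleA s t x :
  bimod_scale s (bimod_scale t x) = bimod_scale (s * t) x.
Proof.
have [s' ->] := pi_aquot_surj s; have [t' ->] := pi_aquot_surj t.
by rewrite -pi_aquotM !bimod_scale_pi actM.
Qed.

Fact bimod_scale1 : left_id 1 bimod_scale.
Proof. by move=> x; rewrite -[1]pi_aquot1 bimod_scale_pi act1. Qed.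

Fact bimod_scaleDr : right_distributive bimod_scale +%R.
Proof. by move=> t x y; exact: actD. Qed.

Fact bimod_scaleDl x : {morph bimod_scale^~ x : s t / s + t}.
Proof.
move=> s t; have [s' ->] := pi_aquot_surj s; have [t' ->] := pi_aquot_surj t.
by rewrite -pi_aquotD !bimod_scale_pi linearD.
Qed.

HB.instance Definition _ := GRing.Zmodule_isLmodule.Build env bimod
  bimod_scaleA bimod_scale1 bimod_scaleDr bimod_scaleDl.

Lemma tensor_scale a b (x : bimod) : tensor a b *: x = b * (x : A) * a :> A.
Proof. by rewrite -[LHS]/(bimod_scale _ x) bimod_scale_pi act_elt. Qed.
End EnvelopingAlgebra.

Section Kernel.
Variables (R : pzRingType) (U V : lmodType R) (f : {linear U -> V}).

Fact ker_DZ a x y : f x = 0 -> f y = 0 -> f (a *: x + y) = 0.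
Proof. by move=> fx fy; rewrite linearP fx fy scaler0 addr0. Qed.

Definition ker : submodule U := Submodule (linear0 f) ker_DZ.
End Kernel.

Definition projective (R : pzRingType) (P : lmodType R) : Prop :=
  forall (B C : lmodType R) (g : {linear B -> C}) (f : {linear P -> C}),
    (forall c, exists b, g b = c) ->
    exists h : {linear P -> B}, forall x, g (h x) = f x.

Record proj_resolution (R : pzRingType) (M : lmodType R) := ProjResolution {
  res_mod : nat -> lmodType R;
  res_d : forall n, {linear res_mod n.+1 -> res_mod n};
  res_aug : {linear res_mod 0 -> M};
  res_projective : forall n, projective (res_mod n);
  res_aug_surj : forall m, exists x, res_aug x = m;
  res_exact0 : forall x, res_aug x = 0 <-> exists y, res_d 0 y = x;
  res_exact : forall n x, res_d n x = 0 <-> exists y, res_d n.+1 y = x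
}.

Section FreeResolution.
Variable R : nzRingType.

Definition free_mod (M : lmodType R) : lmodType R := {malg R[M]}.

Lemma free_projective M : projective (free_mod M).
Proof.
move=> B C g f g_surj.
have [s sE] := choice (fun m : M => g_surj (f (<< m >> : {malg R[M]}))).
exists (lin_ext s) => t.
rewrite linear_lin_ext -[in RHS](lin_extUid t) linear_lin_ext.
by apply: eq_lin_ext => m /=; rewrite sE.
Qed.

Definition free_eval (M : lmodType R) : {linear free_mod M -> M} :=
  lin_ext (fun m : M => m).

Lemma free_eval_surj M m : exists x, free_eval M x = m.
Proof. by exists (<< m >> : {malg R[M]}); apply: lin_extU. Qed.

Variable M : lmodType R.

Fixpoint syzygy (n : nat) : lmodType R :=
  if n is m.+1 then sub_type (ker (free_eval (syzygy m))) else M.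

Definition free_res_mod n := free_mod (syzygy n).

Definition free_res_d n : {linear free_res_mod n.+1 -> free_res_mod n} :=
  val \o free_eval (syzygy n.+1).

Lemma free_res_exact_eval n x :
  free_eval (syzygy n) x = 0 <-> exists y, free_res_d n y = x.
Proof.
split=> [x0|[y <-]].
  have xk : x \in mem_sub (ker (free_eval (syzygy n))) by apply/mem_subP.
  have [y yE] := free_eval_surj (Sub x xk : syzygy n.+1).
  by exists y; rewrite /= yE.
by have /mem_subP := valP (free_eval (syzygy n.+1) y).
Qed.

Lemma free_res_exact n x : free_res_d n x = 0 <-> exists y, free_res_d n.+1 y = x.
Proof.
rewrite -free_res_exact_eval.
have -> : free_res_d n x = val (free_eval (syzygy n.+1) x) by [].
split=> [h|->]; last by rewrite linear0.
by apply: val_inj; rewrite linear0.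
Qed.

Definition free_resolution : proj_resolution M :=
  ProjResolution (fun n => @free_projective (syzygy n)) (free_eval_surj (M := M))
    (@free_res_exact_eval 0) free_res_exact.
End FreeResolution.

Section Cohomology.
Variables (K : pzRingType) (C : nat -> lmodType K).
Variable delta : forall n, {linear C n -> C n.+1}.

(* Degree n is ker (delta n) modulo those of its elements that lie in the image
   of delta (n - 1), or that vanish if n = 0. *)
Definition cocycle n : lmodType K := sub_type (ker (delta n)).

Definition is_coboundary n : C n -> Prop :=
  match n with
  | 0 => fun x => x = 0
  | m.+1 => fun x => exists y, delta m y = x
  end.

Fact coboundary0 n : is_coboundary (0 : C n).
Proof. by case: n => [|n] //=; exists 0; rewrite linear0. Qed.

Fact coboundaryDZ n a (x y : C n) :
  is_coboundary x -> is_coboundary y -> is_coboundary (a *: x + y).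
Proof.
case: n x y => [|n] x y /=; first by move=> -> ->; rewrite scaler0 addr0.
by move=> [u <-] [v <-]; exists (a *: u + v); rewrite linearP.
Qed.

Fact coboundary_sub0 n : is_coboundary (val (0 : cocycle n)).
Proof. by rewrite raddf0; exact: coboundary0. Qed.
Fact coboundary_subDZ n a (x y : cocycle n) :
  is_coboundary (val x) -> is_coboundary (val y) -> is_coboundary (val (a *: x + y)).
Proof. by rewrite linearP; exact: coboundaryDZ. Qed.

Definition coboundary n : submodule (cocycle n) :=
  Submodule (V := cocycle n) (submodule_pred := fun z => is_coboundary (val z))
    (@coboundary_sub0 n) (@coboundary_subDZ n).

Definition cohomology n : lmodType K := lquot (coboundary n).
End Cohomology.

Section Hom.
Variables (K : comNzRingType) (R : algType K).

Definition restrict_scalars (N : lmodType R) := (N : Type).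

Section ResScalars.
Variable N : lmodType R.
HB.instance Definition _ := GRing.Zmodule.on (restrict_scalars N).

Definition res_scale (k : K) (x : restrict_scalars N) : restrict_scalars N :=
  (k%:A : R) *: (x : N).

Fact res_scaleA a b x : res_scale a (res_scale b x) = res_scale (a * b) x.
Proof. by rewrite /res_scale scalerA mulr_algl scalerA. Qed.
Fact res_scale1 : left_id 1 res_scale.
Proof. by move=> x; rewrite /res_scale !scale1r. Qed.
Fact res_scaleDr : right_distributive res_scale +%R.
Proof. by move=> a x y; rewrite /res_scale scalerDr. Qed.
Fact res_scaleDl x : {morph res_scale^~ x : a b / a + b}.
Proof. by move=> a b; rewrite /res_scale !scalerDl. Qed.
HB.instance Definition _ := GRing.Zmodule_isLmodule.Build K (restrict_scalars N)
  res_scaleA res_scale1 res_scaleDr res_scaleDl.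
End ResScalars.

Section HomModule.
Variables (P N : lmodType R).

Definition is_hom (f : P -> restrict_scalars N) : Prop := linear (f : P -> N).

Fact is_hom0 : is_hom 0.
Proof. by move=> a x y /=; rewrite [RHS]addr0 scaler0. Qed.

Fact is_homDZ k f g : is_hom f -> is_hom g -> is_hom (k *: f + g).
Proof.
move=> hf hg a x y.
have e z : (k *: f + g) z = (k%:A : R) *: (f z : N) + (g z : N) by [].
rewrite !e (hf a x y) (hg a x y) !scalerDr !scalerA -addrA.
by rewrite mulr_algl mulr_algr [X in _ + X]addrCA !addrA.
Qed.

Definition hom_submodule : submodule (P -> restrict_scalars N) :=
  Submodule is_hom0 is_homDZ.
Definition Hom_mod : lmodType K := sub_type hom_submodule.
End HomModule.

Section Precomposition.
Variables (P Q N : lmodType R) (d : {linear Q -> P}).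

Fact precomp_subproof (f : Hom_mod P N) :
  (val f \o d : Q -> restrict_scalars N) \in mem_sub (hom_submodule Q N).
Proof.
have /mem_subP hf := valP f.
by apply/mem_subP => a x y; rewrite /= linearP hf.
Qed.

Definition precomp (f : Hom_mod P N) : Hom_mod Q N :=
  exist (fun g => g \in mem_sub (hom_submodule Q N)) _ (precomp_subproof f).

Fact precomp_linear : linear precomp.
Proof. by move=> k f g; apply: val_inj. Qed.
HB.instance Definition _ :=
  GRing.isLinear.Build K (Hom_mod P N) (Hom_mod Q N) *:%R precomp precomp_linear.
End Precomposition.

Definition Ext_res (M N : lmodType R) (P : proj_resolution M) (n : nat) : lmodType K :=
  cohomology (C := fun m => Hom_mod (res_mod P m) N)
    (fun m => precomp (N := N) (res_d P m)) n.

(* Among the projective resolutions of M the free one is chosen: its n-th term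
   is the free module on the underlying set of the n-th syzygy.  The K-structure
   comes from the K-algebra structure of R. *)
Definition Ext (M N : lmodType R) (n : nat) : lmodType K :=
  Ext_res N (free_resolution M) n.
End Hom.

Definition HH (K : comNzRingType) (n : nat) (A : algType K) : lmodType K :=
  Ext (R := env A) (bimod A) (bimod A) n.

Definition has_dim (K : fieldType) (V : lmodType K) (d : nat) : Prop :=
  exists f : {linear V -> 'rV[K]_d}, bijective f.

Variant vertex9 := v1 | v2 | v3 | v4.
Variant arrow9 := alpha | beta | xi | epsilon | gamma | delta.

Definition vertex9_code v : 'I_4 :=
  inord match v with v1 => 0 | v2 => 1 | v3 => 2 | v4 => 3 end.
Definition vertex9_decode (i : 'I_4) := nth v1 [:: v1; v2; v3; v4] i.
Fact vertex9_codeK : cancel vertex9_code vertex9_decode.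
Proof. by case; rewrite /vertex9_decode inordK. Qed.
HB.instance Definition _ := Finite.copy vertex9 (can_type vertex9_codeK).

Definition arrow9_code a : 'I_6 :=
  inord match a with
  | alpha => 0 | beta => 1 | xi => 2 | epsilon => 3 | gamma => 4 | delta => 5
  end.
Definition arrow9_decode (i : 'I_6) :=
  nth alpha [:: alpha; beta; xi; epsilon; gamma; delta] i.
Fact arrow9_codeK : cancel arrow9_code arrow9_decode.
Proof. by case; rewrite /arrow9_decode inordK. Qed.
HB.instance Definition _ := Finite.copy arrow9 (can_type arrow9_codeK).

Definition source9 (a : arrow9) : vertex9 :=
  match a with alpha => v1 | xi => v2 | gamma => v3 | _ => v4 end.
Definition target9 (a : arrow9) : vertex9 :=
  match a with beta => v1 | epsilon => v2 | delta => v3 | _ => v4 end.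

Definition quiver9 := Quiver source9 target9 v1.

Section Lambda9.
Variable K : comNzRingType.

Local Notation "[ a ]" := (arrow_elt K (a : arrow quiver9)).

Variant rel9 : path_algebra K quiver9 -> Prop :=
| rel9_mesh : rel9 ([beta] * [alpha] + [epsilon] * [xi] + [delta] * [gamma])
| rel9_xi_epsilon : rel9 ([xi] * [epsilon])
| rel9_gamma_delta : rel9 ([gamma] * [delta])
| rel9_alpha_beta :
    rel9 ([alpha] * [beta] - [alpha] * [delta] * [gamma] * [beta]).

Fact rel9P r : rel9 r -> forall v, trivial_coeff v r = 0.
Proof.
have hM a f v : trivial_coeff v (f * [a]) = 0 by exact: trivial_coeff_arrowM.
have hD v f g : trivial_coeff v f = 0 -> trivial_coeff v g = 0 ->
    trivial_coeff v (f + g) = 0.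
  by move=> f0 g0; rewrite trivial_coeffD f0 g0 addr0.
have hB v f g : trivial_coeff v f = 0 -> trivial_coeff v g = 0 ->
    trivial_coeff v (f - g) = 0.
  by move=> f0 g0; rewrite trivial_coeffB f0 g0 subr0.
case=> v; [|exact: hM|exact: hM|by apply: hB; exact: hM].
by apply: (hD); [apply: hD|]; exact: hM.
Qed.

Definition bound_quiver9 := BoundQuiver rel9P.

Definition Lambda9 : algType K := bound_quiver_algebra bound_quiver9.
End Lambda9.

(* Main.v *)
From HB Require Import structures.
From mathcomp Require Import all_boot all_algebra.
From mathcomp Require Import finmap monalg boolp functions.
Require Import Defs.

(* HH^n(A) is computed from the beginning P_3 -> P_2 -> P_1 -> P_0 of the minimal
   projective bimodule resolution of A, whose generators are the vertices, the
   arrows, the relations and again the vertices; the differentials are given by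
   Fox derivatives.  By the comparison theorem the free resolution in the
   definition of Ext gives the same cohomology.

   All structure constants lie in F_2.  In characteristic 2 the elements of A, of
   P_n and of Hom(P_n, A) that are F_2-combinations of basis elements can be coded
   by lists of basis indices, read as formal sums with x + x = 0, and an identity
   between linear maps is checked by a computation on the basis.  In this way the
   exactness of the resolution follows from a contracting homotopy, and the
   dimensions of HH^0, HH^1, HH^2 follow from a splitting of the complex of the
   Hom(P_n, A), of dimensions 10, 12, 10, 10 with differentials of rank 5, 6, 2.

   A has a basis of 28 paths.  They span A since every product of a basis path
   with an arrow is rewritten by explicit multiples of the relations; they are
   independent since the resulting table is a matrix representation of A. *)

Set Implicit Arguments.
Unset Strict Implicit.
Unset Printing Implicit Defensive.

Import GRing.Theory.
Local Open Scope ring_scope.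
Local Open Scope quotient_scope.

(** * Comparison of projective resolutions *)

(** The modules in the definition of Ext are free on whole underlying sets, where nothing can be
    computed, so the passage to them rests only on the existence of lifts and homotopies. The
    explicit terms have dimensions 208, 360, 208, 208 over K; a homotopy identity on basis elements
    replaces the computation of ranks in them. The rewriting certificates are used twice: they prove
    the multiplication table of A, and they are the contracting homotopy from P_1 to P_2. The
    generators of P_3 are of Casimir type. For each vertex they map to a sum of terms b_u (x) b_v,
    in which b_u runs once through the basis paths from that vertex and b_u b_v is the basis path
    from it that every arrow on the right kills. Three more terms, with the codes (21, 22), (13,
    25), (25, 13) and product b_u b_v = 0, correct this sum. *)

Section Corestriction.
Variables (R : pzRingType) (U V : lmodType R) (S : submodule V).
Variables (f : {linear U -> V}) (fS : forall x, S (f x)).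

Definition corestr (x : U) : sub_type S :=
  exist (fun y => y \in mem_sub S) (f x) (introT (mem_subP S (f x)) (fS x)).

Fact corestr_linear : linear corestr.
Proof. by move=> a x y; apply: val_inj; rewrite /= linearP. Qed.
HB.instance Definition _ :=
  GRing.isLinear.Build R U (sub_type S) *:%R corestr corestr_linear.
End Corestriction.

Section Image.
Variables (R : pzRingType) (U V : lmodType R) (f : {linear U -> V}).

Fact image0 : exists x, f x = 0.
Proof. by exists 0; rewrite linear0. Qed.

Fact imageDZ a y z :
  (exists x, f x = y) -> (exists x, f x = z) -> exists x, f x = a *: y + z.
Proof. by move=> [u <-] [v <-]; exists (a *: u + v); rewrite linearP. Qed.

Definition image_submodule : submodule V :=
  Submodule (submodule_pred := fun y => exists x, f x = y) image0 imageDZ.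
End Image.

(** [projective] speaks of surjections only; corestricting both maps to the image of [g] makes it
    applicable. *)
Lemma projective_lift (R : pzRingType) (P B C : lmodType R)
    (g : {linear B -> C}) (f : {linear P -> C}) :
  projective P -> (forall x, exists b, g b = f x) ->
  exists h : {linear P -> B}, forall x, g (h x) = f x.
Proof.
move=> Pproj gf.
have gS b : image_submodule g (g b) by exists b.
have [] := Pproj B _ (corestr gS) (corestr (S := image_submodule g) gf).
  by move=> [c cP]; have /mem_subP[b bE] := cP; exists b; apply: val_inj.
by move=> h hE; exists h => x; have /(congr1 val) := hE x.
Qed.

Section Comparison.
Variables (R : pzRingType) (M : lmodType R).

(** Taking the kernel of the augmentation as the cycles of degree 0 lets the inductions treat all
    degrees alike. *)
Definition res_cycle (P : proj_resolution M) n : res_mod P n -> Prop :=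
  match n with
  | 0 => fun x => res_aug P x = 0
  | m.+1 => fun x => res_d P m x = 0
  end.

Lemma res_cycleP (P : proj_resolution M) n x :
  res_cycle x <-> exists y, res_d P n y = x.
Proof. by case: n x => [|n] x; [exact: res_exact0 | exact: res_exact]. Qed.

Lemma res_cycle_d (P : proj_resolution M) n y : res_cycle (res_d P n y).
Proof. by apply/res_cycleP; exists y. Qed.

(** A chain map over the identity of M, recorded by its component in degree n; the lower components
    are only asserted to exist, which suffices for cohomology in degree n. *)
Fixpoint chain_lift (P Q : proj_resolution M) n :
    {linear res_mod P n -> res_mod Q n} -> Prop :=
  match n with
  | 0 => fun f => forall x, res_aug Q (f x) = res_aug P x
  | m.+1 => fun f => exists2 g, chain_lift g &
      forall x, res_d Q m (f x) = g (res_d P m x)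
  end.

Lemma chain_lift_cycle (P Q : proj_resolution M) n
    (f : {linear res_mod P n -> res_mod Q n}) x :
  chain_lift f -> res_cycle x -> res_cycle (f x).
Proof.
case: n f x => [|n] f x /=; first by move=> ->.
by move=> [g _ ->] ->; rewrite linear0.
Qed.

Lemma chain_lift_exists (P Q : proj_resolution M) n :
  exists f : {linear res_mod P n -> res_mod Q n}, chain_lift f.
Proof.
elim: n => [|n [g gP]].
  have [f fE] := projective_lift (@res_projective _ _ P 0)
    (fun x => res_aug_surj Q (res_aug P x)).
  by exists f.
have gd (x : res_mod P n.+1) : exists y, res_d Q n y = (g \o res_d P n) x.
  by apply/res_cycleP/chain_lift_cycle => //; apply: res_cycle_d.
by have [f fE] := projective_lift (@res_projective _ _ P n.+1) gd; exists f, g.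
Qed.

Lemma chain_lift_id (P : proj_resolution M) n :
  chain_lift (@idfun (res_mod P n) : {linear res_mod P n -> res_mod P n}).
Proof. by elim: n => [|n IH] //=; eexists; first exact: IH. Qed.

Lemma chain_lift_comp (P Q S : proj_resolution M) n
    (f : {linear res_mod P n -> res_mod Q n})
    (g : {linear res_mod Q n -> res_mod S n}) :
  chain_lift f -> chain_lift g -> chain_lift (g \o f).
Proof.
elim: n f g => [|n IH] f g /=; first by move=> fE gE x; rewrite gE fE.
move=> [f' f'P fE] [g' g'P gE]; eexists; first exact: IH f'P g'P.
by move=> x /=; rewrite gE fE.
Qed.

(** One half of a null-homotopy: the other half would write u - h d as a boundary, but cocycles
    already vanish on its values, which are cycles. *)
Definition chain_null (P Q : proj_resolution M) n :
    (res_mod P n -> res_mod Q n) -> Prop :=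
  match n with
  | 0 => fun u => forall x, res_cycle (u x)
  | m.+1 => fun u => exists h : {linear res_mod P m -> res_mod Q m.+1},
      forall x, res_cycle (u x - h (res_d P m x))
  end.

Lemma chain_lift_null (P Q : proj_resolution M) n
    (f g : {linear res_mod P n -> res_mod Q n}) :
  chain_lift f -> chain_lift g -> chain_null (fun x => f x - g x).
Proof.
elim: n f g => [|n IH] f g.
  by move=> /= fE gE x; rewrite linearB fE gE subrr.
move=> [f' f'P fE] [g' g'P gE].
(* The difference in degree n minus the preceding homotopy term has values in cycles, hence lifts
   along [res_d Q n]; the lift is the next homotopy. The subtracted term vanishes on boundaries. *)
have [v vE] : exists v : {linear res_mod P n -> res_mod Q n},
    (forall x, res_cycle (v x)) /\
    forall x, v (res_d P n x) = f' (res_d P n x) - g' (res_d P n x).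
  case: n f' g' f'P g'P {f g fE gE} IH => [|n] f' g' f'P g'P IH.
    by exists (f' \- g'); split=> // x; apply: (IH f' g').
  have [h hE] := IH _ _ f'P g'P.
  exists (f' \- g' \- (h \o res_d P n)); split=> //= x.
  by have /= -> := res_cycle_d x; rewrite linear0 subr0.
have [h hE] := projective_lift (@res_projective _ _ P n)
  (fun x => (res_cycleP (v x)).1 (vE.1 x)).
by exists h => x /=; rewrite !linearB fE gE hE vE.2 subrr.
Qed.
End Comparison.

Section CohomologyDim.
Variables (K : fieldType) (C : nat -> lmodType K).
Variable delta : forall n, {linear C n -> C n.+1}.

(* [T] induces an isomorphism from the cohomology in degree [n] to K^d. *)
Definition detects n d (T : {linear C n -> 'rV[K]_d}) : Prop :=
  (forall x, delta n x = 0 -> T x = 0 <-> is_coboundary delta x) /\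
  (forall v, exists2 x, delta n x = 0 & T x = v).

Lemma detects_dim n d (T : {linear C n -> 'rV[K]_d}) :
  detects T -> has_dim (cohomology delta n) d.
Proof.
move=> [Tker Tsurj].
pose F (z : cohomology delta n) : 'rV[K]_d := T (val (repr z)).
have FE x : F (\pi_(cohomology delta n) x) = T (val x).
  apply/eqP; rewrite -subr_eq0 /F -!linearB; apply/eqP/Tker; last first.
    by apply/(lquotP (coboundary delta n)); rewrite reprK.
  by have /mem_subP := valP (repr (\pi_(cohomology delta n) x) - x).
have Flin : linear F.
  move=> a x y; have [x' ->] := pi_lquot_surj x; have [y' ->] := pi_lquot_surj y.
  by rewrite -pi_lquotZ -pi_lquotD !FE linearP.
exists (HB.pack_for {linear cohomology delta n -> 'rV[K]_d} F
  (GRing.isLinear.Build _ _ _ _ F Flin)).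
have ex v : exists z, F z = v.
  have [x x0 <-] := Tsurj v.
  have xc : x \in mem_sub (ker (delta n)) by apply/mem_subP.
  by exists (\pi_(cohomology delta n) (Sub x xc : cocycle delta n)); rewrite FE.
have [G GE] := choice ex; exists G => // z /=.
have [x zE] := pi_lquot_surj z; have [y yE] := pi_lquot_surj (G (F z)).
rewrite yE zE; apply/lquotP/Tker.
  by have /mem_subP := valP (y - x).
have -> : val (y - x) = val y - val x by [].
by rewrite linearB -!FE -yE -zE GE subrr.
Qed.
End CohomologyDim.

(** * Independence of Ext from the chosen resolution *)

Section ExtComparison.
Variables (K : fieldType) (R : algType K) (M N : lmodType R).

Definition mk_hom (P : lmodType R) (f : {linear P -> N}) : Hom_mod P N :=
  exist (fun g => g \in mem_sub (hom_submodule P N))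
    (f : P -> restrict_scalars N)
    (introT (mem_subP (hom_submodule P N) _) (linearP f)).

Definition hom_lin (P : lmodType R) (phi : Hom_mod P N) : {linear P -> N} :=
  HB.pack_for {linear P -> N} (val phi : P -> N)
    (GRing.isLinear.Build R P N *:%R (val phi : P -> N)
      (elimT (mem_subP (hom_submodule P N) _) (valP phi))).

Lemma precomp_comp (P Q S : lmodType R) (f : {linear P -> Q})
    (g : {linear Q -> S}) (phi : Hom_mod S N) :
  precomp f (precomp g phi) = precomp (g \o f) phi.
Proof. exact: val_inj. Qed.

(** By exactness the cycles are the values of the next differential, so cocycles are the maps that
    vanish on cycles. Degree n + 1 thereby disappears from the comparison. *)
Lemma cocycle_cycle (S : proj_resolution M) n (phi : Hom_mod (res_mod S n) N) x :
  precomp (res_d S n) phi = 0 -> res_cycle x -> hom_lin phi x = 0.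
Proof. by move=> /(congr1 val) e /res_cycleP[y <-]; have := congr1 (@^~ y) e. Qed.

Lemma cocycleP (S : proj_resolution M) n (phi : Hom_mod (res_mod S n) N) :
  (forall x, res_cycle x -> hom_lin phi x = 0) -> precomp (res_d S n) phi = 0.
Proof.
by move=> h; apply/val_inj/funext => y; have := h _ (res_cycle_d y).
Qed.
End ExtComparison.

Section ExtTransfer.
Variables (K : fieldType) (R : algType K) (M N : lmodType R).
Variables P Q : proj_resolution M.
Local Notation codiff P := (fun m => precomp (N := N) (res_d P m)).

Lemma chain_lift_coboundary (P' Q' : proj_resolution M) n
    (f : {linear res_mod P' n -> res_mod Q' n}) (phi : Hom_mod (res_mod Q' n) N) :
  chain_lift f -> is_coboundary (codiff Q') phi ->
  is_coboundary (codiff P') (precomp f phi).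
Proof.
case: n f phi => [|n] f phi /=; first by move=> _ ->; rewrite linear0.
move=> [g _ fE] [chi <-]; exists (precomp g chi); apply/val_inj/funext => x /=.
by rewrite fE.
Qed.

Lemma chain_null_coboundary (P' Q' : proj_resolution M) n
    (f g : {linear res_mod P' n -> res_mod Q' n}) (phi : Hom_mod (res_mod Q' n) N) :
  chain_null (fun x => f x - g x) -> precomp (res_d Q' n) phi = 0 ->
  is_coboundary (codiff P') (precomp f phi - precomp g phi).
Proof.
move=> + phi0; case: n f g phi phi0 => [|n] f g phi phi0 /= fg.
  apply/val_inj/funext => x.
  by have := cocycle_cycle phi0 (fg x); rewrite (linearB (hom_lin phi)).
have [h hE] := fg; exists (precomp h phi); apply/val_inj/funext => x.
have := cocycle_cycle phi0 (hE x); rewrite !(linearB (hom_lin phi)) => /eqP.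
by rewrite subr_eq0 => /eqP.
Qed.

Lemma detects_transfer n d (T : {linear Hom_mod (res_mod P n) N -> 'rV[K]_d}) :
  detects (codiff P) T ->
  exists T' : {linear Hom_mod (res_mod Q n) N -> 'rV[K]_d}, detects (codiff Q) T'.
Proof.
move=> [Tker Tsurj].
have [f fP] := chain_lift_exists P Q n; have [g gP] := chain_lift_exists Q P n.
have coc (P' Q' : proj_resolution M) (u : {linear res_mod P' n -> res_mod Q' n}) phi :
    chain_lift u -> precomp (N := N) (res_d Q' n) phi = 0 ->
    precomp (res_d P' n) (precomp u phi) = 0.
  move=> uP phi0; apply: cocycleP => x x0.
  exact: (cocycle_cycle phi0 (chain_lift_cycle uP x0)).
(* Pull-back along [g] is inverse to pull-back along [f] on cohomology: both composites lift the
   identity of M, so they differ from the identity by a null-homotopic map. *)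
exists (T \o precomp f); split=> [phi phi0|v] /=.
  split=> [/(Tker _ (coc _ _ _ _ fP phi0))|phiB].
    move=> /(chain_lift_coboundary gP); rewrite precomp_comp => B1.
    have B2 := chain_null_coboundary
      (chain_lift_null (chain_lift_id Q n) (chain_lift_comp gP fP)) phi0.
    have := coboundaryDZ 1 B2 B1.
    by rewrite scale1r subrK; congr is_coboundary; apply: val_inj.
  by apply/Tker; [exact: coc | exact: chain_lift_coboundary].
have [psi psi0 psiE] := Tsurj v; exists (precomp g psi); first exact: coc.
have B := chain_null_coboundary
  (chain_lift_null (chain_lift_comp fP gP) (chain_lift_id P n)) psi0.
have e : precomp (@idfun (res_mod P n)) psi = psi by exact: val_inj.
rewrite e in B.
rewrite precomp_comp -[precomp _ psi](subrK psi) linearD psiE.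
rewrite (iffRL (Tker _ _) B) ?add0r // linearB /= psi0 subr0.
by rewrite -precomp_comp; apply: (coc) => //; apply: (coc).
Qed.
End ExtTransfer.

Lemma Ext_dim_of_resolution (K : fieldType) (R : algType K) (M N : lmodType R)
    (P : proj_resolution M) n d (T : {linear Hom_mod (res_mod P n) N -> 'rV[K]_d}) :
  detects (fun m => precomp (N := N) (res_d P m)) T -> has_dim (Ext M N n) d.
Proof.
by move=> /(detects_transfer (free_resolution M)) [T']; apply: detects_dim.
Qed.

Section ExtendResolution.
Variables (R : nzRingType) (M P0 P1 P2 : lmodType R).
Variables (aug : {linear P0 -> M}) (d0 : {linear P1 -> P0}) (d1 : {linear P2 -> P1}).
Hypothesis P_projective : [/\ projective P0, projective P1 & projective P2].
Hypothesis aug_surj : forall m, exists x, aug x = m.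
Hypothesis exact0 : forall x, aug x = 0 <-> exists y, d0 y = x.
Hypothesis exact1 : forall x, d0 x = 0 <-> exists y, d1 y = x.

Let tail : lmodType R := sub_type (ker d1).

(** A resolution has infinitely many terms, of which three are explicit; a free resolution of the
    kernel of [d1] completes them. The explicit P_3 is not a term: it serves to describe this
    kernel. *)
Definition ext_mod n : lmodType R :=
  match n with 0 => P0 | 1 => P1 | 2 => P2 | m.+3 => free_res_mod tail m end.

Definition ext_d n : {linear ext_mod n.+1 -> ext_mod n} :=
  match n return {linear ext_mod n.+1 -> ext_mod n} with
  | 0 => d0
  | 1 => d1
  | 2 => val \o free_eval tail
  | m.+3 => free_res_d tail m
  end.

Fact ext_projective n : projective (ext_mod n).
Proof.
by case: P_projective => ? ? ?; case: n => [|[|[|n]]] //; apply: free_projective.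
Qed.

Fact ext_exact n x : ext_d n x = 0 <-> exists y, ext_d n.+1 y = x.
Proof.
case: n x => [|[|[|n]]] x; first exact: exact1.
- split=> [x0|[y <-]].
    have xk : x \in mem_sub (ker d1) by apply/mem_subP.
    have [y yE] := free_eval_surj (Sub x xk : tail).
    by exists y; rewrite /= yE.
  by have /mem_subP := valP (free_eval tail y).
- rewrite -[X in _ <-> X](@free_res_exact_eval _ _ 0 x).
  by split=> [h|h]; [apply: val_inj; exact: h | exact: (congr1 val h)].
- exact: (@free_res_exact _ tail n x).
Qed.

Definition ext_resolution : proj_resolution M :=
  ProjResolution ext_projective aug_surj exact0 ext_exact.
End ExtendResolution.

(** * Formal sums over F_2 and bases *)

Section FormalSums.
Variable T : eqType.
Implicit Types l : seq T.

Definition fsum (V : zmodType) (v : T -> V) l : V := \sum_(t <- l) v t.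

Definition feq l1 l2 :=
  all (fun t => odd (count_mem t l1) == odd (count_mem t l2)) (l1 ++ l2).

Definition fbind (T' : Type) (tab : T -> seq T') l := flatten (map tab l).

Variable V : zmodType.
Hypothesis V2 : forall x : V, x + x = 0.

Lemma mulrn_odd (x : V) n : x *+ n = x *+ odd n.
Proof.
by rewrite -[in LHS](odd_double_half n) mulrnDr -muln2 mulrnA mulr2n V2 addr0.
Qed.

Lemma feqP (v : T -> V) l1 l2 : feq l1 l2 -> fsum v l1 = fsum v l2.
Proof.
move=> /allP e; have Vopp (x : V) : - x = x by apply/eqP; rewrite eq_sym -addr_eq0 V2.
apply/eqP; rewrite -subr_eq0 Vopp; apply/eqP.
(* Since - x = x, the difference is the sum over the concatenation, where each code has even
   multiplicity. *)
rewrite /fsum -big_cat -big_undup_iterop_count big_seq big1 // => t.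
rewrite mem_undup => /e /eqP h.
rewrite -[iterop _ _ _ _]/(v t *+ count_mem t (l1 ++ l2)) mulrn_odd.
by rewrite count_cat oddD h addbb.
Qed.
End FormalSums.

Lemma fsum_cat (T : eqType) (V : zmodType) (v : T -> V) l1 l2 :
  fsum v (l1 ++ l2) = fsum v l1 + fsum v l2.
Proof. exact: big_cat. Qed.

Lemma raddf_fsum (T T' : eqType) (V W : zmodType) (f : {additive V -> W})
    (v : T -> V) (w : T' -> W) tab l :
  (forall t, t \in l -> f (v t) = fsum w (tab t)) ->
  f (fsum v l) = fsum w (fbind tab l).
Proof.
move=> e; rewrite raddf_sum /fsum big_flatten big_map.
by apply: eq_big_seq => t tl; rewrite e.
Qed.

Lemma char2_addxx (K : nzRingType) (V : lmodType K) :
  2%N \in [pchar K] -> forall x : V, x + x = 0.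
Proof. by move=> charK x; rewrite -mulr2n -scaler_nat pcharf0 // scale0r. Qed.

(** A finite basis with its dual coordinates. The vectors are defined for every code in [T], so that
    product tables hold without range conditions; the codes in [fidx] are those of the basis. *)
Record frame (K : fieldType) (V : lmodType K) (T : eqType) := Frame {
  fidx : seq T;
  fvec : T -> V;
  fcoord : T -> V -> K;
  fcoord_linear : forall t a x y, fcoord t (a *: x + y) = a * fcoord t x + fcoord t y;
  frameE : forall x, x = \sum_(t <- fidx) fcoord t x *: fvec t;
  fidx_uniq : uniq fidx;
  fcoordE : forall s t, s \in fidx -> t \in fidx -> fcoord s (fvec t) = (s == t)%:R
}.

Lemma fcoord0 (K : fieldType) (V : lmodType K) (T : eqType) (b : frame V T) t :
  fcoord b t 0 = 0.
Proof.
by have := fcoord_linear b t (-1) 0 0; rewrite scaler0 addr0 mulN1r addNr.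
Qed.

Section FrameExt.
Variables (K : fieldType) (V : lmodType K) (T : eqType) (b : frame V T).
Variable W : lmodType K.

Definition frame_ext (F : T -> W) (x : V) : W :=
  \sum_(t <- fidx b) fcoord b t x *: F t.

Fact frame_ext_linear F : linear (frame_ext F).
Proof.
move=> a x y; rewrite /frame_ext scaler_sumr -big_split; apply: eq_bigr => t _.
by rewrite /= fcoord_linear scalerDl scalerA.
Qed.
HB.instance Definition _ F :=
  GRing.isLinear.Build K V W *:%R (frame_ext F) (frame_ext_linear F).

Lemma frame_extE F t : t \in fidx b -> frame_ext F (fvec b t) = F t.
Proof.
move=> tB; rewrite /frame_ext (bigD1_seq t) ?fidx_uniq //= fcoordE // eqxx scale1r.
rewrite big_seq_cond big1 ?addr0 // => s /andP[sB /negPf st].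
by rewrite fcoordE // st scale0r.
Qed.

Lemma eq_frame (f g : {linear V -> W}) :
  (forall t, t \in fidx b -> f (fvec b t) = g (fvec b t)) -> f =1 g.
Proof.
move=> fg x; rewrite (frameE b x) !linear_sum.
by apply: eq_big_seq => t tB; rewrite !linearZ fg.
Qed.
End FrameExt.

(** * Exactness checked on bases *)

Section Homotopy.
Variables (K : fieldType) (charK : 2%N \in [pchar K]).
Variables (U V W : lmodType K) (TU TV TW : eqType).
Variables (bU : frame U TU) (bV : frame V TV) (bW : frame W TW).
Variables (d : {linear V -> U}) (dtab : TV -> seq TU).
Variables (d' : {linear W -> V}) (dtab' : TW -> seq TV).
Variables (stab : TU -> seq TV) (stab' : TV -> seq TW).
Hypothesis dE : forall t, d (fvec bV t) = fsum (fvec bU) (dtab t).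
Hypothesis dE' : forall t, d' (fvec bW t) = fsum (fvec bV) (dtab' t).

Lemma complex_check :
  all (fun t => feq (fbind dtab (dtab' t)) [::]) (fidx bW) -> forall x, d (d' x) = 0.
Proof.
move=> /allP h x; pose z : {linear W -> U} := \0.
apply: (eq_frame (b := bW) (f := d \o d') (g := z)) => t /h /feqP e.
rewrite /= dE' (raddf_fsum (fun t _ => dE t)).
by rewrite e ?[LHS]big_nil //; apply: char2_addxx.
Qed.

Lemma split_check :
  all (fun t => feq (fbind dtab' (stab' t)) [:: t]) (fidx bV) ->
  forall x, exists y, d' y = x.
Proof.
move=> /allP h x; pose s := frame_ext bV (fun t => fsum (fvec bW) (stab' t)).
exists (s x); apply: (eq_frame (b := bV) (f := d' \o s) (g := idfun)) => t tB.
rewrite /= frame_extE // (raddf_fsum (fun t _ => dE' t)).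
by rewrite (feqP _ _ (h t tB)) ?[LHS]big_seq1 //; apply: char2_addxx.
Qed.

(** From s d + d' s' = 1 a cycle x equals d' (s' x). The maps s and s' are only K-linear, hence
    determined by arbitrary values on bases; [dtab] has to stay inside [fidx bU] because the
    extension of [stab] has its tabulated values only there. *)
Lemma homotopy_check :
  all (fun t => all (mem (fidx bU)) (dtab t) &&
     feq (fbind stab (dtab t) ++ fbind dtab' (stab' t)) [:: t]) (fidx bV) ->
  forall x, d x = 0 -> exists y, d' y = x.
Proof.
move=> /allP h x dx.
pose s := frame_ext bU (fun t => fsum (fvec bV) (stab t)).
pose s' := frame_ext bV (fun t => fsum (fvec bW) (stab' t)).
exists (s' x); have : ((s \o d) \+ (d' \o s')) x = idfun x.
  pose f : {linear V -> V} := (s \o d) \+ (d' \o s').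
  apply: (eq_frame (b := bV) (f := f) (g := idfun)) => t tB.
  have /andP[/allP dB /feqP e] := h t tB.
  rewrite /f /= /s' dE (frame_extE (b := bV)) // (raddf_fsum (fun t _ => dE' t)).
  rewrite (raddf_fsum (w := fvec bV) (tab := stab)); last first.
    by move=> u /dB uB; rewrite /= /s frame_extE.
  by rewrite -fsum_cat e ?[LHS]big_seq1 //; apply: char2_addxx.
by have s0 : s 0 = 0 := linear0 _; rewrite /= dx s0 add0r.
Qed.
End Homotopy.

(** * The enveloping algebra *)

Lemma catalg_ind (K : comNzRingType) (C : fincat) (P : catalg K C -> Prop) :
  P 0 -> (forall x y, P x -> P y -> P (x + y)) ->
  (forall k p, P (k *: cbase K p)) -> forall x, P x.
Proof.
by move=> P0 PD PZ x; rewrite (catalgE x); apply: (big_ind P) => // p _; apply: PZ.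
Qed.

Lemma eq_catalg (K : comNzRingType) (C : fincat) (V : lmodType K)
    (f g : {linear catalg K C -> V}) :
  (forall p, f (cbase K p) = g (cbase K p)) -> f =1 g.
Proof.
move=> fg; apply: catalg_ind => [|x y fx fy|k p].
- by rewrite !linear0.
- by rewrite !linearD fx fy.
- by rewrite !linearZ fg.
Qed.

Section IdealQuotientLift.
Variables (K : comNzRingType) (A : algType K) (I : ideal A) (V : lmodType K).

Definition aquot_pi (x : A) : aquot I := \pi_(aquot I) x.

Fact aquot_pi_linear : linear aquot_pi.
Proof. by move=> k x y; rewrite /aquot_pi pi_aquotD pi_aquotZ. Qed.
HB.instance Definition _ :=
  GRing.isLinear.Build K A (aquot I) *:%R aquot_pi aquot_pi_linear.

Lemma eq_aquot (f g : aquot I -> V) :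
  (forall x, f (aquot_pi x) = g (aquot_pi x)) -> f =1 g.
Proof. by move=> fg x; have [y ->] := pi_aquot_surj x; apply: fg. Qed.

Variables (f : {linear A -> V}) (fI : forall x, I x -> f x = 0).

Definition aquot_lift_def (x : aquot I) : V := f (repr x).

Lemma aquot_liftE x : aquot_lift_def (aquot_pi x) = f x.
Proof.
apply/eqP; rewrite -subr_eq0 -linearB; apply/eqP/fI/aquotP.
by rewrite reprK.
Qed.

Fact aquot_lift_linear : linear aquot_lift_def.
Proof.
move=> k x y; have [x' ->] := pi_aquot_surj x; have [y' ->] := pi_aquot_surj y.
by rewrite -[\pi _]/(aquot_pi x') -[\pi y']/(aquot_pi y') -linearP !aquot_liftE linearP.
Qed.
HB.instance Definition _ :=
  GRing.isLinear.Build K (aquot I) V *:%R aquot_lift_def aquot_lift_linear.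

Definition aquot_lift : {linear aquot I -> V} := aquot_lift_def.
End IdealQuotientLift.

Lemma catalg_ideal_gen (K : comNzRingType) (C : fincat) (V : lmodType K)
    (rel : catalg K C -> Prop) (f : {linear catalg K C -> V}) :
  (forall p q r, rel r -> f (cbase K p * r * cbase K q) = 0) ->
  forall x, ideal_gen rel x -> f x = 0.
Proof.
move=> f0 x; elim=> [|s r t y rr _ IH]; first exact: linear0.
rewrite linearD IH addr0; elim/catalg_ind: s => [|s s' fs fs'|k p].
- by rewrite !mul0r linear0.
- by rewrite !mulrDl linearD fs fs' addr0.
rewrite -!scalerAl linearZ /=; elim/catalg_ind: t => [|t t' ft ft'|k' q].
- by rewrite mulr0 linear0 scaler0.
- by rewrite mulrDr linearD scalerDr ft ft' addr0.
- by rewrite -scalerAr linearZ /= f0 // !scaler0.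
Qed.

Section EnvAlgebra.
Variables (K : fieldType) (A : algType K).
Local Notation R := (env A).
Local Notation KAA := (catalg K (env_cat A)).
Implicit Types a b : A.

Lemma pair_eltM a b a' b' : pair_elt a b * pair_elt a' b' = pair_elt (a' * a) (b * b').
Proof. exact: cbaseM. Qed.

Lemma tensorM a b a' b' : tensor a b * tensor a' b' = tensor (a' * a) (b * b').
Proof. by rewrite -[LHS]pi_aquotM pair_eltM. Qed.

Lemma tensor_relE (u v : KAA) : tensor_rel (u - v) -> \pi_(env A) u = \pi_(env A) v.
Proof.
move=> uv; apply/(aquotP (gen_ideal (@env_proper K A))).
rewrite -[u - v]mulr1 -[_ * 1]mul1r mulrA -[_ * 1]addr0.
exact: ideal_genS uv (ideal_gen0 _).
Qed.

Lemma tensorDl a a' b : tensor (a + a') b = tensor a b + tensor a' b.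
Proof.
rewrite -[RHS]pi_aquotD; apply: tensor_relE.
by rewrite opprD addrA; exact: tensor_Dl.
Qed.

Lemma tensorDr a b b' : tensor a (b + b') = tensor a b + tensor a b'.
Proof.
rewrite -[RHS]pi_aquotD; apply: tensor_relE.
by rewrite opprD addrA; exact: tensor_Dr.
Qed.

Lemma tensorZl k a b : tensor (k *: a) b = k *: tensor a b.
Proof. by rewrite -[RHS]pi_aquotZ; apply: tensor_relE; exact: (tensor_Zl k a b). Qed.

Lemma tensorZr k a b : tensor a (k *: b) = k *: tensor a b.
Proof. by rewrite -[RHS]pi_aquotZ; apply: tensor_relE; exact: (tensor_Zr k a b). Qed.

Lemma tensor_suml (I : Type) (r : seq I) (c : I -> K) (f : I -> A) b :
  tensor (\sum_(i <- r) c i *: f i) b = \sum_(i <- r) c i *: tensor (f i) b.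
Proof.
have t0 : tensor 0 b = 0 by rewrite -(scale0r (0 : A)) tensorZl scale0r.
rewrite (big_morph (fun a => tensor a b) (fun x y => tensorDl x y b) t0).
by apply: eq_bigr => i _; rewrite tensorZl.
Qed.

Lemma tensor_sumr (I : Type) (r : seq I) (c : I -> K) (f : I -> A) a :
  tensor a (\sum_(i <- r) c i *: f i) = \sum_(i <- r) c i *: tensor a (f i).
Proof.
have t0 : tensor a 0 = 0 by rewrite -(scale0r (0 : A)) tensorZr scale0r.
rewrite (big_morph (tensor a) (fun x y => tensorDr a x y) t0).
by apply: eq_bigr => i _; rewrite tensorZr.
Qed.

Lemma eq_env (V : lmodType K) (f g : {linear R -> V}) :
  (forall a b, f (tensor a b) = g (tensor a b)) -> f =1 g.
Proof.
move=> fg; apply: eq_aquot => t.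
pose p : {linear KAA -> R} := aquot_pi (gen_ideal (@env_proper K A)).
by apply: (eq_catalg (f := f \o p) (g := g \o p)) => -[a b]; apply: fg.
Qed.

Section Lift.
Variables (V : lmodType K) (F : A -> A -> V).
Hypothesis F_linearl : forall b, linear (F^~ b).
Hypothesis F_linearr : forall a, linear (F a).

Let G : {linear KAA -> V} := lin_ext (fun p : opp_pair A => F (p.1 : A) p.2).

Let GU a b : G (pair_elt a b) = F a b.
Proof. exact: lin_extU. Qed.

(** Multiplying a bilinearity relation by pure tensors on both sides only multiplies its entries, so
    the product is again of a form that bilinear maps kill. *)
Lemma env_lift_rel t : ideal_gen (@tensor_rel K A) t -> G t = 0.
Proof.
have FDl b a a' : F (a + a') b = F a b + F a' b.
  by have := F_linearl b 1 a a'; rewrite !scale1r.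
have FDr a b b' : F a (b + b') = F a b + F a b'.
  by have := F_linearr a 1 b b'; rewrite !scale1r.
have F0l b : F 0 b = 0 by apply: (addrI (F 0 b)); rewrite -FDl !addr0.
have F0r a : F a 0 = 0 by apply: (addrI (F a 0)); rewrite -FDr !addr0.
have FZl k a b : F (k *: a) b = k *: F a b.
  by have := F_linearl b k a 0; rewrite F0l !addr0.
have FZr k a b : F a (k *: b) = k *: F a b.
  by have := F_linearr a k b 0; rewrite F0r !addr0.
apply: catalg_ideal_gen => -[a b] [a' b'] r.
rewrite -[cbase _ _]/(pair_elt (a : A) b) -[X in _ * X]/(pair_elt (a' : A) b').
case=> [x x' y|x y y'|k x y|k x y].
- rewrite !(mulrBr, mulrBl) !pair_eltM !linearB !GU.
  by rewrite mulrDl mulrDr FDl addrAC addrK subrr.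
- rewrite !(mulrBr, mulrBl) !pair_eltM !linearB !GU.
  by rewrite mulrDr mulrDl FDr addrAC addrK subrr.
- rewrite !(mulrBr, mulrBl) -scalerAr -scalerAl !pair_eltM linearB linearZ !GU.
  by rewrite -scalerAl -scalerAr FZl subrr.
- rewrite !(mulrBr, mulrBl) -scalerAr -scalerAl !pair_eltM linearB linearZ !GU.
  by rewrite -scalerAr -scalerAl FZr subrr.
Qed.

Definition env_lift : {linear R -> V} :=
  aquot_lift (I := gen_ideal (@env_proper K A)) env_lift_rel.

Lemma env_liftE a b : env_lift (tensor a b) = F a b.
Proof.
rewrite -(GU a b).
exact: (aquot_liftE (I := gen_ideal (@env_proper K A)) env_lift_rel).
Qed.
End Lift.
End EnvAlgebra.

(** * Projective modules attached to idempotents *)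

Section RestrictScalars.
Variables (K : comNzRingType) (R : algType K) (P Q : lmodType R).
Variable f : {linear P -> Q}.

Definition res_lin (x : restrict_scalars P) : restrict_scalars Q := f x.

Fact res_lin_linear : linear res_lin.
Proof. by move=> k x y; apply: (linearP f). Qed.
HB.instance Definition _ := GRing.isLinear.Build K
  (restrict_scalars P) (restrict_scalars Q) *:%R res_lin res_lin_linear.
End RestrictScalars.

Section IdempotentModule.
Variables (R : nzRingType) (n : nat) (e : nat -> R).
Hypothesis e_idem : forall j, e j * e j = e j.
Hypothesis e_out : forall j, (n <= j)%N -> e j = 0.

Local Notation F := (nat -> R^o).

Fact idem_mod0 : forall j, (0 : F) j * e j = (0 : F) j.
Proof. by move=> j; rewrite mul0r. Qed.

Fact idem_modDZ a (x y : F) : (forall j, x j * e j = x j) ->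
  (forall j, y j * e j = y j) -> forall j, (a *: x + y) j * e j = (a *: x + y) j.
Proof.
move=> xe ye j; rewrite -[(a *: x + y) j]/(a * x j + y j).
by rewrite mulrDl -mulrA xe ye.
Qed.

(* As [e j = 0] for [n <= j], this is the direct sum of the left ideals [R e_j]
   for [j < n]. *)
Definition idem_submodule : submodule F :=
  Submodule (submodule_pred := fun x : F => forall j, x j * e j = x j)
    idem_mod0 idem_modDZ.
Definition idem_mod : lmodType R := sub_type idem_submodule.

Definition entry (x : idem_mod) j : R := val x j.

Lemma entryE x j : entry x j * e j = entry x j.
Proof. by have /mem_subP := valP x. Qed.

Lemma entryP a x y j : entry (a *: x + y) j = a * entry x j + entry y j.
Proof. by []. Qed.

Lemma entryZ a x j : entry (a *: x) j = a * entry x j.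
Proof. by []. Qed.

Lemma eq_entry (x y : idem_mod) : entry x =1 entry y -> x = y.
Proof. by move=> xy; apply/val_inj/funext. Qed.

Fact gen_subproof j :
  (fun i => if i == j then e j else 0 : R) \in mem_sub idem_submodule.
Proof. by apply/mem_subP => i; case: eqP => [->|_]; rewrite ?e_idem ?mul0r. Qed.
Definition gen j : idem_mod := 
  exist (fun x => x \in mem_sub idem_submodule) _ (gen_subproof j).

Lemma entry_gen j i : entry (gen j) i = if i == j then e j else 0.
Proof. by []. Qed.

Lemma gen_out j : (n <= j)%N -> gen j = 0.
Proof.
by move=> nj; apply: eq_entry => i; rewrite entry_gen e_out // if_same.
Qed.

Section Comb.
Variables (M : lmodType R) (w : nat -> M).

(** The family [w] is arbitrary: entries satisfy x_j e_j = x_j, so only e_j w_j counts. Preimages of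
    generators can thus be chosen freely when maps are lifted. *)
Definition comb (x : idem_mod) : M := \sum_(0 <= j < n) entry x j *: w j.

Fact comb_linear : linear comb.
Proof.
move=> a x y; rewrite /comb scaler_sumr -big_split; apply: eq_bigr => j _ /=.
by rewrite entryP scalerDl scalerA.
Qed.
HB.instance Definition _ := GRing.isLinear.Build R idem_mod M *:%R comb comb_linear.

Lemma comb_gen j : (j < n)%N -> comb (gen j) = e j *: w j.
Proof.
move=> jn; rewrite /comb (bigD1_seq j) ?mem_index_iota ?iota_uniq //=.
rewrite entry_gen eqxx big1 ?addr0 // => i /negPf ij.
by rewrite entry_gen ij scale0r.
Qed.
End Comb.

Lemma idem_modE x : x = comb gen x.
Proof.
apply: eq_entry => i; pose ent (y : idem_mod) := entry y i.
have entD : {morph ent : y z / y + z} by [].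
rewrite -[RHS]/(ent _) /comb (big_morph ent entD (erefl : ent 0 = 0)) /ent.
have [ni|ni] := leqP n i.
  rewrite -entryE e_out // mulr0 big1 // => j _.
  by rewrite entryZ entry_gen; case: eqP => [<-|_]; rewrite ?e_out ?mulr0.
rewrite (bigD1_seq i) ?mem_index_iota ?iota_uniq //= entryZ entry_gen eqxx entryE.
rewrite big1 ?addr0 // => j /negPf ji.
by rewrite entryZ entry_gen eq_sym ji mulr0.
Qed.

Lemma lin_comb (M : lmodType R) (f : {linear idem_mod -> M}) :
  f =1 comb (fun j => f (gen j)).
Proof.
move=> x; rewrite {1}(idem_modE x) linear_sum; apply: eq_bigr => j _.
by rewrite linearZ.
Qed.

Lemma eq_idem_mod (M : lmodType R) (f g : {linear idem_mod -> M}) :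
  (forall j, (j < n)%N -> f (gen j) = g (gen j)) -> f =1 g.
Proof.
move=> fg x; rewrite (lin_comb f) (lin_comb g) /comb !big_nat.
apply: eq_bigr => j /= jn.
by rewrite fg.
Qed.

Lemma idem_mod_projective : projective idem_mod.
Proof.
move=> B C g f g_surj; have [s sE] := choice (fun j => g_surj (f (gen j))).
exists (comb s) => x; rewrite linear_sum lin_comb; apply: eq_bigr => j _.
by rewrite linearZ /= sE.
Qed.
End IdempotentModule.

Lemma frame_filter (K : fieldType) (V : lmodType K) (T : eqType) (b : frame V T)
    (p : {linear V -> V}) (good : pred T) x :
  (forall t, t \in fidx b -> p (fvec b t) = if good t then fvec b t else 0) ->
  p x = \sum_(t <- [seq t <- fidx b | good t]) fcoord b t x *: fvec b t.
Proof.
move=> pE; rewrite {1}(frameE b x) linear_sum big_filter [RHS]big_mkcond.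
apply: eq_big_seq => t tb; rewrite linearZ /= pE //.
by case: ifP => //; rewrite scaler0.
Qed.

Section Mul.
Variables (K : comNzRingType) (R : algType K) (a : R).
Definition rmul (x : R) := x * a.
Fact rmul_linear : linear rmul.
Proof. by move=> k x y; rewrite /rmul mulrDl scalerAl. Qed.
HB.instance Definition _ := GRing.isLinear.Build K R R *:%R rmul rmul_linear.
Definition lmul (x : R) := a * x.
Fact lmul_linear : linear lmul.
Proof. by move=> k x y; rewrite /lmul mulrDr scalerAr. Qed.
HB.instance Definition _ := GRing.isLinear.Build K R R *:%R lmul lmul_linear.
End Mul.

(** * Coordinates on projective modules and on Hom spaces *)

Section IdempotentTables.
Variables (T TN : eqType) (B : seq T) (BN : seq TN).
Variables (mulT : T -> T -> seq T) (actN : T -> TN -> seq TN).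

(** Right multiplication by t keeps or kills each basis element, so the kept ones form a basis of
    the left ideal R t. In [hom_ok] the same holds for the action on N, which gives a basis of e
    N. *)
Definition idem_ok (t : T) : bool :=
  all (fun s => mulT s t \in [:: [::]; [:: s]]) B && (mulT t t == [:: t]).

Definition hom_ok (es : seq T) :=
  all (fun s => all (fun t => actN s t \in [:: [::]; [:: t]]) BN) es.

(** [ohead (drop j es)] is the j-th entry as an option, as [T] comes without a default element. *)
Definition pcode es (j : nat) : seq T :=
  if ohead (drop j es) is Some t then [seq s <- B | mulT s t == [:: s]] else [::].
Definition pidx es : seq (nat * T) :=
  [seq (j, s) | j <- iota 0 (size es), s <- pcode es j].

Definition hcode es (j : nat) : seq TN :=
  if ohead (drop j es) is Some s
  then [seq t <- BN | actN s t == [:: t]] else [::].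
Definition hidx es : seq (nat * TN) :=
  [seq (j, t) | j <- iota 0 (size es), t <- hcode es j].
End IdempotentTables.

Section IdemFrame.
Variables (K : fieldType) (R : algType K).
Variables (T : eqType) (bR : frame R T) (mulT : T -> T -> seq T).
Hypothesis mulTE : forall s t, fvec bR s * fvec bR t = fsum (fvec bR) (mulT s t).

Definition idem_table (es : seq T) j : R := nth 0 (map (fvec bR) es) j.

Variables (es : seq T) (es_ok : all (idem_ok (fidx bR) mulT) es).
Local Notation n := (size es).
Local Notation e := (idem_table es).
Local Notation Pcode := (pcode (fidx bR) mulT es).
Local Notation Pidx := (pidx (fidx bR) mulT es).

Lemma idem_table_in t0 j : (j < n)%N -> e j = fvec bR (nth t0 es j).
Proof. exact: nth_map. Qed.

Lemma idem_table_out j : (n <= j)%N -> e j = 0.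
Proof. by move=> nj; rewrite /idem_table nth_default ?size_map. Qed.

Lemma idem_tableM j : e j * e j = e j.
Proof.
have [nj|jn] := leqP n j; first by rewrite idem_table_out // mul0r.
have [t0 _] : {t0 : T | true} by case: (es) jn => // t0 s; exists t0.
rewrite (idem_table_in t0) // mulTE.
by have /allP/(_ _ (mem_nth t0 jn))/andP[_ /eqP ->] := es_ok; rewrite [LHS]big_seq1.
Qed.

Definition pmod : lmodType R := idem_mod e.
Definition pgen : nat -> pmod := gen idem_tableM.

Definition pvec (jt : nat * T) : pmod := fvec bR jt.2 *: pgen jt.1.
Definition pcoord (jt : nat * T) (x : pmod) : K := fcoord bR jt.2 (entry x jt.1).

Lemma fvec_idem t0 j s : (j < n)%N -> s \in fidx bR ->
  fvec bR s * e j = if mulT s (nth t0 es j) == [:: s] then fvec bR s else 0.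
Proof.
move=> jn sb; rewrite (idem_table_in t0) // mulTE.
have /allP/(_ _ (mem_nth t0 jn))/andP[/allP/(_ s sb) + _] := es_ok.
by rewrite !inE => /orP[] /eqP ->; rewrite ?eqxx [LHS](big_nil, big_seq1).
Qed.

Lemma pcodeE (t0 : T) j : (j < n)%N ->
  Pcode j = [seq s <- fidx bR | mulT s (nth t0 es j) == [:: s]].
Proof. by move=> jn; rewrite /pcode (drop_nth t0). Qed.

Lemma mem_pidx (t0 : T) j t : ((j, t) \in Pidx) =
  [&& (j < n)%N, t \in fidx bR & mulT t (nth t0 es j) == [:: t]].
Proof.
apply/allpairsPdep/and3P => [[i [s [+ + [-> ->]]]]|[jn tb tE]].
  by rewrite mem_iota => /= jn; rewrite (pcodeE t0) // mem_filter => /andP[].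
by exists j, t; rewrite mem_iota (pcodeE t0) // mem_filter tE.
Qed.

Lemma pidx_uniq : uniq Pidx.
Proof.
apply: allpairs_uniq_dep; first by rewrite iota_uniq.
  move=> j _; rewrite /pcode; case: ohead => // t.
  by rewrite filter_uniq ?fidx_uniq.
by move=> [i s] [j t] _ _ /= [-> ->].
Qed.

Lemma pvec_idem (t0 : T) j t : (j, t) \in Pidx -> fvec bR t * e j = fvec bR t.
Proof.
by rewrite (mem_pidx t0) => /and3P[jn tb /eqP tE]; rewrite (fvec_idem t0) // tE eqxx.
Qed.

Lemma entry_pvec j t i : (j, t) \in Pidx ->
  entry (pvec (j, t)) i = if i == j then fvec bR t else 0.
Proof.
move=> jt; rewrite /pvec /= entryZ entry_gen (fun_if (fun z => fvec bR t * z)) mulr0.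
by case: eqP => // _; exact: (pvec_idem t jt).
Qed.

Fact pcoord_linear jt k (x y : restrict_scalars (K := K) pmod) :
  pcoord jt (k *: x + y) = k * pcoord jt x + pcoord jt y.
Proof.
rewrite /pcoord -[k *: x]/((k%:A : R) *: (x : pmod)) entryP.
by rewrite mulr_algl fcoord_linear.
Qed.

Fact pframeE (x : restrict_scalars (K := K) pmod) :
  x = \sum_(jt <- Pidx) pcoord jt x *: (pvec jt : restrict_scalars pmod).
Proof.
rewrite big_allpairs_dep /= {1}(idem_modE idem_tableM idem_table_out x) /comb.
rewrite /index_iota subn0; apply: eq_big_seq => j; rewrite mem_iota => /= jn.
have [t0 _] : {t0 : T | true} by case: (es) jn => // t0 s; exists t0.
have -> : entry (x : pmod) j = rmul (e j) (entry (x : pmod) j).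
  by rewrite /rmul entryE.
rewrite (frame_filter (b := bR) (good := fun s => mulT s (nth t0 es j) == [:: s])).
  rewrite scaler_suml (pcodeE t0) //; apply: eq_bigr => s _.
  by rewrite -mulr_algl -scalerA.
by move=> s sb; rewrite /= /rmul (fvec_idem t0).
Qed.

Fact pcoordE s t : s \in Pidx -> t \in Pidx -> pcoord s (pvec t) = (s == t)%:R.
Proof.
case: s t => [i s] [j t] si tj; rewrite /pcoord entry_pvec //= xpair_eqE.
move: si tj; rewrite !(mem_pidx s) => /and3P[_ sb _] /and3P[_ tb _].
case: eqP => _ /=; first exact: fcoordE.
exact: fcoord0.
Qed.

Definition pframe : frame (restrict_scalars (K := K) pmod) (nat * T)%type :=
  Frame pcoord_linear pframeE pidx_uniq pcoordE.
End IdemFrame.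

Section ScalarMaps.
Variables (K : fieldType) (R : algType K) (N : lmodType R).

Definition smul (a : R) (x : restrict_scalars N) : restrict_scalars N := a *: (x : N).
Fact smul_linear a : linear (smul a).
Proof.
move=> k x y; rewrite /smul -[k *: x]/((k%:A : R) *: (x : N)) scalerDr scalerA.
by rewrite mulr_algr -mulr_algl -scalerA.
Qed.
HB.instance Definition _ a := GRing.isLinear.Build K
  (restrict_scalars N) (restrict_scalars N) *:%R (smul a) (smul_linear a).

Definition hom_eval (P : lmodType R) (x : P) (phi : Hom_mod P N) :
  restrict_scalars N := hom_lin phi x.
Fact hom_eval_linear P x : linear (@hom_eval P x).
Proof. by []. Qed.
HB.instance Definition _ P x := GRing.isLinear.Build K
  (Hom_mod P N) (restrict_scalars N) *:%R (@hom_eval P x) (@hom_eval_linear P x).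
End ScalarMaps.

Section SymbolicModule.
Variables (K : fieldType) (R : algType K).
Variables (T : eqType) (bR : frame R T) (mulT : T -> T -> seq T).
Hypothesis mulTE : forall s t, fvec bR s * fvec bR t = fsum (fvec bR) (mulT s t).

Section Act.
Variables (N : lmodType R) (TN : eqType) (bN : frame (restrict_scalars (K := K) N) TN).
Variable actN : T -> TN -> seq TN.

Definition act_rule :=
  forall s t, smul (fvec bR s) (fvec bN t) = fsum (fvec bN) (actN s t).
Hypothesis actE : act_rule.

Definition idem_act (es : seq T) j (l : seq TN) : seq TN :=
  if ohead (drop j es) is Some s then fbind (actN s) l else [::].

Lemma smul_fsum s l :
  smul (fvec bR s) (fsum (fvec bN) l) = fsum (fvec bN) (fbind (actN s) l).
Proof. by apply: raddf_fsum => t _; apply: actE. Qed.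

Lemma idem_actE es j l :
  smul (idem_table bR es j) (fsum (fvec bN) l) = fsum (fvec bN) (idem_act es j l).
Proof.
rewrite /idem_act; have [nj|jn] := leqP (size es) j.
  by rewrite drop_oversize // idem_table_out // /smul scale0r [RHS]big_nil.
have [t0 _] : {t0 : T | true} by case: (es) jn => // t0 s; exists t0.
by rewrite (idem_table_in _ t0) // smul_fsum (drop_nth t0).
Qed.

Variables (es : seq T) (es_ok : all (idem_ok (fidx bR) mulT) es).
Local Notation P := (pmod bR es).
Local Notation n := (size es).
Local Notation pgen := (pgen mulTE es_ok).
Local Notation pvec := (pvec mulTE es_ok).

Definition comb_tab (wt : nat -> seq TN) (jt : nat * T) : seq TN :=
  fbind (actN jt.2) (idem_act es jt.1 (wt jt.1)).

Definition sym_comb (wt : nat -> seq TN) : {linear P -> N} :=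
  comb (size es) (fun j => fsum (fvec bN) (wt j) : N).

Lemma sym_comb_gen wt j : sym_comb wt (pgen j) = fsum (fvec bN) (idem_act es j (wt j)).
Proof.
have [nj|jn] := leqP n j; last first.
  by rewrite [LHS](comb_gen (idem_tableM mulTE es_ok)) // -idem_actE.
have -> : pgen j = 0 by apply: gen_out nj => i; exact: idem_table_out.
rewrite linear0.
by rewrite /idem_act drop_oversize // [RHS]big_nil.
Qed.

Lemma comb_tabE wt jt :
  res_lin (sym_comb wt) (pvec jt) = fsum (fvec bN) (comb_tab wt jt).
Proof. by rewrite /res_lin linearZ /= sym_comb_gen; apply: smul_fsum. Qed.

Hypothesis N_ok : hom_ok (fidx bN) actN es.

Local Notation Hcode := (hcode (fidx bN) actN es).
Local Notation Hidx := (hidx (fidx bN) actN es).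
(** Evaluation at the generator identifies Hom (R e_j, N) with e_j N, so the pairs (j, t) with b_t
    kept by e_j index a basis of Hom (P, N). *)
Definition hvec (ju : nat * TN) : Hom_mod P N :=
  mk_hom (comb n (fun i => if i == ju.1 then fvec bN ju.2 : N else 0)).
Definition hcoord (ju : nat * TN) (phi : Hom_mod P N) : K :=
  fcoord bN ju.2 (hom_eval (pgen ju.1) phi).

Lemma eq_hom (phi psi : Hom_mod P N) :
  (forall j, (j < n)%N -> hom_eval (pgen j) phi = hom_eval (pgen j) psi) -> phi = psi.
Proof.
move=> e; apply/val_inj/funext => x.
have out j : (n <= j)%N -> idem_table bR es j = 0 by apply: idem_table_out.
by apply: (eq_idem_mod (e_idem := idem_tableM mulTE es_ok) out
  (f := hom_lin phi) (g := hom_lin psi)) => j /e.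
Qed.

Lemma hcodeE (t0 : T) j : (j < n)%N ->
  Hcode j = [seq t <- fidx bN | actN (nth t0 es j) t == [:: t]].
Proof. by move=> jn; rewrite /hcode (drop_nth t0). Qed.

Lemma mem_hidx (t0 : T) j t : ((j, t) \in Hidx) =
  [&& (j < n)%N, t \in fidx bN & actN (nth t0 es j) t == [:: t]].
Proof.
apply/allpairsPdep/and3P => [[i [s [+ + [-> ->]]]]|[jn tb tE]].
  by rewrite mem_iota => /= jn; rewrite (hcodeE t0) // mem_filter => /andP[].
by exists j, t; rewrite mem_iota (hcodeE t0) // mem_filter tE.
Qed.

Lemma hidx_uniq : uniq Hidx.
Proof.
apply: allpairs_uniq_dep; first by rewrite iota_uniq.
  move=> j _; rewrite /hcode; case: ohead => // t.
  by rewrite filter_uniq ?fidx_uniq.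
by move=> [i s] [j t] _ _ /= [-> ->].
Qed.

Lemma hom_eval_hvec i j t : (i < n)%N ->
  hom_eval (pgen i) (hvec (j, t)) =
  if i == j then smul (idem_table bR es i) (fvec bN t) else 0.
Proof.
move=> ni; rewrite [LHS](comb_gen (idem_tableM mulTE es_ok)) //=.
by case: eqP => // _; rewrite scaler0.
Qed.

Lemma smul_idem (t0 : T) j t : (j < n)%N -> t \in fidx bN ->
  smul (idem_table bR es j) (fvec bN t) =
  if actN (nth t0 es j) t == [:: t] then fvec bN t else 0.
Proof.
move=> jn tb; rewrite (idem_table_in _ t0) // actE.
have /allP/(_ _ (mem_nth t0 jn))/allP/(_ t tb) := N_ok.
by rewrite !inE => /orP[] /eqP ->; rewrite ?eqxx [LHS](big_nil, big_seq1).
Qed.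

Fact hcoord_linear ju k (phi psi : Hom_mod P N) :
  hcoord ju (k *: phi + psi) = k * hcoord ju phi + hcoord ju psi.
Proof. by rewrite /hcoord linearP fcoord_linear. Qed.

Lemma smul_idem_eval j (phi : Hom_mod P N) :
  smul (idem_table bR es j) (hom_eval (pgen j) phi) = hom_eval (pgen j) phi.
Proof.
rewrite /smul /hom_eval -linearZ; congr (hom_lin phi _).
by apply: eq_entry => i; rewrite entryZ entry_gen; case: eqP => _; rewrite ?mulr0 //;
  exact: (idem_tableM mulTE es_ok).
Qed.

Fact hframeE (phi : Hom_mod P N) : phi = \sum_(ju <- Hidx) hcoord ju phi *: hvec ju.
Proof.
apply: eq_hom => i ni; rewrite linear_sum big_allpairs_dep /=.
have [t0 _] : {t0 : T | true} by case: (es) ni => // t0 s; exists t0.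
rewrite (bigD1_seq i) ?mem_iota ?iota_uniq //= [X in _ + X]big1 ?addr0 => [|j ji].
  rewrite -{1}smul_idem_eval.
  rewrite (frame_filter (b := bN) (good := fun s => actN (nth t0 es i) s == [:: s])).
    rewrite (hcodeE t0) // [in RHS]big_seq [in LHS]big_seq.
    apply: eq_bigr => t; rewrite mem_filter => /andP[/eqP tE tb].
    by rewrite linearZ /= hom_eval_hvec // eqxx (smul_idem t0) // tE eqxx.
  by move=> t tb; rewrite /= (smul_idem t0).
apply: big1 => t _; rewrite linearZ /= hom_eval_hvec // eq_sym (negPf ji).
by rewrite scaler0.
Qed.

Fact hcoordE s t : s \in Hidx -> t \in Hidx -> hcoord s (hvec t) = (s == t)%:R.
Proof.
case: s t => [i s] [j t] si tj; have ni : (i < n)%N.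
  by case/allpairsPdep: si => [k [r [+ _ [-> _]]]]; rewrite mem_iota.
have [t0 _] : {t0 : T | true} by case: (es) ni => // t0 r; exists t0.
move: si tj; rewrite !(mem_hidx t0) => /and3P[_ sb _] /and3P[_ tb /eqP tE].
rewrite /hcoord /= hom_eval_hvec // xpair_eqE; case: eqP ni => [->|_] nj /=.
  by rewrite (smul_idem t0) // tE eqxx fcoordE.
exact: fcoord0.
Qed.

Definition hframe : frame (Hom_mod P N) (nat * TN)%type :=
  Frame hcoord_linear hframeE hidx_uniq hcoordE.
End Act.

Section CochainTable.
Variables (N : lmodType R) (TN : eqType) (bN : frame (restrict_scalars (K := K) N) TN).
Variables (actN : T -> TN -> seq TN) (actE : act_rule bN actN).
Variables (es es' : seq T).
Variable es_ok : all (idem_ok (fidx bR) mulT) es.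
Variable es_ok' : all (idem_ok (fidx bR) mulT) es'.
Variables (bP : frame (restrict_scalars (K := K) (pmod bR es)) (nat * T)%type).
Hypothesis bPE : fvec bP = pvec mulTE es_ok.
Variable wt : nat -> seq (nat * T).

(** phi o d sends the i-th generator to e_i phi(w_i), and for phi = [hvec (j, u)] only the terms of
    w_i in the j-th summand contribute, the generator there going to e_j b_u. *)
Definition cocode (ju : nat * TN) i : seq TN :=
  idem_act actN es' i
    (fbind (fun js => if js.1 == ju.1
                      then fbind (actN js.2) (idem_act actN es js.1 [:: ju.2])
                      else [::]) (wt i)).
Definition codiff_tab (ju : nat * TN) : seq (nat * TN) :=
  [seq (i, q) | i <- iota 0 (size es'), q <- cocode ju i].

Lemma codiff_tabE ju :
  precomp (sym_comb bP es' wt) (hvec bN es ju) = fsum (hvec bN es') (codiff_tab ju).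
Proof.
apply: (eq_hom (es_ok := es_ok')) => i ni.
rewrite [RHS]linear_sum big_allpairs_dep /=.
rewrite (bigD1_seq i) ?mem_iota ?iota_uniq //= [X in _ + X]big1 ?addr0; last first.
  move=> j ji; apply: big1 => t _.
  by rewrite hom_eval_hvec // eq_sym (negPf ji).
pose e' : {linear restrict_scalars N -> restrict_scalars N} :=
  smul (idem_table bR es' i).
have -> : \sum_(t <- cocode ju i) hom_eval (pgen mulTE es_ok' i) (hvec bN es' (i, t)) =
    e' (fsum (fvec bN) (cocode ju i)).
  by rewrite linear_sum; apply: eq_bigr => t _; rewrite hom_eval_hvec // eqxx.
(* Both [cocode] and the evaluation of [hvec] multiply by e_i; idempotence merges the two
   factors. *)
rewrite /cocode -(idem_actE actE) /e' /= /smul scalerA (idem_tableM mulTE es_ok').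
rewrite -[LHS]/(hom_eval (sym_comb bP es' wt (pgen mulTE es_ok' i)) (hvec bN es ju)).
rewrite /sym_comb [X in hom_eval X _](comb_gen (idem_tableM mulTE es_ok')) //.
rewrite /hom_eval linearZ; apply: (congr1 (fun z : N => idem_table bR es' i *: z)).
pose h :
    {linear restrict_scalars (K := K) (pmod bR es) -> restrict_scalars (K := K) N} :=
  res_lin (hom_lin (hvec bN es ju)).
rewrite -[LHS]/(h (fsum (fvec bP) (wt i))); apply: raddf_fsum => -[j s] _.
rewrite bPE /h /= /res_lin /pvec linearZ /=.
have [nj|jn] := leqP (size es) j.
  rewrite /idem_act drop_oversize // if_same /fsum big_nil.
  have -> : pgen mulTE es_ok j = 0 by apply: gen_out nj => k; exact: idem_table_out.
  by rewrite linear0 scaler0.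
case: ju {h} => j' u /=.
rewrite -[comb _ _ _]/(hom_eval (pgen mulTE es_ok j) (hvec bN es (j', u))).
rewrite hom_eval_hvec //; case: eqP => _; last first.
  by rewrite scaler0 /fsum big_nil.
by rewrite -(smul_fsum actE) -(idem_actE actE) /fsum big_seq1.
Qed.
End CochainTable.
End SymbolicModule.

(** * Ext from tables *)

Section ClassTables.
Variables (TU TV TW : eqType) (BU : seq TU) (BV : seq TV) (BW : seq TW).
Variables (dtab : TV -> seq TU) (dtab' : TW -> seq TV).
Variables (d : nat) (h : TV -> seq TW) (h' : TU -> seq TV).
Variables (pt : TV -> seq nat) (it : nat -> seq TV).

(** With D and D' the outgoing and incoming maps, these identities read D' h + h' D + it pt = 1, pt
    it = 1, D it = 0 and pt D' = 0. Together they make [pt] an isomorphism from ker D / im D' onto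
    K^d with inverse [it]. *)
Definition class_check :=
  [&& all (fun t => [&& all (mem BU) (dtab t), all (fun i => i < d)%N (pt t)
          & feq (fbind dtab' (h t) ++ fbind h' (dtab t) ++ fbind it (pt t)) [:: t]])
        BV,
      all (fun k => [&& all (mem BV) (it k), feq (fbind pt (it k)) [:: k]
          & feq (fbind dtab (it k)) [::]]) (iota 0 d)
    & all (fun t => all (mem BV) (dtab' t) && feq (fbind pt (dtab' t)) [::])
        BW].

End ClassTables.

Section DetectCheck.
Variables (K : fieldType) (charK : 2%N \in [pchar K]).
Variables (U V W : lmodType K) (TU TV TW : eqType).
Variables (bU : frame U TU) (bV : frame V TV) (bW : frame W TW).
Variables (D : {linear V -> U}) (dtab : TV -> seq TU).
Variables (D' : {linear W -> V}) (dtab' : TW -> seq TV).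
Hypothesis DE : forall t, D (fvec bV t) = fsum (fvec bU) (dtab t).
Hypothesis DE' : forall t, D' (fvec bW t) = fsum (fvec bV) (dtab' t).
Variables (d : nat) (h : TV -> seq TW) (h' : TU -> seq TV).
Variables (pt : TV -> seq nat) (it : nat -> seq TV).

Definition std_row k : 'rV[K]_d := \row_i (i == k :> nat)%:R.
Definition class_map : {linear V -> 'rV[K]_d} :=
  frame_ext bV (fun t => fsum std_row (pt t)).

Definition repr_class (x : 'rV[K]_d) : V :=
  \sum_i x ord0 i *: fsum (fvec bV) (it i).

Fact repr_class_linear : linear repr_class.
Proof.
move=> a x y; rewrite /repr_class scaler_sumr -big_split; apply: eq_bigr => i _.
by rewrite !mxE scalerDl scalerA.
Qed.
HB.instance Definition _ :=
  GRing.isLinear.Build K 'rV[K]_d V *:%R repr_class repr_class_linear.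

Lemma repr_class_std k : (k < d)%N -> repr_class (std_row k) = fsum (fvec bV) (it k).
Proof.
move=> kd; rewrite /repr_class (bigD1 (Ordinal kd)) //= mxE eqxx scale1r.
rewrite big1 ?addr0 // => i; rewrite -val_eqE /= mxE => /negPf ->.
by rewrite scale0r.
Qed.

Lemma class_map_fsum l : all (mem (fidx bV)) l ->
  class_map (fsum (fvec bV) l) = fsum std_row (fbind pt l).
Proof.
by move=> /allP lV; apply: raddf_fsum => t /lV tV; rewrite [LHS]frame_extE.
Qed.

Lemma class_mapP :
  class_check (fidx bU) (fidx bV) (fidx bW) dtab dtab' d h h' pt it ->
  (forall x, D x = 0 -> class_map x = 0 <-> exists y, D' y = x) /\
  (forall v, exists2 x, D x = 0 & class_map x = v).
Proof.
have V2 := char2_addxx (V := V) charK; have U2 := char2_addxx (V := U) charK.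
have r2 := char2_addxx (V := 'rV[K]_d) charK.
move=> /and3P[/allP c1 /allP c2 /allP c3]; split=> [x Dx|v].
  split=> [Tx|[y <-]]; last first.
    pose z : {linear W -> 'rV[K]_d} := \0.
    apply: (eq_frame (b := bW) (f := class_map \o D') (g := z)) => t /c3/andP[tV te].
    by rewrite /= DE' class_map_fsum // (feqP r2 _ te) [LHS]big_nil.
  pose s := frame_ext bV (fun t => fsum (fvec bW) (h t)).
  pose s' := frame_ext bU (fun t => fsum (fvec bV) (h' t)).
  exists (s x); pose f : {linear V -> V} :=
    (D' \o s) \+ ((s' \o D) \+ (repr_class \o class_map)).
  have fx : D' (s x) + (s' (D x) + repr_class (class_map x)) = x.
    change (f x = idfun x).
    apply: (eq_frame (b := bV) (f := f) (g := idfun)) => t tV.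
    have /and3P[/allP tU /allP td te] := c1 t tV.
    rewrite /f /= /s /class_map /= !(frame_extE (b := bV)) // DE.
    rewrite (raddf_fsum (fun t _ => DE' t)).
    rewrite (raddf_fsum (w := fvec bV) (tab := h')); last first.
      by move=> u /tU uU; rewrite /= /s' frame_extE.
    rewrite (raddf_fsum (f := repr_class) (w := fvec bV) (tab := it)); last first.
      by move=> k /td kd; apply: repr_class_std.
    by rewrite -!fsum_cat (feqP V2 _ te) [LHS]big_seq1.
  have s0 : s' 0 = 0 := linear0 _; have r0 : repr_class 0 = 0 := linear0 _.
  by rewrite -[RHS]fx Dx Tx s0 r0 !addr0.
have ii (i : 'I_d) : (i : nat) \in iota 0 d by rewrite mem_iota ltn_ord.
exists (repr_class v).
  rewrite /repr_class linear_sum big1 // => i _; rewrite linearZ /=.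
  have /and3P[_ _ e] := c2 i (ii i).
  by rewrite (raddf_fsum (fun t _ => DE t)) (feqP U2 _ e) /fsum big_nil scaler0.
rewrite /repr_class linear_sum [RHS]row_sum_delta; apply: eq_bigr => i _.
have /and3P[itV e _] := c2 i (ii i).
rewrite linearZ /= [X in _ *: X]class_map_fsum // (feqP r2 _ e) /fsum big_seq1.
by congr (_ *: _); apply/rowP => j; rewrite !mxE eqxx val_eqE.
Qed.
End DetectCheck.

Section ResolutionTables.
Variables (T TM : eqType) (BR : seq T) (BM : seq TM).
Variables (mulT : T -> T -> seq T) (actM : T -> TM -> seq TM).

Definition pact (s : T) (jt : nat * T) : seq (nat * T) :=
  [seq (jt.1, p) | p <- mulT s jt.2].

Variables es0 es1 es2 es3 : seq T.
Variables (w0 : nat -> seq TM) (w1 w2 w3 : nat -> seq (nat * T)).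
Variables (sm : TM -> seq (nat * T)) (s0 s1 s2 : nat * T -> seq (nat * T)).

Definition aug_tab := comb_tab actM es0 w0.
Definition d_tab es w := comb_tab pact es w.

Definition resolution_check : bool :=
  let t1 := d_tab es1 w1 in let t2 := d_tab es2 w2 in let t3 := d_tab es3 w3 in
  let i0 := pidx BR mulT es0 in let i1 := pidx BR mulT es1 in
  let i2 := pidx BR mulT es2 in
  [&& all (fun t => feq (fbind aug_tab (sm t)) [:: t]) BM,
      all (fun t => feq (fbind aug_tab (t1 t)) [::]) i1,
      all (fun t => feq (fbind t1 (t2 t)) [::]) i2,
      all (fun t => feq (fbind t2 (t3 t)) [::]) (pidx BR mulT es3),
      all (fun t => all (mem BM) (aug_tab t) &&
        feq (fbind sm (aug_tab t) ++ fbind t1 (s0 t)) [:: t]) i0,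
      all (fun t => all (mem i0) (t1 t) &&
        feq (fbind s0 (t1 t) ++ fbind t2 (s1 t)) [:: t]) i1
    & all (fun t => all (mem i1) (t2 t) &&
        feq (fbind s1 (t2 t) ++ fbind t3 (s2 t)) [:: t]) i2].
End ResolutionTables.

Section ExtTables.
Variables (K : fieldType) (charK : 2%N \in [pchar K]) (R : algType K).
Variables (T : eqType) (bR : frame R T) (mulT : T -> T -> seq T).
Hypothesis mulTE : forall s t, fvec bR s * fvec bR t = fsum (fvec bR) (mulT s t).
Variables (M : lmodType R) (TM : eqType) (bM : frame (restrict_scalars (K := K) M) TM).
Variables (actM : T -> TM -> seq TM) (actME : act_rule bR bM actM).

Local Notation pact := (pact mulT).

Lemma pactE es (es_ok : all (idem_ok (fidx bR) mulT) es) :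
  act_rule bR (pframe mulTE es_ok) pact.
Proof.
move=> s [j t]; rewrite /smul /= /pvec /= scalerA mulTE /fsum scaler_suml big_map.
by [].
Qed.

Variables es0 es1 es2 es3 : seq T.
Local Notation table_ok := (all (idem_ok (fidx bR) mulT)).
Hypotheses (ok0 : table_ok es0) (ok1 : table_ok es1) (ok2 : table_ok es2).
Hypothesis ok3 : table_ok es3.
Variables (w0 : nat -> seq TM) (w1 w2 w3 : nat -> seq (nat * T)).
Variables (sm : TM -> seq (nat * T)) (s0 s1 s2 : nat * T -> seq (nat * T)).

Hypothesis r_check : resolution_check (fidx bR) (fidx bM) mulT actM
  es0 es1 es2 es3 w0 w1 w2 w3 sm s0 s1 s2.

Let b0 := pframe mulTE ok0.
Let b1 := pframe mulTE ok1.
Let b2 := pframe mulTE ok2.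
Let b3 := pframe mulTE ok3.
Let aug : {linear pmod bR es0 -> M} := sym_comb bR bM es0 w0.
Let d1 : {linear pmod bR es1 -> pmod bR es0} := sym_comb bR b0 es1 w1.
Let d2 : {linear pmod bR es2 -> pmod bR es1} := sym_comb bR b1 es2 w2.
Let d3 : {linear pmod bR es3 -> pmod bR es2} := sym_comb bR b2 es3 w3.

Local Notation aug_tab := (aug_tab actM es0 w0).
Local Notation d_tab := (d_tab mulT).

Let augE t : res_lin aug (fvec b0 t) = fsum (fvec bM) (aug_tab t).
Proof. exact: comb_tabE. Qed.
Let d1E t : res_lin d1 (fvec b1 t) = fsum (fvec b0) (d_tab es1 w1 t).
Proof. exact: (comb_tabE mulTE (pactE ok0) ok1). Qed.
Let d2E t : res_lin d2 (fvec b2 t) = fsum (fvec b1) (d_tab es2 w2 t).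
Proof. exact: (comb_tabE mulTE (pactE ok1) ok2). Qed.
Let d3E t : res_lin d3 (fvec b3 t) = fsum (fvec b2) (d_tab es3 w3 t).
Proof. exact: (comb_tabE mulTE (pactE ok2) ok3). Qed.

Let aug_surj m : exists x, aug x = m.
Proof. by case/and5P: r_check => h *; apply: (split_check charK augE h). Qed.

Let exact_0 x : aug x = 0 <-> exists y, d1 y = x.
Proof.
case/and5P: r_check => _ c _ _ /and3P[h _ _].
split=> [|[y <-]]; first exact: (homotopy_check charK augE d1E h).
exact: (complex_check charK augE d1E c).
Qed.

Let exact_1 x : d1 x = 0 <-> exists y, d2 y = x.
Proof.
case/and5P: r_check => _ _ c _ /and3P[_ h _].
split=> [|[y <-]]; first exact: (homotopy_check charK d1E d2E h).
exact: (complex_check charK d1E d2E c).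
Qed.

Let exact_2 x : d2 x = 0 <-> exists y, d3 y = x.
Proof.
case/and5P: r_check => _ _ _ c /and3P[_ _ h].
split=> [|[y <-]]; first exact: (homotopy_check charK d2E d3E h).
exact: (complex_check charK d2E d3E c).
Qed.

Let pmod_proj : [/\ projective (pmod bR es0), projective (pmod bR es1)
  & projective (pmod bR es2)].
Proof.
by split; apply: (idem_mod_projective (idem_tableM mulTE _)) => // j;
  exact: idem_table_out.
Qed.

Let P := ext_resolution pmod_proj aug_surj exact_0 exact_1.

Local Notation hom_ok := (hom_ok (fidx bM) actM).
Hypotheses (hok0 : hom_ok es0) (hok1 : hom_ok es1) (hok2 : hom_ok es2).
Hypothesis hok3 : hom_ok es3.

Let c0 := hframe mulTE actME ok0 (hok0).
Let c1 := hframe mulTE actME ok1 (hok1).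
Let c2 := hframe mulTE actME ok2 (hok2).
Let c3 := hframe mulTE actME ok3 (hok3).

Local Notation codiff_tab := (codiff_tab actM).

Let delta0E t : precomp d1 (fvec c0 t) = fsum (fvec c1) (codiff_tab es0 es1 w1 t).
Proof. exact: (codiff_tabE actME ok1 (es_ok := ok0) (bP := b0) erefl w1 t). Qed.
Let delta1E t : precomp d2 (fvec c1 t) = fsum (fvec c2) (codiff_tab es1 es2 w2 t).
Proof. exact: (codiff_tabE actME ok2 (es_ok := ok1) (bP := b1) erefl w2 t). Qed.
Let delta2E t : precomp d3 (fvec c2 t) = fsum (fvec c3) (codiff_tab es2 es3 w3 t).
Proof. exact: (codiff_tabE actME ok3 (es_ok := ok2) (bP := b2) erefl w3 t). Qed.

Local Notation hidx := (hidx (fidx bM) actM).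

Lemma Ext0_dim q h' pt it :
  class_check (hidx es1) (hidx es0) (hidx es0) (codiff_tab es0 es1 w1) (fun=> [::])
    q (fun=> [::]) h' pt it ->
  has_dim (Ext (K := K) M M 0) q.
Proof.
(* In degree 0 only the zero cochain is a coboundary; a zero map stands for the missing incoming
   differential. *)
pose z : {linear Hom_mod (pmod bR es0) M -> Hom_mod (pmod bR es0) M} := \0.
have zE t : z (fvec c0 t) = fsum (fvec c0) [::] by rewrite /fsum big_nil.
move=> /(class_mapP charK delta0E zE) [Tker Tsurj].
apply: (Ext_dim_of_resolution (P := P) (n := 0) (T := class_map c0 q pt)).
split=> // x x0; split=> [/(Tker x x0) [_ <-] //|xB].
by apply/(Tker x x0); exists 0; rewrite xB.
Qed.

Lemma Ext1_dim q h h' pt it :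
  class_check (hidx es2) (hidx es1) (hidx es0) (codiff_tab es1 es2 w2)
    (codiff_tab es0 es1 w1) q h h' pt it ->
  has_dim (Ext (K := K) M M 1) q.
Proof.
move=> /(class_mapP charK delta1E delta0E) [Tker Tsurj].
exact: (Ext_dim_of_resolution (P := P) (n := 1) (T := class_map c1 q pt)).
Qed.

Lemma Ext2_dim q h h' pt it :
  class_check (hidx es3) (hidx es2) (hidx es1) (codiff_tab es2 es3 w3)
    (codiff_tab es1 es2 w2) q h h' pt it ->
  has_dim (Ext (K := K) M M 2) q.
Proof.
move=> /(class_mapP charK delta2E delta1E) [Tker Tsurj].
(* The third differential of [P] starts from a free module on the kernel of [d2], not from the
   explicit P_3; both have this kernel as image, so they define the same cocycles. *)
have cocycle2 (phi : Hom_mod (pmod bR es2) M) :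
    precomp (res_d P 2) phi = 0 <-> precomp d3 phi = 0.
  split=> [phi0|phi0].
    apply/val_inj/funext => y; apply: (cocycle_cycle (S := P) (n := 2) phi0).
    by apply/exact_2; exists y.
  apply: (cocycleP (S := P) (n := 2)) => x /exact_2[y <-].
  exact: (congr1 (fun psi => val psi y) phi0).
apply: (Ext_dim_of_resolution (P := P) (n := 2) (T := class_map c2 q pt)).
split=> [x /cocycle2 x0|v]; first exact: Tker.
by have [x x0 xv] := Tsurj v; exists x => //; apply/cocycle2.
Qed.
End ExtTables.

(** * Path algebras *)

Lemma catalg_morphM (K : comNzRingType) (C : fincat) (B : algType K)
    (f : {linear catalg K C -> B}) :
  (forall p q, f (cbase K p * cbase K q) = f (cbase K p) * f (cbase K q)) ->
  {morph f : x y / x * y}.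
Proof.
move=> fM x y; elim/catalg_ind: x => [|x x' hx hx'|k p].
- by rewrite mul0r linear0 mul0r.
- by rewrite mulrDl (linearD f x) (linearD f (x * y)) hx hx' mulrDl.
rewrite -scalerAl !linearZ /= -scalerAl; congr (_ *: _).
elim/catalg_ind: y => [|y y' hy hy'|k' q].
- by rewrite mulr0 linear0 mulr0.
- by rewrite mulrDr (linearD f y) (linearD f (_ * y)) hy hy' mulrDr.
by rewrite -scalerAr !linearZ /= -scalerAr fM.
Qed.

Lemma path_eltM (K : comNzRingType) (Q : quiver) (p q : qpath Q) :
  path_elt K p * path_elt K q = obase K (path_comp p q : option (path_cat Q)).
Proof. exact: catmulUU. Qed.

Section PathMorphism.
Variables (K : comNzRingType) (Q : quiver) (B : algType K).
Variables (E : vertex Q -> B) (X : arrow Q -> B).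
Local Notation KQ := (path_algebra K Q).

Definition word_val (v : vertex Q) (s : seq (arrow Q)) : B := E v * \prod_(a <- s) X a.

Lemma word_val_rcons v s a : word_val v (rcons s a) = word_val v s * X a.
Proof. by rewrite /word_val -cats1 big_cat big_seq1 mulrA. Qed.

Hypothesis EM : forall v w, E v * E w = if v == w then E v else 0.
Hypothesis XE : forall a, X a * E (target a) = X a.

Lemma word_val_end v s : is_path v s ->
  word_val v s * E (last v [seq target a | a <- s]) = word_val v s.
Proof.
case/lastP: s => [|s a] _; rewrite /word_val; first by rewrite big_nil mulr1 EM eqxx.
by rewrite map_rcons last_rcons -cats1 big_cat big_seq1 /= -!mulrA XE.
Qed.

Definition path_morph : {linear KQ -> B} :=
  lin_ext (fun p : qpath Q => word_val (val p).1 (val p).2).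

Lemma path_morph_path p : path_morph (path_elt K p) = word_val (val p).1 (val p).2.
Proof. exact: lin_extU. Qed.

(** The value on [p] absorbs E (path_end p) on the right. Against the first factor E (path_start q)
    of the value on [q] this idempotent disappears if the paths compose and gives 0 otherwise. *)
Lemma path_morph_pathM p q :
  path_morph (path_elt K p * path_elt K q) =
  path_morph (path_elt K p) * path_morph (path_elt K q).
Proof.
rewrite [X in _ = X * _]path_morph_path [X in _ = _ * X]path_morph_path path_eltM.
have pend := word_val_end (valP p); rewrite -/(path_end p) in pend.
rewrite -pend -mulrA; case: path_compP => [r e rE|e].
  rewrite [LHS]path_morph_path rE /= e {1 3}/word_val mulrA -[(val q).1]/(path_start q).
  by rewrite -mulrA (mulrA (E _)) EM eqxx mulrA -e pend /word_val -mulrA -big_cat.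
rewrite [path_morph _]linear0 {2}/word_val (mulrA (E (path_end p))) EM.
by case: eqP => // _; rewrite mul0r mulr0.
Qed.

Lemma path_morphM f g : path_morph (f * g) = path_morph f * path_morph g.
Proof. exact: (catalg_morphM (f := path_morph) path_morph_pathM). Qed.
End PathMorphism.

Section PathGenerators.
Variables (K : comNzRingType) (Q : quiver).
Local Notation KQ := (path_algebra K Q).
Local Notation E v := (path_elt K (trivial_path v)).

Lemma trivialM (v w : vertex Q) : E v * E w = if v == w then E v else 0 :> KQ.
Proof.
rewrite path_eltM; case: path_compP => [r e rE|/= e].
  by congr (cbase _ _); apply: val_inj; rewrite rE.
by [].
Qed.

Lemma trivial_arrowM (v : vertex Q) a :
  E v * arrow_elt K a = if source a == v then arrow_elt K a else 0 :> KQ.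
Proof.
rewrite path_eltM; case: path_compP => [r e rE|ne].
  have {}e : v = source a := e; rewrite -e eqxx.
  by congr (cbase _ _); apply: val_inj; rewrite rE [path_start _]e.
have /negPf -> // : source a != v.
by apply/eqP => e; apply: ne; exact: esym e.
Qed.

Lemma arrow_trivialM (v : vertex Q) a :
  arrow_elt K a * E v = if target a == v then arrow_elt K a else 0 :> KQ.
Proof.
rewrite path_eltM; case: path_compP => [r e rE|_]; last by [].

by congr (cbase _ _); apply: val_inj; rewrite rE.
Qed.

Lemma path_eltE (p : qpath Q) :
  path_elt K p = word_val (fun v => E v : KQ) (@arrow_elt K Q) (val p).1 (val p).2.
Proof.
case pE: (val p) => [v s] /=; elim/last_ind: s p pE => [|s a IH] p pE.
  rewrite /word_val big_nil mulr1; congr (path_elt _ _); apply: val_inj.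
  by rewrite pE.
have /andP[ps /andP[/eqP sa _]] :
    is_path v s && is_path (last v [seq target a | a <- s]) [:: a].
  by rewrite -is_path_cat cats1; have := valP p; rewrite pE.
pose p' : qpath Q := exist (fun p => is_path p.1 p.2) (v, s) ps.
rewrite word_val_rcons -(IH p' erefl) path_eltM.
case: path_compP => [r e rE|[]]; last by rewrite -[path_end _]/(last v _) -sa.
by congr (cbase _ _); apply: val_inj; rewrite rE pE -cats1.
Qed.
End PathGenerators.

(** * Algebras given by a table of words *)

(* Vertices, arrows and basis elements are coded by natural numbers; a word is a
   starting vertex with a list of arrows.  [tbl] is the table of the right
   multiplication of the basis elements by the arrows. *)
Section WordTables.
Variables (nv : nat) (src tgt : nat -> nat).
Variables (words : seq (nat * seq nat)) (tbl : seq (seq (seq nat))).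

(** The default word starts at [nv], one beyond the vertices, where [E_out] makes the idempotent
    vanish: codes out of range denote 0. *)
Definition word u := nth (nv, [::]) words u.
Definition wend u := last (word u).1 (map tgt (word u).2).
Definition rt u a : seq nat := nth [::] (nth [::] tbl u) a.
Definition wrun l (w : nat * seq nat) :=
  foldl (fun l a => fbind (rt^~ a) l) [seq u <- l | wend u == w.1] w.2.
Definition wmul u v := wrun [:: u] (word v).

Definition expand (rels : seq (seq (seq nat))) (cert : seq (seq nat * nat * seq nat)) :=
  flatten [seq [seq c.1.1 ++ t ++ c.2 | t <- nth [::] rels c.1.2] | c <- cert].

(** Soundness of the table: the certificate writes u a plus its tabulated value as a sum of
    multiples of relations, compared as formal sums of words, so the table is valid in every algebra
    of characteristic 2 with these relations. *)
Definition table_check rels (cert : nat -> nat -> seq (seq nat * nat * seq nat)) na :=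
  [&& size tbl == size words, all (fun r => size r == na) tbl
    & all (fun u => all (fun a =>
        if wend u == src a
        then [&& all (fun w => (word w).1 == (word u).1) (rt u a),
                 all (fun w => wend w == tgt a) (rt u a)
               & feq (rcons (word u).2 a :: map (fun w => (word w).2) (rt u a))
                     (expand rels (cert u a))]
        else rt u a == [::]) (iota 0 na)) (iota 0 (size words))].

(** The independence half: the relations act by zero through the table, and each word, applied to
    the unit (the sum of the first [nv] codes), returns its own basis vector. *)
Definition rep_check (rels : seq (seq (seq nat))) :=
  [&& all (fun u => all (fun r =>
        feq (flatten [seq foldl (fun l a => fbind (rt^~ a) l) [:: u] t | t <- r]) [::])
        rels) (iota 0 (size words))
    & all (fun u => feq (wrun (iota 0 nv) (word u)) [:: u]) (iota 0 (size words))].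

Section Ring.
Variables (K : fieldType) (charK : 2%N \in [pchar K]) (B : algType K).
Variables (na : nat) (E X : nat -> B).
Hypothesis EE : forall i j, E i * E j = if i == j then E i else 0.
Hypothesis EX : forall i a, E i * X a = if src a == i then X a else 0.
Hypothesis XE : forall i a, X a * E i = if tgt a == i then X a else 0.
Hypothesis E_out : E nv = 0.
Hypothesis X_out : forall a, (na <= a)%N -> X a = 0.

Let B2 (x : B) : x + x = 0 := char2_addxx charK x.

Definition wvec u : B := E (word u).1 * \prod_(a <- (word u).2) X a.

Lemma wvec_out u : (size words <= u)%N -> wvec u = 0.
Proof. by move=> le; rewrite /wvec /word nth_default // E_out mul0r. Qed.

Lemma wvecE u i : wvec u * E i = if wend u == i then wvec u else 0.
Proof.
rewrite /wvec /wend; case: (word u) => v s /=; case/lastP: s => [|s a].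
  by rewrite big_nil mulr1 EE.
rewrite map_rcons last_rcons -cats1 big_cat big_seq1 /= -!mulrA XE.
by case: eqP; rewrite ?mulr0.
Qed.

Definition vanish (l : seq (seq nat)) := \sum_(t <- l) \prod_(a <- t) X a = 0.

Lemma expand_vanish rels cert :
  (forall l, l \in rels -> vanish l) -> vanish (expand rels cert).
Proof.
move=> h; rewrite /vanish /expand big_flatten big_map big1 // => -[[x r] y] _ /=.
rewrite big_map; transitivity ((\prod_(a <- x) X a) *
    (\sum_(t <- nth [::] rels r) \prod_(a <- t) X a) * \prod_(a <- y) X a).
  rewrite mulr_sumr mulr_suml; apply: eq_bigr => t _.
  by rewrite !big_cat /= mulrA.
have [rs|sr] := ltnP r (size rels); first by rewrite h ?mem_nth // mulr0 mul0r.
by rewrite nth_default // big_nil mulr0 mul0r.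
Qed.

Lemma cert_vanish rels cert l : (forall l, l \in rels -> vanish l) ->
  feq l (expand rels cert) -> vanish l.
Proof.
move=> h /(feqP B2 (fun t => \prod_(a <- t) X a)) e.
by rewrite /vanish -/(fsum _ l) e; apply: expand_vanish.
Qed.

Variables (rels : seq (seq (seq nat))).
Variable cert : nat -> nat -> seq (seq nat * nat * seq nat).
Hypothesis rels0 : forall l, l \in rels -> vanish l.
Hypothesis t_check : table_check rels cert na.

Lemma rt_out u a : ((size words <= u) || (na <= a))%N -> rt u a = [::].
Proof.
case/and3P: t_check => /eqP s1 /allP s2 _.
rewrite /rt => le; have [us|su] := ltnP u (size tbl); last first.
  by rewrite [nth _ tbl u]nth_default // nth_nil.
rewrite nth_default // (eqP (s2 _ (mem_nth _ us))).
by move: le; rewrite -s1 leqNgt us.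
Qed.

Lemma wvecX u a : wvec u * X a = fsum wvec (rt u a).
Proof.
case/and3P: t_check => _ _ /allP c.
have [out|] := boolP ((size words <= u) || (na <= a))%N.
  rewrite rt_out // /fsum big_nil.
  by case/orP: out => le; rewrite ?(wvec_out le) ?mul0r ?(X_out le) ?mulr0.
rewrite negb_or -!ltnNge => /andP[us an].
have iu : u \in iota 0 (size words) by rewrite mem_iota.
have ia : a \in iota 0 na by rewrite mem_iota.
have /allP/(_ a ia) := c u iu.
case: eqP => [we|we /eqP ->]; last first.
  have e : wvec u * E (wend u) = wvec u by rewrite wvecE eqxx.
  by rewrite -e -mulrA EX eq_sym; case: eqP => // _; rewrite mulr0 /fsum big_nil.
case/and3P=> /allP cs _ /(cert_vanish rels0).
rewrite /vanish big_cons big_map -cats1 big_cat big_seq1 /= => /eqP.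
have Bopp (x : B) : - x = x by apply/eqP; rewrite eq_sym -addr_eq0 B2.
rewrite addr_eq0 Bopp /wvec -mulrA => /eqP ->; rewrite mulr_sumr.
by apply: eq_big_seq => w /cs /eqP ->.
Qed.

Definition rmulX a : {linear B -> B} := rmul (X a).

Lemma wvec_run l (w : nat * seq nat) :
  fsum wvec l * (E w.1 * \prod_(a <- w.2) X a) = fsum wvec (wrun l w).
Proof.
rewrite mulrA /wrun.
have -> : fsum wvec l * E w.1 = fsum wvec [seq u <- l | wend u == w.1].
  rewrite /fsum mulr_suml big_filter [RHS]big_mkcond; apply: eq_bigr => u _.
  exact: wvecE.
elim: w.2 (filter _ _) => [|a s IH] k /=; first by rewrite big_nil mulr1.
rewrite big_cons mulrA -IH; congr (_ * _).
exact: (raddf_fsum (f := rmulX a) (fun u _ => wvecX u a)).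
Qed.

Lemma wvecM u v : wvec u * wvec v = fsum wvec (wmul u v).
Proof. by rewrite -wvec_run /fsum big_seq1. Qed.
End Ring.

(** * The matrix representation defined by a table *)

Section Matrices.
Variables (K : fieldType) (charK : 2%N \in [pchar K]) (m na : nat).
Local Notation n := m.+1.
Local Notation std := (std_row K n).
Local Notation MX := ('M[K]_n).

(** The matrices act on row vectors from the right, so that their products follow paths from left to
    right. *)
Definition vmx i : MX := \matrix_(u, w) ((u == w) && (wend u == i))%:R.
Definition amx a : MX := \matrix_(u, w) (odd (count_mem (w : nat) (rt u a)))%:R.

Lemma std_out u : (n <= u)%N -> std u = 0.
Proof.
move=> nu; apply/rowP => j; rewrite !mxE; case: eqP => // ju.
by have := ltn_ord j; rewrite ju ltnNge nu.
Qed.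

Lemma std_mul (M : MX) (u : 'I_n) : std u *m M = row u M.
Proof. by rewrite rowE; congr (_ *m _); apply/rowP => j; rewrite !mxE eqxx. Qed.

Lemma std_vmx u i : std u *m vmx i = if wend u == i then std u else 0.
Proof.
have [nu|un] := leqP n u; first by rewrite std_out // mul0mx if_same.
rewrite (std_mul _ (Ordinal un)); apply/rowP => j.
rewrite !mxE (fun_if (fun z : 'rV[K]_n => z ord0 j)) !mxE -val_eqE /= eq_sym.
by case: (wend u == i); rewrite ?andbT ?andbF.
Qed.

Hypothesis size_tbl : size tbl = n.

Lemma std_amx u a : std u *m amx a = fsum std (rt u a).
Proof.
have [nu|un] := leqP n u.
  rewrite std_out // mul0mx /rt [nth _ tbl u]nth_default ?size_tbl //.
  by rewrite nth_nil /fsum big_nil.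
rewrite (std_mul _ (Ordinal un)); apply/rowP => j; rewrite !mxE /= /fsum summxE.
elim: (rt u a) => [|w l IH]; first by rewrite big_nil.
rewrite big_cons -IH !mxE /= oddD eq_sym; case: (_ == w); last by rewrite ?mulr0n add0r.
case: (odd (count_mem _ _)) => /=; last by rewrite ?mulr0n addr0.
by rewrite -[RHS]natrD [RHS](pcharf0 charK).
Qed.

Lemma eq_std (M N : MX) :
  (forall u, (u < n)%N -> std u *m M = std u *m N) -> M = N.
Proof. by move=> e; apply/row_matrixP => u; rewrite -!std_mul e. Qed.

Lemma std_run l s : fsum std l *m \prod_(a <- s) amx a =
  fsum std (foldl (fun l a => fbind (rt^~ a) l) l s).
Proof.
elim: s l => [|a s IH] l /=; first by rewrite big_nil mulmx1.
rewrite big_cons [_ * _]/(_ *m _) mulmxA -IH; congr (_ *m _).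
rewrite /fsum mulmx_suml big_flatten big_map; apply: eq_bigr => u _.
exact: std_amx.
Qed.

Lemma std_wrun l (w : nat * seq nat) :
  fsum std l *m (vmx w.1 * \prod_(a <- w.2) amx a) = fsum std (wrun l w).
Proof.
rewrite [_ * _]/(_ *m _) mulmxA -std_run; congr (_ *m _).
rewrite /fsum mulmx_suml big_filter [RHS]big_mkcond; apply: eq_bigr => u _.
exact: std_vmx.
Qed.

Lemma vmxM i j : vmx i * vmx j = if i == j then vmx i else 0.
Proof.
apply: eq_std => u _; rewrite [_ * _]/(_ *m _) mulmxA std_vmx.
have [wi|wi] := eqVneq (wend u) i; last first.
  by rewrite mul0mx; case: eqP => _; rewrite ?mulmx0 // std_vmx (negPf wi).
by rewrite std_vmx wi; case: eqP => _; rewrite ?mulmx0 // std_vmx wi eqxx.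
Qed.

Variables (rels : seq (seq (seq nat))).
Variable cert : nat -> nat -> seq (seq nat * nat * seq nat).
Hypothesis t_check : table_check rels cert na.
Hypothesis r_check : rep_check rels.

Lemma size_words : size words = n.
Proof. by case/and3P: t_check => /eqP <-. Qed.

Lemma rt_cases u a : rt u a = [::] \/
  [/\ wend u = src a & all (fun w => wend w == tgt a) (rt u a)].
Proof.
have [out|] := boolP ((size words <= u) || (na <= a))%N.
  by left; apply: rt_out out; exact: t_check.
rewrite negb_or -!ltnNge => /andP[us an].
case/and3P: t_check => _ _ /allP c.
have iu : u \in iota 0 (size words) by rewrite mem_iota.
have ia : a \in iota 0 na by rewrite mem_iota.
have /allP/(_ a ia) := c u iu.
by case: eqP => [we /and3P[_ ? _]|_ /eqP]; [right|left].
Qed.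

Lemma vmx_amx a : vmx (src a) * amx a = amx a.
Proof.
apply: eq_std => u _; rewrite [_ * _]/(_ *m _) mulmxA std_vmx.
case: eqP => // we; rewrite mul0mx std_amx.
by case: (rt_cases u a) => [->|[]] //; rewrite /fsum big_nil.
Qed.

Lemma amx_vmx a : amx a * vmx (tgt a) = amx a.
Proof.
apply: eq_std => u _; rewrite [_ * _]/(_ *m _) mulmxA std_amx.
case: (rt_cases u a) => [->|[_ /allP wt]]; first by rewrite /fsum big_nil mul0mx.
rewrite /fsum mulmx_suml; apply: eq_big_seq => w /wt we.
by rewrite std_vmx we.
Qed.

Lemma mx_rel r : r \in rels -> \sum_(t <- r) \prod_(a <- t) amx a = 0.
Proof.
case/andP: r_check => /allP c _ rin; apply: eq_std => u un.
have iu : u \in iota 0 (size words) by rewrite mem_iota size_words.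
have /allP/(_ r rin) /feqP e := c u iu.
have r2 := char2_addxx (V := 'rV[K]_n) charK.
have {e} := e _ r2 std; rewrite {2}/fsum big_nil mulmx0 mulmx_sumr.
apply: etrans; rewrite /fsum big_flatten big_map.
by apply: eq_bigr => t _; rewrite -/(fsum std _) -std_run /fsum big_seq1.
Qed.

Definition mx_unit_row : 'rV[K]_n := fsum std (iota 0 nv).

Lemma mx_word u : (u < n)%N ->
  mx_unit_row *m (vmx (word u).1 * \prod_(a <- (word u).2) amx a) = std u.
Proof.
case/andP: r_check => _ /allP c un.
have iu : u \in iota 0 (size words) by rewrite mem_iota size_words.
have r2 := char2_addxx (V := 'rV[K]_n) charK.
by rewrite std_wrun (feqP r2 _ (c u iu)) /fsum big_seq1.
Qed.
End Matrices.
End WordTables.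

(** * Tables for the algebra *)

(* The vertex [i + 1] is coded by [i], the arrows alpha, beta, xi, epsilon, gamma,
   delta by [0], ..., [5].  The basis consists of the paths that are irreducible
   for the deglex rewriting system of the relations. *)
Definition words9 : seq (nat * seq nat) := [:: (0, [::]); (1, [::]); (2,
    [::]); (3, [::]); (3, [:: 5]); (2, [:: 4]); (3, [:: 3]); (1, [:: 2]); (3,
    [:: 1]); (0, [:: 0]); (3, [:: 5; 4]); (2, [:: 4; 3]); (2, [:: 4; 1]); (3,
    [:: 3; 2]); (1, [:: 2; 5]); (1, [:: 2; 1]); (0, [:: 0; 5]); (0, [:: 0;
    3]); (0, [:: 0; 1]); (3, [:: 5; 4; 3]); (3, [:: 5; 4; 1]); (2, [:: 4; 3;
    2]); (3, [:: 3; 2; 5]); (1, [:: 2; 5; 4]); (0, [:: 0; 5; 4]); (3, [:: 5;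
    4; 3; 2]); (2, [:: 4; 3; 2; 5]); (1, [:: 2; 5; 4; 3])].

Definition table9 : seq (seq (seq nat)) := [:: [:: [:: 9]; [::]; [::]; [::];
    [::]; [::]]; [:: [::]; [::]; [:: 7]; [::]; [::]; [::]]; [:: [::]; [::];
    [::]; [::]; [:: 5]; [::]]; [:: [::]; [:: 8]; [::]; [:: 6]; [::]; [:: 4]];
    [:: [::]; [::]; [::]; [::]; [:: 10]; [::]]; [:: [::]; [:: 12]; [::]; [::
    11]; [::]; [::]]; [:: [::]; [::]; [:: 13]; [::]; [::]; [::]]; [:: [::];
    [:: 15]; [::]; [::]; [::]; [:: 14]]; [:: [:: 10; 13]; [::]; [::]; [::];
    [::]; [::]]; [:: [::]; [:: 18]; [::]; [:: 17]; [::]; [:: 16]]; [:: [::];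
    [:: 20]; [::]; [:: 19]; [::]; [::]]; [:: [::]; [::]; [:: 21]; [::]; [::];
    [::]]; [:: [:: 21]; [::]; [::]; [::]; [::]; [::]]; [:: [::]; [:: 20];
    [::]; [::]; [::]; [:: 22]]; [:: [::]; [::]; [::]; [::]; [:: 23]; [::]];
    [:: [:: 23]; [::]; [::]; [::]; [::]; [::]]; [:: [::]; [::]; [::]; [::];
    [:: 24]; [::]]; [:: [::]; [::]; [:: 24]; [::]; [::]; [::]]; [:: [::];
    [::]; [::]; [::]; [::]; [::]]; [:: [::]; [::]; [:: 25]; [::]; [::]; [::]];
    [:: [:: 25]; [::]; [::]; [::]; [::]; [::]]; [:: [::]; [::]; [::]; [::];
    [::]; [:: 26]]; [:: [::]; [::]; [::]; [::]; [:: 25]; [::]]; [:: [::];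
    [::]; [::]; [:: 27]; [::]; [::]]; [:: [::]; [:: 18]; [::]; [::]; [::];
    [::]]; [:: [::]; [::]; [::]; [::]; [::]; [::]]; [:: [::]; [::]; [::];
    [::]; [::]; [::]]; [:: [::]; [::]; [::]; [::]; [::]; [::]]].

(** In the order of the constructors of [rel9]; the minus sign of the last one is lost in
    characteristic 2. *)
Definition rels9 : seq (seq (seq nat)) := [:: [:: [:: 1; 0]; [:: 3; 2]; [:: 5;
    4]]; [:: [:: 2; 3]]; [:: [:: 4; 5]]; [:: [:: 0; 1]; [:: 0; 5; 4; 1]]].

(* A triple [(x, r, y)] stands for [x r y] with [r] the [r]-th relation.  The two
   lists derive exb + dgb = 0 and aex + adg = 0, with a, b, x, e, g, d for the
   arrows; [certs9] refers to these as relations 4 and 5. *)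
Definition derived9 : seq (seq (seq nat * nat * seq nat)) := [:: [:: ([::], 0,
    [:: 1]); ([::], 0, [:: 5; 4; 1]); ([:: 3; 2], 0, [:: 1]); ([:: 3], 1, [::
    2; 1]); ([:: 5], 2, [:: 4; 1]); ([:: 1], 3, [::]); ([:: 3; 2], 0, [:: 5;
    4; 1]); ([:: 3], 1, [:: 2; 5; 4; 1]); ([:: 3; 2; 5], 2, [:: 4; 1]); ([::
    3; 2; 1], 3, [::])]; [:: ([:: 0], 0, [::]); ([:: 0], 0, [:: 3; 2]); ([::
    0; 5; 4], 0, [::]); ([:: 0; 3], 1, [:: 2]); ([:: 0; 5], 2, [:: 4]); ([::],
    3, [:: 0]); ([:: 0; 5; 4], 0, [:: 3; 2]); ([:: 0; 5; 4; 3], 1, [:: 2]);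
    ([:: 0; 5], 2, [:: 4; 3; 2]); ([::], 3, [:: 0; 3; 2])]].

(* For a basis path [u] and an arrow [a] such that [u a] is not in the basis, an
   expression of [u a] minus its normal form as a sum of multiples [x r y]. *)
Definition certs9 : seq ((nat * nat) * seq (seq nat * nat * seq nat)) := [::
    ((5, 5), [:: ([::], 2, [::])]); ((7, 3), [:: ([::], 1, [::])]); ((8, 0),
    [:: ([::], 0, [::])]); ((10, 5), [:: ([:: 5], 2, [::])]); ((12, 0), [::
    ([:: 4], 0, [::]); ([::], 2, [:: 4])]); ((13, 1), [:: ([::], 4, [::])]);
    ((13, 3), [:: ([:: 3], 1, [::])]); ((15, 0), [:: ([:: 2], 0, [::]); ([::],
    1, [:: 2])]); ((17, 2), [:: ([::], 5, [::])]); ((18, 0), [:: ([:: 0], 0,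
    [::]); ([::], 5, [::])]); ((20, 0), [:: ([:: 5; 4], 0, [::]); ([:: 5], 2,
    [:: 4])]); ((21, 1), [:: ([:: 4], 4, [::]); ([::], 2, [:: 4; 1])]); ((21,
    3), [:: ([:: 4; 3], 1, [::])]); ((22, 4), [:: ([::], 0, [:: 3; 2]); ([::],
    0, [:: 5; 4]); ([:: 5], 2, [:: 4]); ([:: 3], 1, [:: 2]); ([:: 1], 5,
    [::])]); ((23, 1), [:: ([:: 2], 4, [::]); ([::], 1, [:: 2; 1])]); ((23,
    5), [:: ([:: 2; 5], 2, [::])]); ((24, 1), [:: ([::], 3, [::])]); ((24, 5),
    [:: ([:: 0; 5], 2, [::])]); ((24, 3), [:: ([::], 5, [:: 3]); ([:: 0; 3],
    1, [::])]); ((25, 1), [:: ([:: 5; 4], 4, [::]); ([:: 5], 2, [:: 4; 1])]);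
    ((25, 5), [:: ([::], 0, [:: 3; 2; 5]); ([:: 3], 1, [:: 2; 5]); ([:: 1], 5,
    [:: 5]); ([:: 1; 0; 5], 2, [::])]); ((25, 3), [:: ([:: 5; 4; 3], 1,
    [::])]); ((26, 4), [:: ([:: 4; 3; 2], 0, [::]); ([:: 4; 3], 1, [:: 2]);
    ([:: 4], 4, [:: 0]); ([::], 2, [:: 4; 1; 0])]); ((27, 2), [:: ([:: 2; 5;
    4], 0, [::]); ([:: 2; 5], 2, [:: 4]); ([:: 2], 4, [:: 0]); ([::], 1, [::
    2; 1; 0])])].

Definition src9 (a : nat) : nat := nth 4 [:: 0; 3; 1; 3; 2; 3]%N a.
Definition tgt9 (a : nat) : nat := nth 4 [:: 3; 0; 3; 1; 3; 2]%N a.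

Definition lookup (T : eqType) (U : Type) (l : seq (T * seq U)) (t : T) : seq U :=
  flatten [seq x.2 | x <- l & x.1 == t].

Definition base_cert (c : seq nat * nat * seq nat) :=
  if (c.1.2 < 4)%N then [:: c]
  else [seq (c.1.1 ++ d.1.1, d.1.2, d.2 ++ c.2) | d <- nth [::] derived9 (c.1.2 - 4)].
Definition cert9 u a := fbind base_cert (lookup certs9 (u, a)).

Lemma table9_check : table_check 4 src9 tgt9 words9 table9 rels9 cert9 6.
Proof. by vm_compute. Qed.

Lemma rep9_check : rep_check 4 tgt9 words9 table9 rels9.
Proof. by vm_compute. Qed.

(** * A basis of the algebra *)

Lemma pi_aquot_algM (K : comNzRingType) (A : algType K) (I : ideal A) (x y : A) :
  aquot_pi I (x * y) = aquot_pi I x * aquot_pi I y.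
Proof. exact: pi_aquotM. Qed.

Definition vertices9 : seq vertex9 := [:: v1; v2; v3; v4].
Definition arrows9 : seq arrow9 := [:: alpha; beta; xi; epsilon; gamma; delta].
Definition vcode9 (v : vertex9) : nat :=
  match v with v1 => 0 | v2 => 1 | v3 => 2 | v4 => 3 end.
Definition acode9 (a : arrow9) : nat :=
  match a with
  | alpha => 0 | beta => 1 | xi => 2 | epsilon => 3 | gamma => 4 | delta => 5
  end.

Lemma vertices9_uniq : uniq vertices9.
Proof. exact: (@map_uniq _ _ vcode9). Qed.

Lemma target9E a : target9 a = nth v1 vertices9 (tgt9 (acode9 a)).
Proof. by case: a. Qed.
Lemma source9E a : source9 a = nth v1 vertices9 (src9 (acode9 a)).
Proof. by case: a. Qed.
Lemma nth_acode9 i : (i < 6)%N -> acode9 (nth alpha arrows9 i) = i.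
Proof. by move: i; do 6![case=> //]. Qed.
Lemma vcode9K v : nth v1 vertices9 (vcode9 v) = v.
Proof. by case: v. Qed.
Lemma tgt9_lt a : (a < 6)%N -> (tgt9 a < 4)%N.
Proof. by move: a; do 6![case=> //]. Qed.
Lemma src9_lt a : (a < 6)%N -> (src9 a < 4)%N.
Proof. by move: a; do 6![case=> //]. Qed.
Lemma vcode9_source a : vcode9 (source9 a) = src9 (acode9 a).
Proof. by case: a. Qed.
Lemma vcode9_target a : vcode9 (target9 a) = tgt9 (acode9 a).
Proof. by case: a. Qed.
Lemma vcode9_inj : injective vcode9.
Proof. exact: can_inj vcode9K. Qed.

Lemma rels9P (K : fieldType) (B : algType K) (X : nat -> B) :
  (forall l, l \in rels9 -> vanish X l) <->
  [/\ X 1%N * X 0%N + X 3%N * X 2%N + X 5%N * X 4%N = 0, X 2%N * X 3%N = 0,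
    X 4%N * X 5%N = 0 & X 0%N * X 1%N + X 0%N * X 5%N * X 4%N * X 1%N = 0].
Proof.
have e : [/\ X 1%N * X 0%N + X 3%N * X 2%N + X 5%N * X 4%N = 0, X 2%N * X 3%N = 0,
    X 4%N * X 5%N = 0 & X 0%N * X 1%N + X 0%N * X 5%N * X 4%N * X 1%N = 0] <->
  [/\ vanish X (nth [::] rels9 0), vanish X (nth [::] rels9 1),
    vanish X (nth [::] rels9 2) & vanish X (nth [::] rels9 3)].
  by rewrite /vanish /= !(big_cons, big_nil) !mulr1 !addr0 !mulrA !addrA.
rewrite e; split=> [h|[h0 h1 h2 h3] l]; first by split; apply/h/mem_nth.
by rewrite /rels9 !inE => /or4P[] /eqP ->.
Qed.

Section RelationMorphism.
Variables (K : comNzRingType) (A B : algType K) (f : {linear A -> B}).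
Hypothesis fM : {morph f : x y / x * y}.

Lemma mesh_morph b a e x d g :
  f b * f a + f e * f x + f d * f g = f (b * a + e * x + d * g).
Proof. by rewrite !linearD !fM. Qed.

Lemma alpha_beta_morph a b d g : (forall x : B, x + x = 0) ->
  f a * f b + f a * f d * f g * f b = f (a * b - a * d * g * b).
Proof.
move=> B2; have oppE (x : B) : - x = x by apply/eqP; rewrite eq_sym -addr_eq0 B2.
by rewrite linearB oppE !fM.
Qed.
Lemma ideal_gen_morph (rel : A -> Prop) : (forall r, rel r -> f r = 0) ->
  forall x, ideal_gen rel x -> f x = 0.
Proof.
move=> f0 x; elim=> [|a r b y rr _ IH]; first exact: linear0.
by rewrite linearD IH addr0 !fM (f0 r rr) mulr0 mul0r.
Qed.
End RelationMorphism.

Section Lambda9.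
Variables (K : fieldType) (charK : 2%N \in [pchar K]).
Local Notation KQ := (path_algebra K quiver9).
Local Notation A := (Lambda9 K).
Local Notation I9 := (gen_ideal (@bound_quiver_proper K (bound_quiver9 K))).
Local Notation "[ a ]" := (arrow_elt K (a : arrow quiver9)).

Definition pi9 : {linear KQ -> A} := aquot_pi I9.

Lemma pi9M x y : pi9 (x * y) = pi9 x * pi9 y.
Proof. exact: pi_aquot_algM. Qed.

Lemma pi9_rel r : rel9 r -> pi9 r = 0.
Proof.
move=> rr; rewrite -(linear0 pi9); apply/(aquotP I9); rewrite subr0.
by have := ideal_genS 1 1 rr (ideal_gen0 _); rewrite mul1r mulr1 addr0.
Qed.

Definition vert9 (i : nat) : A :=
  if (i < 4)%N
  then pi9 (path_elt K (@trivial_path quiver9 (nth v1 vertices9 i))) else 0.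
Definition arr9 (a : nat) : A :=
  if (a < 6)%N then pi9 [nth alpha arrows9 a] else 0.

Lemma vert9M i j : vert9 i * vert9 j = if i == j then vert9 i else 0.
Proof.
rewrite /vert9; case: ltnP => i4; last by rewrite mul0r if_same.
case: ltnP => j4.
  rewrite -pi9M trivialM nth_uniq ?vertices9_uniq //.
  by case: eqP; rewrite ?linear0.
by rewrite mulr0; case: eqP => // ij; move: i4; rewrite ij ltnNge j4.
Qed.

Lemma vert9_arr9 i a : vert9 i * arr9 a = if src9 a == i then arr9 a else 0.
Proof.
rewrite /vert9 /arr9; case: (ltnP a 6) => a6; last by rewrite mulr0 if_same.
case: ltnP => i4.
  rewrite -pi9M trivial_arrowM /= source9E nth_acode9 //.
  rewrite (nth_uniq _ _ _ vertices9_uniq) ?src9_lt //.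
  by case: eqP; rewrite ?linear0.
rewrite mul0r; case: eqP => // ij.
by move: (src9_lt a6); rewrite ij ltnNge i4.
Qed.

Lemma arr9_vert9 i a : arr9 a * vert9 i = if tgt9 a == i then arr9 a else 0.
Proof.
rewrite /vert9 /arr9; case: (ltnP a 6) => a6; last by rewrite mul0r if_same.
case: ltnP => i4.
  rewrite -pi9M arrow_trivialM /= target9E nth_acode9 //.
  rewrite (nth_uniq _ _ _ vertices9_uniq) ?tgt9_lt //.
  by case: eqP; rewrite ?linear0.
rewrite mulr0; case: eqP => // ij.
by move: (tgt9_lt a6); rewrite ij ltnNge i4.
Qed.

Lemma rels9_vanish l : l \in rels9 -> vanish arr9 l.
Proof.
have A2 (x : A) : x + x = 0 := char2_addxx charK x.
have arrE (a : arrow9) : arr9 (acode9 a) = pi9 [a] by case: a.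
move: l; apply/rels9P; split.
- rewrite (arrE beta) (arrE alpha) (arrE epsilon) (arrE xi) (arrE delta) (arrE gamma).
  exact: etrans (mesh_morph pi9M _ _ _ _ _ _) (pi9_rel (rel9_mesh K)).
- rewrite (arrE xi) (arrE epsilon).
  exact: etrans (esym (pi9M _ _)) (pi9_rel (rel9_xi_epsilon K)).
- rewrite (arrE gamma) (arrE delta).
  exact: etrans (esym (pi9M _ _)) (pi9_rel (rel9_gamma_delta K)).
rewrite (arrE beta) (arrE alpha) (arrE delta) (arrE gamma).
exact: etrans (alpha_beta_morph pi9M _ _ _ _ A2) (pi9_rel (rel9_alpha_beta K)).
Qed.

Lemma sum_vert9 : \sum_(0 <= i < 4) vert9 i = 1.
Proof.
have -> : 1 = pi9 1 by [].
rewrite -[1 : KQ]/(catone K (path_cat quiver9)) /catone /= /trivial_paths big_map.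
rewrite linear_sum (perm_big vertices9); last first.
  apply: uniq_perm; [exact: enum_uniq | exact: vertices9_uniq |].
  by move=> v; rewrite mem_enum /vertices9 !inE -!(inj_eq vcode9_inj); case: v.
by rewrite /vertices9 !big_cons !big_nil.
Qed.
End Lambda9.

Section RegularFrame.
Variables (K : fieldType) (A : algType K) (m : nat) (b : nat -> A).
Local Notation n := m.+1.
Local Notation std := (std_row K n).

Lemma eq_rV (V : lmodType K) (f g : {linear 'rV[K]_n -> V}) :
  (forall u, (u < n)%N -> f (std u) = g (std u)) -> f =1 g.
Proof.
move=> fg y; have -> : y = \sum_j y ord0 j *: std j.
  rewrite [LHS]row_sum_delta; apply: eq_bigr => j _; congr (_ *: _).
  by apply/rowP => k; rewrite !mxE eqxx val_eqE.
by rewrite !linear_sum; apply: eq_bigr => j _; rewrite !linearZ fg.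
Qed.

Definition row_comb (y : 'rV[K]_n) : A := \sum_j y ord0 j *: b j.
Fact row_comb_linear : linear row_comb.
Proof.
move=> k x y; rewrite /row_comb scaler_sumr -big_split; apply: eq_bigr => j _.
by rewrite !mxE scalerDl scalerA.
Qed.
HB.instance Definition _ :=
  GRing.isLinear.Build K 'rV[K]_n A *:%R row_comb row_comb_linear.

Hypothesis b_out : forall u, (n <= u)%N -> b u = 0.

Lemma row_comb_std u : row_comb (std u) = b u.
Proof.
have [nu|un] := leqP n u; first by rewrite std_out // linear0 b_out.
rewrite /row_comb (bigD1 (Ordinal un)) //= mxE eqxx scale1r big1 ?addr0 // => j.
by rewrite mxE -val_eqE /= => /negPf ->; rewrite scale0r.
Qed.

Variables (rho : {linear A -> 'M[K]_n}) (one : 'rV[K]_n).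
Hypothesis rhoE : forall a y, row_comb (y *m rho a) = row_comb y * a.
Hypothesis oneE : row_comb one = 1.
Hypothesis rho_b : forall u, (u < n)%N -> one *m rho (b u) = std u.

(** The row one rho(a) gives both halves of the basis property: [row_comb] carries it to 1 a = a,
    and for a = b_u it is the u-th unit row. *)
Definition reg_coord u (a : A) : K := (one *m rho a) ord0 (inord u).

Fact reg_coord_linear u k (x y : A) :
  reg_coord u (k *: x + y) = k * reg_coord u x + reg_coord u y.
Proof. by rewrite /reg_coord linearP mulmxDr -scalemxAr !mxE. Qed.

Fact reg_frameE (x : A) : x = \sum_(u <- iota 0 n) reg_coord u x *: b u.
Proof.
rewrite -[LHS]mul1r -oneE -rhoE -[n in iota 0 n]subn0 -/(index_iota 0 n) big_mkord.
by apply: eq_bigr => j _; rewrite /reg_coord inord_val.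
Qed.

Fact reg_coordE s t : s \in iota 0 n -> t \in iota 0 n ->
  reg_coord s (b t) = (s == t)%:R.
Proof.
by rewrite !mem_iota => /= ? ?; rewrite /reg_coord rho_b // mxE inordK.
Qed.

Definition reg_frame : frame A nat :=
  Frame reg_coord_linear reg_frameE (iota_uniq 0 n) reg_coordE.
End RegularFrame.

Section Lambda9Frame.
Variables (K : fieldType) (charK : 2%N \in [pchar K]).
Local Notation KQ := (path_algebra K quiver9).
Local Notation A := (Lambda9 K).
Local Notation I9 := (gen_ideal (@bound_quiver_proper K (bound_quiver9 K))).
Local Notation "[ a ]" := (arrow_elt K (a : arrow quiver9)).
Local Notation MX := 'M[K]_27.+1.
Local Notation vmx9 := (vmx 4 tgt9 words9 K 27).
Local Notation amx9 := (amx table9 K 27).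

Definition b9 : nat -> A := wvec 4 words9 (vert9 K) (arr9 K).

Let vertM := @vert9M K.
Let EX := @vert9_arr9 K.
Let XE := @arr9_vert9 K.

Lemma size_table9 : size table9 = 28.
Proof. by []. Qed.

Lemma vert9_out : vert9 K 4 = 0.
Proof. by []. Qed.

Lemma arr9_out a : (6 <= a)%N -> arr9 K a = 0.
Proof. by move=> a6; rewrite /arr9 ifF // ltnNge a6. Qed.

Lemma b9_out u : (28 <= u)%N -> b9 u = 0.
Proof. by move=> u28; apply: wvec_out => //; exact: vert9_out. Qed.

Lemma b9M u v : b9 u * b9 v = fsum b9 (wmul 4 tgt9 words9 table9 u v).
Proof.
exact: (wvecM charK vertM EX XE vert9_out arr9_out (rels9_vanish charK)
  table9_check).
Qed.

Lemma b9_vert u i : b9 u * vert9 K i = if wend 4 tgt9 words9 u == i then b9 u else 0.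
Proof. exact: (wvecE 4 words9 vertM XE u i). Qed.

Lemma b9_arr u a : b9 u * arr9 K a = fsum b9 (rt table9 u a).
Proof.
exact: (wvecX charK vertM EX XE vert9_out arr9_out (rels9_vanish charK)
  table9_check).
Qed.

Section Representation.
Let E9 (v : vertex9) : MX := vmx9 (vcode9 v).
Let X9 (a : arrow9) : MX := amx9 (acode9 a).

Let E9M v w : E9 v * E9 w = if v == w then E9 v else 0.
Proof. by rewrite /E9 vmxM (inj_eq vcode9_inj). Qed.
Let E9X a : E9 (source9 a) * X9 a = X9 a.
Proof. by rewrite /E9 vcode9_source (vmx_amx charK _ table9_check). Qed.
Let X9E a : X9 a * E9 (target9 a) = X9 a.
Proof. by rewrite /E9 vcode9_target (amx_vmx charK _ table9_check). Qed.

Definition path_rep9 : {linear KQ -> MX} := path_morph (Q := quiver9) E9 X9.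

Lemma path_rep9M : {morph path_rep9 : x y / x * y}.
Proof. exact: (path_morphM (Q := quiver9) E9M X9E). Qed.

Lemma path_rep9_word p : path_rep9 (path_elt K p) =
  word_val (Q := quiver9) E9 X9 (val p).1 (val p).2.
Proof. exact: path_morph_path. Qed.

Lemma path_rep9_arrow (a : arrow9) : path_rep9 [a] = amx9 (acode9 a).
Proof. by rewrite [LHS]path_morph_path /word_val /= big_seq1 E9X. Qed.

Lemma path_rep9_vert (v : vertex9) :
  path_rep9 (path_elt K (@trivial_path quiver9 v)) = vmx9 (vcode9 v).
Proof. by rewrite [LHS]path_morph_path /word_val /= big_nil mulr1. Qed.
End Representation.

Lemma path_rep9_rel r : rel9 r -> path_rep9 r = 0.
Proof.
have MX2 (x : MX) : x + x = 0 := char2_addxx charK x.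
have [h0 h1 h2 h3] := (rels9P amx9).1
  (fun l => mx_rel charK (m := 27) size_table9 table9_check rep9_check (r := l)).
pose X (a : arrow9) : MX := path_rep9 [a].
have XE' : X = fun a => amx9 (acode9 a) by apply: funext => a; exact: path_rep9_arrow.
have k0 : X beta * X alpha + X epsilon * X xi + X delta * X gamma = 0.
  by rewrite XE'; exact: h0.
have k1 : X xi * X epsilon = 0 by rewrite XE'; exact: h1.
have k2 : X gamma * X delta = 0 by rewrite XE'; exact: h2.
have k3 : X alpha * X beta + X alpha * X delta * X gamma * X beta = 0.
  by rewrite XE'; exact: h3.
case.
- exact: etrans (esym (mesh_morph path_rep9M _ _ _ _ _ _)) k0.
- exact: etrans (path_rep9M _ _) k1.
- exact: etrans (path_rep9M _ _) k2.
exact: etrans (esym (alpha_beta_morph path_rep9M _ _ _ _ MX2)) k3.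
Qed.

Lemma path_rep9_ideal x : ideal_gen (@rel9 K) x -> path_rep9 x = 0.
Proof. exact: (ideal_gen_morph path_rep9M path_rep9_rel). Qed.

Definition rho9 : {linear A -> MX} := aquot_lift (I := I9) path_rep9_ideal.

Lemma rho9_pi x : rho9 (pi9 K x) = path_rep9 x.
Proof. exact: (aquot_liftE (I := I9) path_rep9_ideal). Qed.

Local Notation row_comb9 := (row_comb (m := 27) b9).

(** The same table describes the matrices and, by the certificates, right multiplication in A; so
    [row_comb9] intertwines them on vertices and arrows, hence on words. *)
Lemma row_comb9_word y (v : vertex9) (s : seq arrow9) :
  row_comb9 (y *m (vmx9 (vcode9 v) * \prod_(a <- s) amx9 (acode9 a))) =
  row_comb9 y * (vert9 K (vcode9 v) * \prod_(a <- s) arr9 K (acode9 a)).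
Proof.
have colE i z : row_comb9 (z *m vmx9 i) = row_comb9 z * vert9 K i.
  pose f : {linear 'rV[K]_28 -> A} := row_comb9 \o mulmxr (vmx9 i).
  pose g : {linear 'rV[K]_28 -> A} := rmul (vert9 K i) \o row_comb9.
  apply: (eq_rV (f := f) (g := g)) => u _.
  rewrite /f /g /= std_vmx /rmul (row_comb_std b9_out) b9_vert.
  by case: ifP => _; rewrite ?linear0 // (row_comb_std b9_out).
have colX a z : row_comb9 (z *m amx9 a) = row_comb9 z * arr9 K a.
  pose f : {linear 'rV[K]_28 -> A} := row_comb9 \o mulmxr (amx9 a).
  pose g : {linear 'rV[K]_28 -> A} := rmul (arr9 K a) \o row_comb9.
  apply: (eq_rV (f := f) (g := g)) => u _.
  rewrite /f /g /= (std_amx charK size_table9) /rmul (row_comb_std b9_out) b9_arr.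
  by rewrite linear_sum; apply: eq_bigr => w _; exact: (row_comb_std b9_out).
rewrite [_ * _ in LHS]/(_ *m _) mulmxA mulrA -colE.
elim: s (y *m _) => [|a s IH] z; first by rewrite !big_nil mulmx1 mulr1.
by rewrite !big_cons [_ * _ in LHS]/(_ *m _) mulmxA IH colX mulrA.
Qed.

Lemma pi9_path (p : qpath quiver9) : pi9 K (path_elt K p) =
  vert9 K (vcode9 (val p).1) * \prod_(a <- (val p).2) arr9 K (acode9 a).
Proof.
rewrite path_eltE /word_val pi9M; congr (_ * _).
  by case: (val p).1.
elim: (val p).2 => [|a s IH]; first by rewrite !big_nil.
rewrite !big_cons pi9M IH; congr (_ * _).
by case: a.
Qed.

Lemma rho9E a y : row_comb9 (y *m rho9 a) = row_comb9 y * a.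
Proof.
pose f : {linear A -> A} := row_comb9 \o (mulmx y \o rho9).
pose g : {linear A -> A} := lmul (row_comb9 y).
suff h p : f (pi9 K (path_elt K p)) = g (pi9 K (path_elt K p)).
  apply: (eq_aquot (f := f) (g := g)) => x.
  exact: (eq_catalg (f := f \o pi9 K) (g := g \o pi9 K) h).
rewrite -[LHS]/(row_comb9 (y *m rho9 (pi9 K (path_elt K p)))).
rewrite -[RHS]/(row_comb9 y * pi9 K (path_elt K p)) [X in _ = _ * X]pi9_path.
by rewrite (etrans (rho9_pi _) (path_rep9_word p)); exact: row_comb9_word.
Qed.

Lemma rho9M x y : rho9 (x * y) = rho9 x * rho9 y.
Proof.
have [x' ->] := pi_aquot_surj x; have [y' ->] := pi_aquot_surj y.
rewrite -[\pi x']/(pi9 K x') -[\pi y']/(pi9 K y') -pi9M !rho9_pi.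
exact: path_rep9M.
Qed.

Lemma rho9_vert i : (i < 4)%N -> rho9 (vert9 K i) = vmx9 i.
Proof.
move=> i4; rewrite /vert9 i4 rho9_pi path_rep9_vert; congr (vmx _ _ _ _ _ _).
by move: i i4; do 4![case=> //].
Qed.

Lemma rho9_arr a : (a < 6)%N -> rho9 (arr9 K a) = amx9 a.
Proof. by move=> a6; rewrite /arr9 a6 rho9_pi path_rep9_arrow nth_acode9. Qed.

Lemma rho9_b9 u : (u < 28)%N -> mx_unit_row 4 K 27 *m rho9 (b9 u) = std_row K 28 u.
Proof.
move=> u28; rewrite -(mx_word charK (m := 27) size_table9 table9_check rep9_check u28).
congr (_ *m _).
have /allP : all (fun w => (w.1 < 4)%N && all (fun a => a < 6)%N w.2) words9 by [].
move=> /(_ _ (mem_nth (4, [::]) (u28 : (u < size words9)%N)))/andP[].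
rewrite /b9 /wvec -/(word 4 words9 u); case: (word _ _ u) => i s /= /rho9_vert <-.
elim: s (vert9 K i) => [|a s IH] z; first by rewrite !big_nil !mulr1.
by rewrite /= => /andP[a6 s6]; rewrite !big_cons !mulrA IH // rho9M rho9_arr.
Qed.

Lemma row_comb9_one : row_comb9 (mx_unit_row 4 K 27) = 1.
Proof.
rewrite -(sum_vert9 K) /mx_unit_row /fsum linear_sum /index_iota subn0.
apply: eq_big_seq => i; rewrite mem_iota => /= i4.
have -> : row_comb9 (std_row K 28 i) = b9 i by exact: row_comb_std b9_out i.
have wi : word 4 words9 i = (i, [::]) by move: i i4; do 4![case=> [//|]].
by rewrite /b9 /wvec wi big_nil mulr1.
Qed.

Definition frame9 : frame A nat := reg_frame rho9E row_comb9_one rho9_b9.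
End Lambda9Frame.

(** * A basis of the enveloping algebra *)

Section TensorFrame.
Variables (K : fieldType) (A : algType K) (T : eqType) (bA : frame A T).
Local Notation b := (fvec bA).

Variables (R : algType K) (tau : A -> A -> R) (tcoord : T * T -> {linear R -> K^o}).
Hypothesis tau_suml : forall (r : seq T) (c : T -> K) y,
  tau (\sum_(t <- r) c t *: b t) y = \sum_(t <- r) c t *: tau (b t) y.
Hypothesis tau_sumr : forall (r : seq T) (c : T -> K) x,
  tau x (\sum_(t <- r) c t *: b t) = \sum_(t <- r) c t *: tau x (b t).
Hypothesis eq_tau : forall f g : {linear R -> R},
  (forall x y, f (tau x y) = g (tau x y)) -> f =1 g.
Hypothesis tcoord_tau : forall uv x y,
  tcoord uv (tau x y) = fcoord bA uv.2 x * fcoord bA uv.1 y.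

(* The code [(u, v)] stands for the two-sided multiplication [x |-> b_u x b_v]. *)
Definition tensor_vec (uv : T * T) : R := tau (b uv.2) (b uv.1).

Definition tensor_idx : seq (T * T) := [seq (u, v) | u <- fidx bA, v <- fidx bA].

Fact tcoord_linear uv k x y : tcoord uv (k *: x + y) = k * tcoord uv x + tcoord uv y.
Proof. exact: linearP. Qed.

Definition tensor_expand (x : R) : R :=
  \sum_(uv <- tensor_idx) tcoord uv x *: tensor_vec uv.
Fact tensor_expand_linear : linear tensor_expand.
Proof.
move=> k x y; rewrite /tensor_expand scaler_sumr -big_split; apply: eq_bigr => uv _.
by rewrite /= tcoord_linear scalerDl scalerA.
Qed.
HB.instance Definition _ :=
  GRing.isLinear.Build K R R *:%R tensor_expand tensor_expand_linear.

Fact tensor_frameE x : x = \sum_(uv <- tensor_idx) tcoord uv x *: tensor_vec uv.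
Proof.
apply: (eq_tau (f := idfun) (g := tensor_expand)) => {}x y /=.
rewrite /tensor_expand big_allpairs_dep /= {1}(frameE bA y) tau_sumr.
apply: eq_bigr => u _; rewrite {1}(frameE bA x) tau_suml scaler_sumr.
by apply: eq_bigr => v _; rewrite tcoord_tau scalerA mulrC.
Qed.

Fact tensor_idx_uniq : uniq tensor_idx.
Proof. by rewrite allpairs_uniq ?fidx_uniq // => -[? ?] [? ?]. Qed.

Fact tcoordE s t : s \in tensor_idx -> t \in tensor_idx ->
  tcoord s (tensor_vec t) = (s == t)%:R.
Proof.
move=> /allpairsP[[u v] [/= uB vB ->]] /allpairsP[[u' v'] [/= uB' vB' ->]].
by rewrite tcoord_tau !fcoordE //= -natrM mulnb xpair_eqE andbC.
Qed.

Definition tensor_frame : frame R (T * T)%type :=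
  Frame tcoord_linear tensor_frameE tensor_idx_uniq tcoordE.

End TensorFrame.

Section EnvFrame.
Variables (K : fieldType) (A : algType K) (T : eqType) (bA : frame A T).
Variable mulA : T -> T -> seq T.
Hypothesis mulAE : forall s t, fvec bA s * fvec bA t = fsum (fvec bA) (mulA s t).
Local Notation b := (fvec bA).

Let F (uv : T * T) (x y : A) : K^o := fcoord bA uv.2 x * fcoord bA uv.1 y.

Fact F_linearl uv y : linear (F uv ^~ y).
Proof. by move=> k x x'; rewrite /F fcoord_linear mulrDl -mulrA. Qed.
Fact F_linearr uv x : linear (F uv x).
Proof. by move=> k y y'; rewrite /F fcoord_linear mulrDr mulrCA. Qed.

Definition env_coord (uv : T * T) : {linear env A -> K^o} :=
  env_lift (@F_linearl uv) (@F_linearr uv).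

Lemma env_coord_tensor uv x y :
  env_coord uv (tensor x y) = fcoord bA uv.2 x * fcoord bA uv.1 y.
Proof. exact: (env_liftE (@F_linearl uv) (@F_linearr uv)). Qed.

Definition env_frame : frame (env A) (T * T)%type :=
  @tensor_frame K A T bA (env A) (@tensor K A) env_coord
    (fun r c y => tensor_suml r c b y) (fun r c x => tensor_sumr r c b x)
    (@eq_env K A (env A)) env_coord_tensor.

Definition tensor_mul (s t : T * T) : seq (T * T) :=
  [seq (p, q) | p <- mulA s.1 t.1, q <- mulA t.2 s.2].

Lemma tensor_fsum l l' : tensor (fsum b l) (fsum b l') =
  fsum (fvec env_frame) [seq (p, q) | p <- l', q <- l].
Proof.
have e k : fsum b k = \sum_(t <- k) (1 : K) *: b t.
  by apply: eq_bigr => t _; rewrite scale1r.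
rewrite !e tensor_sumr /fsum big_allpairs_dep; apply: eq_bigr => p _.
by rewrite tensor_suml scale1r; apply: eq_bigr => q _; rewrite scale1r.
Qed.

Lemma env_mulE s t : fvec env_frame s * fvec env_frame t =
  fsum (fvec env_frame) (tensor_mul s t).
Proof. by rewrite [LHS]tensorM !mulAE tensor_fsum. Qed.

Local Notation resA := (restrict_scalars (K := K) (bimod A)).

(** Restriction of scalars lets k act through k 1 in the enveloping algebra. The agreement with
    scaling in A allows the basis of A to serve for the bimodule. *)
Lemma res_bimod_scale k (x : A) : k *: (x : resA) = k *: x :> A.
Proof.
pose I := gen_ideal (@env_proper K A).
have e : bimod_scale (\pi_(env A) (k *: 1)) x = k *: x.
  by rewrite bimod_scale_pi linearZ /= act1.
exact: etrans (congr1 (fun t => bimod_scale t x) (esym (pi_aquotZ I k 1))) e.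
Qed.

Fact bimod_coord_linear t k (x y : resA) :
  fcoord bA t (k *: x + y : resA) = k * fcoord bA t x + fcoord bA t y.
Proof.
have -> : (k *: x + y : resA) = k *: (x : A) + y.
  exact: (congr1 (fun z : A => z + y) (res_bimod_scale k x)).
exact: fcoord_linear.
Qed.

Fact bimod_frameE (x : resA) : x = \sum_(t <- fidx bA) fcoord bA t x *: (b t : resA).
Proof.
rewrite {1}(frameE bA x : x = _ :> A); apply: eq_bigr => t _.
exact: esym (res_bimod_scale _ _).
Qed.

Definition bimod_frame : frame resA T :=
  Frame bimod_coord_linear bimod_frameE (fidx_uniq bA) (@fcoordE _ _ _ bA).

Definition bimod_act (uv : T * T) (w : T) : seq T :=
  fbind (mulA^~ uv.2) (mulA uv.1 w).

Lemma bimod_actE : act_rule env_frame bimod_frame bimod_act.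
Proof.
move=> [u v] w; rewrite [LHS]tensor_scale mulAE.
exact: (raddf_fsum (f := rmul (b v)) (fun t _ => mulAE t v)).
Qed.
End EnvFrame.

(** * The bimodule resolution *)

(* Minimal generators of the kernel of P_2 -> P_1, one for each vertex.  A code
   [(j, (u, v))] stands for [b_u (x) b_v] in the [j]-th summand of P_n. *)
Definition d3_table9 : seq (seq (nat * (nat * nat))) := [:: [:: (0, (9, 20)); (0,
    (24, 8)); (1, (17, 15)); (2, (16, 12)); (3, (0, 18)); (3, (18, 0))]; [::
    (0, (7, 19)); (0, (23, 6)); (1, (1, 27)); (1, (27, 1)); (2, (14, 11)); (3,
    (15, 17))]; [:: (0, (5, 22)); (0, (21, 4)); (0, (21, 22)); (1, (11, 14));
    (2, (2, 26)); (2, (26, 2)); (3, (12, 16))]; [:: (0, (3, 25)); (0, (10,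
    13)); (0, (13, 10)); (0, (13, 25)); (0, (25, 3)); (0, (25, 13)); (1, (6,
    23)); (1, (19, 7)); (2, (4, 21)); (2, (22, 5)); (3, (8, 24)); (3, (20,
    9))]].

(* The nonzero values on [b_u (x) e] of the contracting homotopy P_2 -> P_3. *)
Definition s2_table9 : seq ((nat * nat) * seq (nat * (nat * nat))) := [:: ((0, 13),
    [:: (3, (3, 3))]); ((0, 25), [:: (3, (3, 3))]); ((1, 27), [:: (1, (1,
    1))]); ((2, 26), [:: (0, (12, 16)); (2, (2, 2))]); ((3, 12), [:: (0, (12,
    0))]); ((3, 18), [:: (0, (0, 0))]); ((3, 20), [:: (0, (8, 0))])].

(* A splitting of the complex Hom(P_n, A): [up]n is a partial inverse of the n-th
   coboundary map, [class]n gives the coordinates of the cohomology class and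
   [cocycle]n cocycles that represent a basis of HH^n. *)
Definition up0_9 : seq (nat * nat * seq (nat * nat)) := [:: ((1, 8), [:: (0,
    0)]); ((3, 6), [:: (1, 1)]); ((3, 19), [:: (3, 10)]); ((5, 4), [:: (2,
    2)]); ((5, 22), [:: (3, 13)])].

Definition class0_9 : seq (nat * nat * seq nat) := [:: ((0, 18), [:: 0]); ((1,
    27), [:: 1]); ((2, 26), [:: 2]); ((3, 3), [:: 4]); ((3, 25), [:: 3])].

(** The centre: at each vertex the closed basis path that every arrow kills on the right, and the
    unit as the sum of the vertices. *)
Definition cocycle0_9 : seq (seq (nat * nat)) := [:: [:: (0, 18)]; [:: (1,
    27)]; [:: (2, 26)]; [:: (3, 25)]; [:: (0, 0); (1, 1); (2, 2); (3, 3)]].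

Definition up1_9 : seq (nat * nat * seq (nat * nat)) := [:: ((0, 10), [:: (0,
    9); (2, 7)]); ((0, 13), [:: (2, 7)]); ((0, 25), [:: (0, 9); (0, 24); (2,
    7); (4, 5)]); ((1, 27), [:: (0, 9); (0, 24); (2, 7); (2, 23); (4, 5)]);
    ((2, 26), [:: (0, 9); (0, 24); (2, 7); (4, 5); (4, 21)]); ((3, 18), [::
    (0, 9); (2, 7); (4, 5)])].

Definition class1_9 : seq (nat * nat * seq nat) := [:: ((1, 20), [:: 0]); ((3,
    19), [:: 0]); ((5, 22), [:: 0])].

(** The outer derivation sends alpha to alpha delta gamma, beta to delta gamma beta and the other
    arrows to 0. *)
Definition cocycle1_9 : seq (seq (nat * nat)) := [:: [:: (0, 24); (1, 20)]].

Definition up2_9 : seq (nat * nat * seq (nat * nat)) := [:: ((1, 27), [:: (2,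
    2)]); ((2, 26), [:: (1, 1)])].

Definition class2_9 : seq (nat * nat * seq nat) := [:: ((0, 3), [:: 0]); ((3,
    0), [:: 1])].

(** Both classes send relations to idempotents: the first sends the mesh relation to the vertex 4,
    the second sends each of the other three relations to the vertex at which it is based. *)
Definition cocycle2_9 : seq (seq (nat * nat)) := [:: [:: (0, 3)]; [:: (1, 1);
    (2, 2); (3, 0)]].

Definition mul9 := wmul 4 tgt9 words9 table9.
Definition run9 := wrun 4 tgt9 words9 table9.
Definition idx9 : seq nat := iota 0 28.
Definition env_idx9 : seq (nat * nat) := [seq (u, v) | u <- idx9, v <- idx9].
Definition env_mul9 := tensor_mul mul9.
Definition act9 := bimod_act mul9.

Definition ends0_9 : seq (nat * nat) := [seq (i, i) | i <- iota 0 4].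
Definition ends1_9 : seq (nat * nat) := [seq (src9 a, tgt9 a) | a <- iota 0 6].
(** The endpoints of the relations in the order of [rels9]; each relation is a combination of closed
    paths at one vertex. *)
Definition ends2_9 : seq (nat * nat) := [:: (3, 3); (1, 1); (2, 2); (0, 0)]%N.

(* The Fox derivative of the word [pre ++ s] with respect to the arrows in [s],
   for a word starting at the vertex [v]. *)
Fixpoint fox9 (v : nat) (pre s : seq nat) : seq (nat * (nat * nat)) :=
  if s is a :: s' then
    [seq (a, (p, q)) | p <- run9 [:: v] (v, pre), q <- run9 [:: tgt9 a] (tgt9 a, s')]
    ++ fox9 v (rcons pre a) s'
  else [::].

Definition gen0_9 (i : nat) : seq nat := [:: i].
(** This is a (x) e_t - e_s (x) a, up to the sign; [run9] looks up the code of the path a. *)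
Definition gen1_9 (a : nat) : seq (nat * (nat * nat)) :=
  let s := src9 a in let t := tgt9 a in
  flatten [seq [:: (t, (u, t)); (s, (s, u))] | u <- run9 [:: s] (s, [:: a])].
Definition gen2_9 (r : nat) : seq (nat * (nat * nat)) :=
  flatten [seq fox9 (nth (0, 0)%N ends2_9 r).1 [::] t | t <- nth [::] rels9 r].

(** As A and all P_n are projective right modules, the augmented resolution splits over A on the
    right. A contracting homotopy can therefore be right linear, given by its values on the elements
    b_u (x) e. *)
Definition right_linear9 (f : nat -> nat -> seq (nat * (nat * nat)))
    (t : nat * (nat * nat)) : seq (nat * (nat * nat)) :=
  flatten [seq [seq (x.1, (x.2.1, q)) | q <- mul9 x.2.2 t.2.2] | x <- f t.1 t.2.1].

Definition s_aug9 (u : nat) : seq (nat * (nat * nat)) :=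
  let s := (word 4 words9 u).1 in [:: (s, (s, u))].
(* As d_1 (fox w) = w (x) e - e (x) w for a path w, [s0_9] satisfies the homotopy
   identity on P_0.  On u a - sum of normal forms = sum of x r y, the difference
   of Fox derivatives is d_2 of the sum of x [r] y: this gives [s1_9]. *)
Definition s0_9 := right_linear9 (fun _ u =>
  let w := word 4 words9 u in fox9 w.1 [::] w.2).
Definition s1_9 := right_linear9 (fun a u =>
  let s := (word 4 words9 u).1 in
  let t r := (nth (0, 0)%N ends2_9 r).2 in
  flatten [seq [seq (c.1.2, (p, q)) | p <- run9 [:: s] (s, c.1.1),
      q <- run9 [:: t c.1.2] (t c.1.2, c.2)] | c <- cert9 u a]).
Definition s2_9 := right_linear9 (fun r u => lookup s2_table9 (r, u)).

Lemma idem9_check es : es \in [:: ends0_9; ends1_9; ends2_9] ->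
  all (idem_ok env_idx9 env_mul9) es.
Proof. by move: es; apply/allP; vm_compute. Qed.

Lemma hom9_check es : es \in [:: ends0_9; ends1_9; ends2_9] -> hom_ok idx9 act9 es.
Proof. by move: es; apply/allP; vm_compute. Qed.

Lemma resolution9_check : resolution_check env_idx9 idx9 env_mul9 act9
  ends0_9 ends1_9 ends2_9 ends0_9 gen0_9 gen1_9 gen2_9 (nth [::] d3_table9)
  s_aug9 s0_9 s1_9 s2_9.
Proof. by vm_compute. Qed.

(** * The cohomology of the explicit complex *)

Local Notation hidx9 := (hidx idx9 act9).
Local Notation codiff9 := (codiff_tab act9).

Lemma class0_check : class_check (hidx9 ends1_9) (hidx9 ends0_9) (hidx9 ends0_9)
  (codiff9 ends0_9 ends1_9 gen1_9) (fun=> [::]) 5 (fun=> [::]) (lookup up0_9)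
  (lookup class0_9) (nth [::] cocycle0_9).
Proof. by vm_compute. Qed.

Lemma class1_check : class_check (hidx9 ends2_9) (hidx9 ends1_9) (hidx9 ends0_9)
  (codiff9 ends1_9 ends2_9 gen2_9) (codiff9 ends0_9 ends1_9 gen1_9) 1
  (lookup up0_9) (lookup up1_9) (lookup class1_9) (nth [::] cocycle1_9).
Proof. by vm_compute. Qed.

Lemma class2_check : class_check (hidx9 ends0_9) (hidx9 ends2_9) (hidx9 ends1_9)
  (codiff9 ends2_9 ends0_9 (nth [::] d3_table9)) (codiff9 ends1_9 ends2_9 gen2_9) 2
  (lookup up1_9) (lookup up2_9) (lookup class2_9) (nth [::] cocycle2_9).
Proof. by vm_compute. Qed.

Theorem proposition6p4 (K : closedFieldType) (charK : 2%N \in [pchar K]) :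
  [/\ has_dim (HH 0 (Lambda9 K)) 5,
      has_dim (HH 1 (Lambda9 K)) 1
    & has_dim (HH 2 (Lambda9 K)) 2].
Proof.
pose bA := frame9 charK; have mulE := b9M charK.
pose bR := env_frame bA; pose bM := bimod_frame bA.
have mulRE := env_mulE (bA := bA) mulE.
have actE := bimod_actE (bA := bA) mulE.
have ok0 : all (idem_ok (fidx bR) env_mul9) ends0_9 by exact: idem9_check.
have ok1 : all (idem_ok (fidx bR) env_mul9) ends1_9 by exact: idem9_check.
have ok2 : all (idem_ok (fidx bR) env_mul9) ends2_9 by exact: idem9_check.
have hok0 : hom_ok (fidx bM) act9 ends0_9 by exact: hom9_check.
have hok1 : hom_ok (fidx bM) act9 ends1_9 by exact: hom9_check.
have hok2 : hom_ok (fidx bM) act9 ends2_9 by exact: hom9_check.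
split.
- exact: (Ext0_dim charK mulRE actE ok0 ok1 ok2 resolution9_check hok0 hok1
    class0_check).
- exact: (Ext1_dim charK mulRE actE ok0 ok1 ok2 resolution9_check hok0 hok1 hok2
    class1_check).
(* P_3 has the same idempotents as P_0, so [ok0] and [hok0] serve for it too. *)
exact: (Ext2_dim charK mulRE actE ok0 ok1 ok2 ok0 resolution9_check hok1 hok2
  hok0 class2_check).
Qed.
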